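(* For all positive integers $N, M$, the $C^*$-algebra $\mathscr{H}_{N,M}$ (the norm-closed algebra of operators on $L^2_{N,M}=L^2(\mathbb{T}^N\to\mathbb{C}^M)$ generated by the finite derivatives with rational steps and by the multiplication operators by $M\times M$-matrix-valued regulated functions with rational discontinuities) is $*$-isomorphic to the universal UHF $C^*$-algebra $\mathscr{U}$. Moreover, for all positive integers $N,M$ there is a unitary operator $\mathcal{U}_{N,M}: L^2_{1,1}\to L^2_{N,M}$ such that $$\mathscr{H}_{1,1}=\mathcal{U}_{N,M}^{-1}\,\mathscr{H}_{N,M}\,\mathcal{U}_{N,M}.$$
   Context: Let $N,M$ be positive integers and let $\mathbb{T}=\mathbb{R}/\mathbb{Z}\simeq[0,1)$. Hilbert space: $L^2_{N,M}=L^2(\mathbb{T}^N\to\mathbb{C}^M)$ is the Hilbert space of (periodic) square-integrable $\mathbb{C}^M$-valued functions on the torus $\mathbb{T}^N$, with respect to Lebesgue measure. $\mathscr{B}_{N,M}=\mathscr{B}(L^2_{N,M})$ is the $C^*$-algebra of bounded operators on $L^2_{N,M}$. Regulated functions: $R^\infty_{N,M}=R^\infty(\mathbb{T}^N\to\mathbb{C}^{M\times M})$ is the $C^*$-algebra of matrix-valued regulated functions with possible rational discontinuities, i.e. those functions $\mathbb{T}^N\to\mathbb{C}^{M\times M}$ that can be uniformly approximated by step functions of the form $$\mathbf{S}(\mathbf{x})=\sum_{n=1}^P\chi_{J_n}(\mathbf{x})\,\mathbf{S}_n,$$ where $P$ is a positive integer, $\mathbf{S}_n\in\mathbb{C}^{M\times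 M}$, and $\chi_{J_n}$ is the characteristic function of a parallelepiped $J_n=\prod_{i=1}^N[p_{in},q_{in})$ with rational end points $p_{in},q_{in}\in\mathbb{Q}/\mathbb{Z}\subset\mathbb{T}$ (half-open arcs of the circle; the full circle $[0,1)$ is allowed as a factor). Multiplication operators: for $\mathbf{S}\in R^\infty_{N,M}$, $\mathcal{M}_{\mathbf{S}}:L^2_{N,M}\to L^2_{N,M}$ is $\mathcal{M}_{\mathbf{S}}\mathbf{u}(\mathbf{x})=\mathbf{S}(\mathbf{x})\mathbf{u}(\mathbf{x})$. Finite derivatives: for $i\in\{1,\dots,N\}$ and $h\in\mathbb{Q}$, $h\neq0$, $\mathcal{D}_{i,h}:L^2_{N,M}\to L^2_{N,M}$ is $$\mathcal{D}_{i,h}\mathbf{u}(\mathbf{x})=\frac{\mathbf{u}(\mathbf{x}+h\mathbf{e}_i)-\mathbf{u}(\mathbf{x})}{h},\qquad \mathbf{x}\in\mathbb{T}^N,$$ where $\mathbf{e}_i$ is the $i$-th standard basis vector. The algebra: $\mathscr{H}_{N,M}$ is the operator-norm closure in $\mathscr{B}_{N,M}$ of the algebra generated by all $\mathcal{D}_{i,h}$ ($i\in\{1,\dots,N\}$, $h\in\mathbb{Q}$, $h\ne0$) and all $\mathcal{M}_{\mathbf{S}}$ ($\mathbf{S}\in R^\infty_{N,M}$). It is a unital $C^*$-subalgebra of $\mathscr{B}_{N,M}$. Universal UHF algebra: $\mathscr{U}$ is the $C^*$-algebra inductive limit of $$\mathbb{C}^{1\times1}\xrightarrow{\varphi_1}\mathbb{C}^{2\times2}\xrightarrow{\varphi_2}\mathbb{C}^{6\times6}\to\cdots\xrightarrow{\varphi_{n-1}}\mathbb{C}^{n!\times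 n!}\to\cdots,$$ where the $\varphi_n$ are unital $*$-embeddings; formally $\mathscr{U}=\bigotimes_{n=1}^\infty\mathbb{C}^{n\times n}$. Equivalently, it is the UHF algebra whose supernatural number contains every prime infinitely many times. *)

(* Defs.v *)
From HB Require Import structures.
From mathcomp Require Import all_boot all_order all_algebra.
From mathcomp Require Import complex.
From mathcomp Require mxtens.
From mathcomp Require Import all_classical all_reals all_analysis.
From mathcomp Require Import measurable_realfun.
From mathcomp Require Import ring lra.

Set Implicit Arguments.
Unset Strict Implicit.
Unset Printing Implicit Defensive.

Import Order.TTheory GRing.Theory Num.Theory.
Import numFieldNormedType.Exports.

Local Open Scope classical_set_scope.
Local Open Scope ring_scope.
Local Open Scope quotient_scope.

Local Open Scope sesquilinear_scope.
Local Notation Re := complex.Re.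
Local Notation Im := complex.Im.

(* R / Z, identified with [0, 1) *)
Definition circle (R : realType) : Type := {x : R | 0 <= x < 1}.

Definition circle_display : measure_display.
Proof. exact: default_measure_display. Qed.

Section circle.
Variable R : realType.

HB.instance Definition _ := SubType.on (circle R).
HB.instance Definition _ := Choice.on (circle R).

Lemma frac_itv (x : R) : 0 <= x - (Num.floor x)%:~R < 1.
Proof.
by have := floor_itv x; rewrite subr_ge0 ltrBlDr intrD addrC => /andP[-> ->].
Qed.

(* the projection R -> R/Z *)
Definition to_circle (x : R) : circle R := Sub (x - (Num.floor x)%:~R) (frac_itv x).

HB.instance Definition _ := isPointed.Build (circle R) (to_circle 0).

Let measurable_circle : set (set (circle R)) :=
  preimage_set_system setT (val : circle R -> measurableTypeR R) measurable.

Let circle_sigma : sigma_algebra setT measurable_circle.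
Proof. exact/sigma_algebra_preimage/sigma_algebra_measurable. Qed.

Let circle0 : measurable_circle set0.
Proof. by case: circle_sigma. Qed.

Let circleC A : measurable_circle A -> measurable_circle (~` A).
Proof. by case: circle_sigma => _ + _ => /[apply]; rewrite setTD. Qed.

Let circleU (F : (set (circle R))^nat) :
  (forall i, measurable_circle (F i)) -> measurable_circle (\bigcup_i F i).
Proof. by case: circle_sigma => _ _; exact. Qed.

HB.instance Definition _ := @isMeasurable.Build circle_display (circle R)
  measurable_circle circle0 circleC circleU.

Lemma measurable_to_circle :
  measurable_fun setT (to_circle : measurableTypeR R -> circle R).
Proof.
move=> _ _ [B mB <-]; rewrite !setTI.
suff /(_ measurableT B mB): measurable_fun setT
    (fun x : measurableTypeR R => x - (Num.floor x)%:~R : measurableTypeR R).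
  by rewrite setTI.
apply: measurable_funB; first exact: measurable_id.
apply: nondecreasing_measurable => // x y xy.
by rewrite ler_int le_floor.
Qed.

HB.instance Definition _ :=
  isMeasurableFun.Build _ _ _ _ (to_circle : measurableTypeR R -> circle R)
    measurable_to_circle.

Let itv01 : set (measurableTypeR R) := `[0, 1[%classic.

Let measurable_itv01 : measurable itv01.
Proof. exact: measurable_itv. Qed.

Definition unit_interval_measure : set (measurableTypeR R) -> \bar R :=
  mrestr lebesgue_measure measurable_itv01.

HB.instance Definition _ := Measure.on unit_interval_measure.

Let unit_interval_measureT : unit_interval_measure setT = 1%:E.
Proof.
rewrite /unit_interval_measure /mrestr setTI.
by rewrite /itv01 lebesgue_measure_itv /= lte_fin ltr01 sube0.
Qed.

HB.instance Definition _ := Measure_isProbability.Build _ _ _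
  unit_interval_measure unit_interval_measureT.

Definition circle_measure : probability (circle R) R :=
  distribution unit_interval_measure to_circle.

End circle.

Definition torus (R : realType) (N : nat) := N.-tuple (circle R).

Section torus.
Variable R : realType.

Definition torus_cons N (z : circle R * torus R N) : torus R N.+1 :=
  [the N.+1.-tuple (circle R) of z.1 :: z.2].

Lemma measurable_torus_cons N : measurable_fun setT (@torus_cons N).
Proof. exact: measurable_cons measurable_fst measurable_snd. Qed.

HB.instance Definition _ N := isMeasurableFun.Build _ _ _ _ (@torus_cons N)
  (@measurable_torus_cons N).

Fixpoint torus_measure N : probability (torus R N) R :=
  if N is N'.+1 then
    distribution (circle_measure R \x torus_measure N')%E (@torus_cons N')
  else \d_ ([tuple] : torus R 0).

Definition torus_shift N (i : 'I_N) (t : R) (x : torus R N) : torus R N :=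
  [tuple if j == i then to_circle (val (tnth x j) + t) else tnth x j | j < N].

(* The half-open arc from a to b; it is empty when b <= a and the whole circle
   when a + 1 <= b. *)
Definition arc (a b : rat) : set (circle R) :=
  [set to_circle t | t in `[ratr a, ratr b[].

Definition box N (a b : 'I_N -> rat) : set (torus R N) :=
  [set x | forall i, arc (a i) (b i) (tnth x i)].

End torus.

Section quotient_lmodule.
Variables (K : pzRingType) (V : lmodType K) (I : submodClosed V).

Definition submod_pred : {pred V} := I.

Let submod_pred_closed : submod_closed submod_pred.
Proof. by split=> [|a u v Iu Iv]; rewrite ?rpred0 ?rpredD ?rpredZ. Qed.

HB.instance Definition _ := GRing.isSubmodClosed.Build K V submod_pred
  submod_pred_closed.

Definition quotmod : Type := Quotient.quot submod_pred.
Local Notation Q := quotmod.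

HB.instance Definition _ := GRing.Zmodule.on Q.
HB.instance Definition _ := EqQuotient.on Q.

Lemma quotmod_eqP (u v : V) : reflect (u = v %[mod Q]) (u - v \in I).
Proof. by rewrite [X in reflect _ X](Quotient.idealrBE submod_pred); exact: eqP. Qed.

Definition quot_scale a := lift_op1 Q ( *:%R a : V -> V).

Lemma pi_quot_scale a : {morph \pi_Q : v / a *: v >-> quot_scale a v}.
Proof.
move=> v; unlock quot_scale.
by apply/quotmod_eqP; rewrite -scalerBr rpredZ//; apply/quotmod_eqP; rewrite reprK.
Qed.

Lemma quot_scaleA a b (v : Q) :
  quot_scale a (quot_scale b v) = quot_scale (a * b) v.
Proof. by rewrite -[v]reprK -!pi_quot_scale scalerA. Qed.

Lemma quot_scale1 : left_id 1 quot_scale.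
Proof. by move=> v; rewrite -[v]reprK -pi_quot_scale scale1r. Qed.

Lemma quot_scaleDr : right_distributive quot_scale +%R.
Proof.
move=> a u v; rewrite -[u]reprK -[v]reprK -raddfD -!pi_quot_scale -raddfD.
by rewrite scalerDr.
Qed.

Lemma quot_scaleDl (v : Q) :
  {morph quot_scale^~ v : a b / a + b}.
Proof.
by move=> a b; rewrite -[v]reprK -!pi_quot_scale -raddfD scalerDl.
Qed.

HB.instance Definition _ := GRing.Zmodule_isLmodule.Build K Q
  quot_scaleA quot_scale1 quot_scaleDr quot_scaleDl.

End quotient_lmodule.

Section euclidean_norm.
Variables (R : realType) (n : nat).
Implicit Types u v : 'cV[R[i]]_n.

Definition sqnorm v : R := \sum_j (Re (v j 0) ^+ 2 + Im (v j 0) ^+ 2).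

Definition vnorm v : R := Num.sqrt (sqnorm v).

Lemma sqnorm_ge0 v : 0 <= sqnorm v.
Proof. by apply: sumr_ge0 => j _; rewrite addr_ge0 ?sqr_ge0. Qed.

Lemma sqnormZ a v : sqnorm (a *: v) = (Re a ^+ 2 + Im a ^+ 2) * sqnorm v.
Proof.
rewrite /sqnorm mulr_sumr; apply: eq_bigr => j _; rewrite mxE.
by case: a (v j 0) => [a1 a2] [b1 b2] /=; ring.
Qed.

Lemma sqnormD u v : sqnorm (u + v) <= 2 * sqnorm u + 2 * sqnorm v.
Proof.
rewrite /sqnorm !mulr_sumr -big_split /=; apply: ler_sum => j _; rewrite mxE.
case: (u j 0) (v j 0) => [a1 a2] [b1 b2] /=.
have := sqr_ge0 (a1 - b1); have := sqr_ge0 (a2 - b2); nra.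
Qed.

End euclidean_norm.

Section square_integrable.
Variables (R : realType) (N M : nat).
Local Notation C := R[i].
Local Notation fT := (torus R N -> 'cV[C]_M).
Local Notation mu := (torus_measure R N).

Definition sqint_prop (f : fT) : Prop :=
  [/\ forall j, measurable_fun setT (fun x => Re (f x j 0)),
      forall j, measurable_fun setT (fun x => Im (f x j 0)) &
      (\int[mu]_x (sqnorm (f x))%:E < +oo)%E].

Definition sqint : {pred fT} := [pred f | `[< sqint_prop f >]].

Lemma measurable_sqnorm (f : fT) :
  (forall j, measurable_fun setT (fun x => Re (f x j 0))) ->
  (forall j, measurable_fun setT (fun x => Im (f x j 0))) ->
  measurable_fun setT (fun x => sqnorm (f x)).
Proof.
by move=> mR mI; apply: measurable_sum => j; apply: measurable_funD;
  apply: measurable_funX.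
Qed.

Lemma sqint_submod_closed : submod_closed sqint.
Proof.
split.
  apply/asboolP; split=> [j|j|].
  - by under eq_fun do rewrite mxE; exact: measurable_cst.
  - by under eq_fun do rewrite mxE; exact: measurable_cst.
  under eq_integral => x _.
    by rewrite -[X in sqnorm X](scale0r 0) sqnormZ !expr0n addr0 mul0r over.
  by rewrite integral0 ltry.
move=> a f g /asboolP[fR fI fi] /asboolP[gR gI gi].
have hR j : measurable_fun setT (fun x => Re ((a *: f + g) x j 0)).
  rewrite (_ : (fun _ => _) = fun x =>
    Re a * Re (f x j 0) - Im a * Im (f x j 0) + Re (g x j 0)).
    by apply: measurable_funD => //; apply: measurable_funB;
      apply: measurable_funM.
  apply/funext => x; rewrite !fctE !mxE.
  by case: a (f x j 0) (g x j 0) => [? ?] [? ?] [? ?].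
have hI j : measurable_fun setT (fun x => Im ((a *: f + g) x j 0)).
  rewrite (_ : (fun _ => _) = fun x =>
    Re a * Im (f x j 0) + Im a * Re (f x j 0) + Im (g x j 0)).
    by apply: measurable_funD => //; apply: measurable_funD;
      apply: measurable_funM.
  apply/funext => x; rewrite !fctE !mxE.
  by clear hR; case: a (f x j 0) (g x j 0) => [? ?] [? ?] [? ?].
apply/asboolP; split=> //.
set k := 2 * (Re a ^+ 2 + Im a ^+ 2).
have k0 : 0 <= k by rewrite mulr_ge0// addr_ge0 ?sqr_ge0.
have mf := measurable_sqnorm fR fI; have mg := measurable_sqnorm gR gI.
apply: (@le_lt_trans _ _
  (\int[mu]_x (k%:E * (sqnorm (f x))%:E + 2%:E * (sqnorm (g x))%:E))%E).
  apply: ge0_le_integral => //.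
  - by move=> x _; rewrite lee_fin sqnorm_ge0.
  - by apply/measurable_EFinP; exact: measurable_sqnorm.
  - by apply/measurable_EFinP; apply: measurable_funD; apply: measurable_funM.
  move=> x _; rewrite -!EFinM -EFinD lee_fin.
  by apply: le_trans (sqnormD _ _) _; rewrite sqnormZ mulrA.
rewrite ge0_integralD//=; first last.
- by apply/measurable_EFinP; apply: measurable_funM.
- by move=> x _; rewrite -EFinM lee_fin mulr_ge0 ?sqnorm_ge0.
- by apply/measurable_EFinP; apply: measurable_funM.
- by move=> x _; rewrite -EFinM lee_fin mulr_ge0 ?sqnorm_ge0.
have E h b : 0 <= b -> measurable_fun setT (fun x => sqnorm (h x : 'cV[C]_M)) ->
    (\int[mu]_x (b%:E * (sqnorm (h x))%:E) =
     b%:E * \int[mu]_x (sqnorm (h x))%:E)%E.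
  move=> b0 mh; rewrite ge0_integralZl//=; first exact/measurable_EFinP.
  by move=> x _; rewrite lee_fin sqnorm_ge0.
by rewrite !E// lte_add_pinfty// lte_mul_pinfty// ?lee_fin.
Qed.

HB.instance Definition _ := GRing.isSubmodClosed.Build C fT sqint
  sqint_submod_closed.

Record sqint_fun : Type := SqintFun {
  sqint_val :> fT;
  sqint_valP : sqint_val \in sqint }.

HB.instance Definition _ := [isSub for sqint_val].
HB.instance Definition _ := [Choice of sqint_fun by <:].
HB.instance Definition _ := [SubChoice_isSubLmodule of sqint_fun by <:].

Definition ae_zero : {pred sqint_fun} :=
  [pred f : sqint_fun | `[< {ae mu, forall x, f x = 0} >]].

Lemma ae_zero_submod_closed : submod_closed ae_zero.
Proof.
split; first by apply/asboolP/aeW => x.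
move=> a f g /asboolP f0 /asboolP g0; apply/asboolP.
move: f0 g0; apply: filterS2 => x fx gx.
by rewrite -[LHS]/(a *: f x + g x) fx gx scaler0 addr0.
Qed.

HB.instance Definition _ := GRing.isSubmodClosed.Build C sqint_fun ae_zero
  ae_zero_submod_closed.

Definition L2 : Type := quotmod (ae_zero : submodClosed _).

HB.instance Definition _ := GRing.Lmodule.on L2.

End square_integrable.

Definition opnorm_le (R : realType) (U V : Type) (nU : U -> R) (nV : V -> R)
  (f : U -> V) (k : R) : Prop := forall u, nV (f u) <= k * nU u.

Section matrix_norm.
Variable R : realType.
Local Notation C := R[i].

Definition mxnorm_le p q (A : 'M[C]_(p, q)) (k : R) : Prop :=
  opnorm_le (@vnorm R q) (@vnorm R p) (mulmx A) k.

Lemma vnorm_ge0 n (v : 'cV[C]_n) : 0 <= vnorm v.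
Proof. exact: sqrtr_ge0. Qed.

Lemma mxnorm_le_sq p q (A : 'M[C]_(p, q)) k : 0 <= k ->
  mxnorm_le A k <-> forall v, sqnorm (A *m v) <= k ^+ 2 * sqnorm v.
Proof.
move=> k0; split=> h v.
  have := h v; rewrite -(@ler_pXn2r _ 2) ?nnegrE ?mulr_ge0 ?vnorm_ge0//.
  by rewrite exprMn !sqr_sqrtr ?sqnorm_ge0.
rewrite -(@ler_pXn2r _ 2) ?nnegrE ?mulr_ge0 ?vnorm_ge0//.
by rewrite exprMn !sqr_sqrtr ?sqnorm_ge0.
Qed.

Lemma mxnorm_leW p q (A : 'M[C]_(p, q)) k l :
  k <= l -> mxnorm_le A k -> mxnorm_le A l.
Proof.
by move=> kl h v; apply: le_trans (h v) _; rewrite ler_wpM2r ?vnorm_ge0.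
Qed.

Lemma mxnorm_leD p q (A B : 'M[C]_(p, q)) k l : 0 <= k -> 0 <= l ->
  mxnorm_le A k -> mxnorm_le B l -> mxnorm_le (A + B) (2 * (k + l)).
Proof.
move=> k0 l0 /(mxnorm_le_sq _ k0) hA /(mxnorm_le_sq _ l0) hB.
apply/mxnorm_le_sq; first by rewrite mulr_ge0 ?addr_ge0.
move=> v; rewrite mulmxDl; apply: le_trans (sqnormD _ _) _.
have := hA v; have := hB v; have := sqnorm_ge0 v.
move: (sqnorm v) (sqnorm (A *m v)) (sqnorm (B *m v)) => x y z x0 zx yx.
have kx : 0 <= k ^+ 2 * x by rewrite mulr_ge0 ?sqr_ge0.
have lx : 0 <= l ^+ 2 * x by rewrite mulr_ge0 ?sqr_ge0.
have klx : 0 <= k * l * x by rewrite !mulr_ge0.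
nra.
Qed.

Lemma mxnorm_leZ p q (A : 'M[C]_(p, q)) a k : 0 <= k ->
  mxnorm_le A k -> mxnorm_le (a *: A) (Num.sqrt (Re a ^+ 2 + Im a ^+ 2) * k).
Proof.
move=> k0 /(mxnorm_le_sq _ k0) hA.
have a0 : 0 <= Re a ^+ 2 + Im a ^+ 2 by rewrite addr_ge0 ?sqr_ge0.
apply/mxnorm_le_sq; first by rewrite mulr_ge0 ?sqrtr_ge0.
move=> v; rewrite -scalemxAl sqnormZ exprMn sqr_sqrtr// -mulrA.
by rewrite ler_wpM2l.
Qed.

Lemma mxnorm_leM p q r (A : 'M[C]_(p, q)) (B : 'M[C]_(q, r)) k l : 0 <= k ->
  mxnorm_le A k -> mxnorm_le B l -> mxnorm_le (A *m B) (k * l).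
Proof.
move=> k0 hA hB v; rewrite -mulmxA; apply: le_trans (hA _) _.
by rewrite -mulrA ler_wpM2l.
Qed.

Lemma mxnorm_le0 p q k : 0 <= k -> mxnorm_le (0 : 'M[C]_(p, q)) k.
Proof.
move=> k0; apply/mxnorm_le_sq => // v; rewrite mul0mx.
by rewrite -(scale0r 0) sqnormZ !expr0n addr0 mul0r mulr_ge0 ?sqr_ge0 ?sqnorm_ge0.
Qed.

Lemma mxnorm_le1 n : mxnorm_le (1%:M : 'M[C]_n) 1.
Proof. by move=> v; rewrite mul1mx mul1r. Qed.

Lemma sqnorm_eq0 n (v : 'cV[C]_n) : sqnorm v = 0 -> v = 0.
Proof.
move=> /eqP; rewrite psumr_eq0 => [|j _]; last by rewrite addr_ge0 ?sqr_ge0.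
move=> /allP v0; apply/matrixP => j l; rewrite ord1 mxE.
have /= := v0 j (mem_index_enum _).
rewrite paddr_eq0 ?sqr_ge0// !sqrf_eq0.
by case: (v j 0) => a b /= /andP[/eqP-> /eqP->].
Qed.

Lemma sqnormE n (v : 'cV[C]_n) : sqnorm v = Re ((v^t* *m v) 0 0).
Proof.
rewrite mxE raddf_sum; apply: eq_bigr => j _; rewrite !mxE.
by case: (v j 0) => a b /=; ring.
Qed.

Lemma sqnormBZ n (a : R) (u v : 'cV[C]_n) :
  sqnorm (a%:C%C *: v - u) =
  a ^+ 2 * sqnorm v - 2 * a * Re ((v^t* *m u) 0 0) + sqnorm u.
Proof.
rewrite mxE raddf_sum /sqnorm !mulr_sumr -sumrB -big_split /=.
apply: eq_bigr => j _; rewrite !mxE.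
by case: (u j 0) (v j 0) => [u1 u2] [v1 v2] /=; ring.
Qed.

Lemma mxnorm_leT p q (A : 'M[C]_(p, q)) k : 0 <= k ->
  mxnorm_le A k -> mxnorm_le (A^t*) k.
Proof.
move=> k0 /(mxnorm_le_sq _ k0) hA; apply/mxnorm_le_sq => // v.
set w := A^t* *m v.
have e : v^t* *m (A *m w) = w^t* *m w.
  by rewrite mulmxA /w trmx_mul map_mxM trmxCK.
have := hA w; have := sqnormBZ (k ^+ 2) (A *m w) v.
have := sqnorm_ge0 ((k ^+ 2)%:C%C *: v - A *m w).
rewrite e -sqnormE => h0 h1; rewrite {}h1 in h0 => h2.
have [k_eq0|k_neq0] := eqVneq k 0; last first.
  have k2 : 0 < k ^+ 2 by rewrite exprn_gt0// lt_neqAle eq_sym k_neq0.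
  rewrite -(ler_pM2l k2); nra.
have /eqP Aw0 : sqnorm (A *m w) == 0.
  by rewrite eq_le sqnorm_ge0 andbT; apply: le_trans h2 _; rewrite k_eq0 expr0n mul0r.
by rewrite sqnormE -e (sqnorm_eq0 Aw0) mulmx0 mxE k_eq0 expr0n mul0r.
Qed.

End matrix_norm.

HB.mixin Record isStarAlgebra (K : numClosedFieldType) A
    of GRing.Algebra K A := {
  star : A -> A;
  starK : involutive star;
  starD : {morph star : a b / a + b};
  starM : forall a b, star (a * b) = star b * star a;
  starZ : forall c a, star (c *: a) = Num.conj c *: star a
}.

#[short(type="starAlgType")]
HB.structure Definition StarAlgebra (K : numClosedFieldType) :=
  {A of GRing.Algebra K A & isStarAlgebra K A}.

Definition unital_star_embedding (R : realType) p q
    (f : 'M[R[i]]_p -> 'M[R[i]]_q) : Prop :=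
  [/\ linear f, {morph f : a b / a *m b}, f 1%:M = 1%:M,
      {morph f : a / a^t*} & injective f].

(* A sequence C^(1 x 1) -> C^(2 x 2) -> C^(6 x 6) -> ..., numbered from 0: the
   n-th algebra is that of the matrices of size (n.+1)`! *)
Record uhf_system (R : realType) := UhfSystem {
  uhf_map :> forall n, 'M[R[i]]_((n.+1)`!) -> 'M[R[i]]_((n.+2)`!);
  uhf_mapP : forall n, unital_star_embedding (@uhf_map n) }.

Section matrix_sequences.
Variable R : realType.
Local Notation C := R[i].

Definition mxseq : Type := forall n, 'M[C]_((n.+1)`!).
Implicit Types a b c : mxseq.

HB.instance Definition _ := gen_eqMixin mxseq.
HB.instance Definition _ := gen_choiceMixin mxseq.

Let mxseqP a b : (forall n, a n = b n) -> a = b.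
Proof. exact: functional_extensionality_dep. Qed.

Definition mxseq_zero : mxseq := fun=> 0.
Definition mxseq_opp a : mxseq := fun n => - a n.
Definition mxseq_add a b : mxseq := fun n => a n + b n.
Definition mxseq_one : mxseq := fun=> 1%:M.
Definition mxseq_mul a b : mxseq := fun n => a n *m b n.
Definition mxseq_scale (k : C) a : mxseq := fun n => k *: a n.

Fact mxseq_addA : associative mxseq_add.
Proof. by move=> a b c; apply: mxseqP => n; exact: addrA. Qed.
Fact mxseq_addC : commutative mxseq_add.
Proof. by move=> a b; apply: mxseqP => n; exact: addrC. Qed.
Fact mxseq_add0 : left_id mxseq_zero mxseq_add.
Proof. by move=> a; apply: mxseqP => n; exact: add0r. Qed.
Fact mxseq_addN : left_inverse mxseq_zero mxseq_opp mxseq_add.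
Proof. by move=> a; apply: mxseqP => n; exact: addNr. Qed.

HB.instance Definition _ := GRing.isZmodule.Build mxseq
  mxseq_addA mxseq_addC mxseq_add0 mxseq_addN.

Fact mxseq_mulA : associative mxseq_mul.
Proof. by move=> a b c; apply: mxseqP => n; exact: mulmxA. Qed.
Fact mxseq_mul1l : left_id mxseq_one mxseq_mul.
Proof. by move=> a; apply: mxseqP => n; exact: mul1mx. Qed.
Fact mxseq_mul1r : right_id mxseq_one mxseq_mul.
Proof. by move=> a; apply: mxseqP => n; exact: mulmx1. Qed.
Fact mxseq_mulDl : left_distributive mxseq_mul +%R.
Proof. by move=> a b c; apply: mxseqP => n; exact: mulmxDl. Qed.
Fact mxseq_mulDr : right_distributive mxseq_mul +%R.
Proof. by move=> a b c; apply: mxseqP => n; exact: mulmxDr. Qed.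
Fact mxseq_one_neq0 : mxseq_one != 0.
Proof.
apply/eqP => /(congr1 (fun a : mxseq => a 0%N ord0 ord0)) /eqP.
by rewrite !mxE eqxx oner_eq0.
Qed.

HB.instance Definition _ := GRing.Zmodule_isNzRing.Build mxseq mxseq_mulA
  mxseq_mul1l mxseq_mul1r mxseq_mulDl mxseq_mulDr mxseq_one_neq0.

Fact mxseq_scaleA k l a : mxseq_scale k (mxseq_scale l a) = mxseq_scale (k * l) a.
Proof. by apply: mxseqP => n; exact: scalerA. Qed.
Fact mxseq_scale1 : left_id 1 mxseq_scale.
Proof. by move=> a; apply: mxseqP => n; exact: scale1r. Qed.
Fact mxseq_scaleDr : right_distributive mxseq_scale +%R.
Proof. by move=> k a b; apply: mxseqP => n; exact: scalerDr. Qed.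
Fact mxseq_scaleDl a : {morph mxseq_scale^~ a : k l / k + l}.
Proof. by move=> k l; apply: mxseqP => n; exact: scalerDl. Qed.

HB.instance Definition _ := GRing.Zmodule_isLmodule.Build C mxseq
  mxseq_scaleA mxseq_scale1 mxseq_scaleDr mxseq_scaleDl.

Fact mxseq_scaleAl (k : C) (a b : mxseq) : k *: (a * b) = k *: a * b.
Proof. by apply: mxseqP => n; exact: scalemxAl. Qed.
Fact mxseq_scaleAr (k : C) (a b : mxseq) : k *: (a * b) = a * (k *: b).
Proof. by apply: mxseqP => n; exact: scalemxAr. Qed.

HB.instance Definition _ := GRing.Lmodule_isLalgebra.Build C mxseq mxseq_scaleAl.
HB.instance Definition _ := GRing.Lalgebra_isAlgebra.Build C mxseq mxseq_scaleAr.

Definition mxseq_star a : mxseq := fun n => (a n)^t*.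

Lemma adjmxK p q : cancel (fun A : 'M[C]_(p, q) => A^t*) (fun A => A^t*).
Proof. by move=> A; rewrite trmxCK. Qed.
Lemma adjmxD p q : {morph (fun A : 'M[C]_(p, q) => A^t*) : A B / A + B}.
Proof. by move=> A B; rewrite linearD /= map_mxD. Qed.
Lemma adjmxB p q : {morph (fun A : 'M[C]_(p, q) => A^t*) : A B / A - B}.
Proof. by move=> A B; rewrite linearB /= map_mxB. Qed.

Fact mxseq_starK : involutive mxseq_star.
Proof. by move=> a; apply: mxseqP => n; exact: adjmxK. Qed.
Fact mxseq_starD : {morph mxseq_star : a b / a + b}.
Proof. by move=> a b; apply: mxseqP => n; exact: adjmxD. Qed.
Fact mxseq_starM a b : mxseq_star (a * b) = mxseq_star b * mxseq_star a.
Proof. by apply: mxseqP => n; rewrite /mxseq_star trmx_mul map_mxM. Qed.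
Fact mxseq_starZ (k : C) a : mxseq_star (k *: a) = Num.conj k *: mxseq_star a.
Proof. by apply: mxseqP => n; rewrite /mxseq_star linearZ /= map_mxZ. Qed.

HB.instance Definition _ := isStarAlgebra.Build C mxseq
  mxseq_starK mxseq_starD mxseq_starM mxseq_starZ.

End matrix_sequences.

Section inductive_limit.
Variables (R : realType) (phi : uhf_system R).
Local Notation C := R[i].
Implicit Types a b : mxseq R.

(* the composite phi_(k+n-1) o ... o phi_n *)
Fixpoint uhf_push n (A : 'M[C]_((n.+1)`!)) k : 'M[C]_(((k + n).+1)`!) :=
  if k is k'.+1 then @phi (k' + n)%N (uhf_push A k') else A.

Lemma uhf_pushL n c (A B : 'M[C]_((n.+1)`!)) k :
  uhf_push (c *: A + B) k = c *: uhf_push A k + uhf_push B k.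
Proof.
elim: k => //= k ->; have [phiL _ _ _ _] := uhf_mapP phi (k + n).
exact: phiL.
Qed.

Lemma uhf_pushM n (A B : 'M[C]_((n.+1)`!)) k :
  uhf_push (A *m B) k = uhf_push A k *m uhf_push B k.
Proof.
elim: k => //= k ->; have [_ phiM _ _ _] := uhf_mapP phi (k + n).
exact: phiM.
Qed.

Lemma uhf_push1 n k : uhf_push (1%:M : 'M[C]_((n.+1)`!)) k = 1%:M.
Proof. by elim: k => //= k ->; have [] := uhf_mapP phi (k + n). Qed.

Lemma uhf_push_star n (A : 'M[C]_((n.+1)`!)) k :
  uhf_push (A^t*) k = (uhf_push A k)^t*.
Proof.
elim: k => //= k ->; have [_ _ _ phiS _] := uhf_mapP phi (k + n).
exact: phiS.
Qed.

(* The inductive limit of (phi n) is realized inside the quotient of the algebra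
   of bounded sequences a n : 'M_((n.+1)`!) by the ideal of the sequences that
   tend to 0 in operator norm, as the closure of the union of the images of the
   sequences (uhf_push A k)_k. Such limits are exactly the classes of the
   bounded sequences a such that the distance from a (k + m) to uhf_push (a m) k
   tends to 0 as m goes to infinity, uniformly in k. *)
Definition uhf_coherent a : Prop :=
  (exists K, forall n, mxnorm_le (a n) K) /\
  forall e, 0 < e -> exists n, forall m k, (n <= m)%N ->
    mxnorm_le (a (k + m)%N - uhf_push (a m) k) e.

Definition uhf_seq : {pred mxseq R} := [pred a | `[< uhf_coherent a >]].

Lemma uhf_boundedP a : uhf_coherent a ->
  exists2 K, 0 < K & forall n, mxnorm_le (a n) K.
Proof.
move=> [[K aK] _]; exists (Num.max 1 K); first by rewrite lt_max ltr01.
by move=> n; apply: mxnorm_leW (aK n); rewrite le_max lexx orbT.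
Qed.

Lemma uhf_subalg_closed : subalg_closed uhf_seq.
Proof.
split.
- apply/asboolP; split; first by exists 1 => n; exact: mxnorm_le1.
  move=> e e0; exists 0%N => m k _.
  by rewrite uhf_push1 subrr; apply: mxnorm_le0; exact: ltW.
- move=> c a b /asboolP ha /asboolP hb; apply/asboolP.
  have [[K K0 aK] [L L0 bL]] := (uhf_boundedP ha, uhf_boundedP hb).
  case: ha hb => [_ ha] [_ hb].
  set s := Num.sqrt (Re c ^+ 2 + Im c ^+ 2).
  have s0 : 0 <= s by exact: sqrtr_ge0.
  split.
    exists (2 * (s * K + L)) => n.
    rewrite -[X in mxnorm_le X]/(c *: a n + b n); apply: mxnorm_leD; rewrite ?(ltW L0)//.
      by rewrite mulr_ge0// ltW.
    exact: (mxnorm_leZ c (ltW K0) (aK n)).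
  move=> e e0; have d0 : 0 < e / (2 * (s + 1)).
    by rewrite divr_gt0// mulr_gt0// ltr_wpDl.
  have [n1 h1] := ha _ d0; have [n2 h2] := hb _ d0.
  exists (maxn n1 n2) => m k; rewrite geq_max => /andP[n1m n2m].
  rewrite uhf_pushL.
  rewrite -[X in X - _]/(c *: a (k + m)%N + b (k + m)%N).
  rewrite opprD addrACA -scalerBr.
  have -> : e = 2 * (s * (e / (2 * (s + 1))) + e / (2 * (s + 1))).
    by field; rewrite gt_eqF// ltr_wpDl.
  apply: mxnorm_leD.
  - exact: mulr_ge0 s0 (ltW d0).
  - exact: ltW.
  - by apply: mxnorm_leZ; [exact: ltW|exact: h1].
  - exact: h2.
- move=> a b /asboolP ha /asboolP hb; apply/asboolP.
  have [[K K0 aK] [L L0 bL]] := (uhf_boundedP ha, uhf_boundedP hb).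
  case: ha hb => [_ ha] [_ hb]; split.
    by exists (K * L) => n; apply: mxnorm_leM => //; exact: ltW.
  move=> e e0.
  pose d := Num.min 1 (e / (2 * (L + 2 * (K + 1)))).
  have D0 : 0 < 2 * (L + 2 * (K + 1)) by rewrite mulr_gt0// !(addr_gt0, mulr_gt0).
  have d0 : 0 < d by rewrite lt_min ltr01 divr_gt0.
  have [n1 h1] := ha _ d0; have [n2 h2] := hb _ d0.
  exists (maxn n1 n2) => m k; rewrite geq_max => /andP[n1m n2m].
  rewrite uhf_pushM -[X in X - _]/(a (k + m)%N *m b (k + m)%N).
  set A := a (k + m)%N; set B := b (k + m)%N.
  set A' := uhf_push _ k; set B' := uhf_push _ k.
  have hA : mxnorm_le (A - A') d by exact: h1.
  have hB : mxnorm_le (B - B') d by exact: h2.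
  have hA' : mxnorm_le A' (2 * (K + 1)).
    have -> : A' = A + (-1) *: (A - A') by rewrite scaleN1r opprB addrC subrK.
    apply: (mxnorm_leD (ltW K0) ler01); first exact: aK.
    have := mxnorm_leZ (-1) (ltW d0) hA.
    rewrite /= oppr0 expr0n addr0 sqrrN expr1n sqrtr1 mul1r.
    by apply: mxnorm_leW; rewrite ge_min lexx.
  have -> : A *m B - A' *m B' = (A - A') *m B + A' *m (B - B').
    by rewrite mulmxBl mulmxBr addrA subrK.
  apply: (@mxnorm_leW _ _ _ _ (2 * (d * L + 2 * (K + 1) * d))).
    rewrite (mulrC d) -mulrDl mulrA -ler_pdivlMl// mulrC.
    by rewrite ge_min lexx orbT.
  apply: mxnorm_leD.
  - by rewrite mulr_ge0// ltW.
  - by rewrite mulr_ge0// ?ltW// mulr_gt0// addr_gt0.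
  - by apply: mxnorm_leM; [exact: ltW|exact: hA|exact: bL].
  - by apply: mxnorm_leM => //; rewrite mulr_ge0// addr_ge0// ltW.
Qed.

HB.instance Definition _ := GRing.isSubalgClosed.Build C (mxseq R) uhf_seq
  uhf_subalg_closed.

Lemma uhf_star_closed a : a \in uhf_seq -> star a \in uhf_seq.
Proof.
move=> /asboolP ha; apply/asboolP; have [K K0 aK] := uhf_boundedP ha.
case: ha => [_ ha]; split.
  by exists K => n; apply: mxnorm_leT => //; exact: ltW.
move=> e e0; have [n h] := ha e e0; exists n => m k nm.
rewrite uhf_push_star -[X in X - _]/((a (k + m)%N)^t*) -adjmxB.
by apply: mxnorm_leT; [exact: ltW|exact: h].
Qed.

Record uhf_fun : Type := UhfFun {
  uhf_val :> mxseq R;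
  uhf_valP : uhf_val \in uhf_seq }.

HB.instance Definition _ := [isSub for uhf_val].
HB.instance Definition _ := [Choice of uhf_fun by <:].
HB.instance Definition _ := [SubChoice_isSubAlgebra of uhf_fun by <:].

Definition uhf_null : {pred uhf_fun} := [pred a : uhf_fun |
  `[< forall e, 0 < e -> exists n, forall m, (n <= m)%N -> mxnorm_le (uhf_val a m) e >]].

Lemma uhf_null_submod_closed : submod_closed uhf_null.
Proof.
split.
  apply/asboolP => e e0; exists 0%N => m _.
  by apply: mxnorm_le0; exact: ltW.
move=> c a b /asboolP ha /asboolP hb; apply/asboolP => e e0.
set s := Num.sqrt (Re c ^+ 2 + Im c ^+ 2).
have s0 : 0 <= s by exact: sqrtr_ge0.
have d0 : 0 < e / (2 * (s + 1)) by rewrite divr_gt0// mulr_gt0// ltr_wpDl.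
have [n1 h1] := ha _ d0; have [n2 h2] := hb _ d0.
exists (maxn n1 n2) => m; rewrite geq_max => /andP[n1m n2m].
have -> : e = 2 * (s * (e / (2 * (s + 1))) + e / (2 * (s + 1))).
  by field; rewrite gt_eqF// ltr_wpDl.
rewrite -[X in mxnorm_le X]/(c *: uhf_val a m + uhf_val b m); apply: mxnorm_leD.
- exact: mulr_ge0 s0 (ltW d0).
- exact: ltW.
- by apply: mxnorm_leZ; [exact: ltW|exact: h1].
- exact: h2.
Qed.

HB.instance Definition _ := GRing.isSubmodClosed.Build C uhf_fun uhf_null
  uhf_null_submod_closed.

Lemma uhf_nullMl (a b : uhf_fun) : b \in uhf_null -> a * b \in uhf_null.
Proof.
move=> /asboolP hb; apply/asboolP => e e0.
have /asboolP/uhf_boundedP[K K0 aK] := uhf_valP a.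
have [n h] := hb _ (divr_gt0 e0 K0); exists n => m nm.
rewrite -[X in mxnorm_le X]/(uhf_val a m *m uhf_val b m).
have -> : e = K * (e / K) by rewrite mulrC divfK// gt_eqF.
by apply: (mxnorm_leM (ltW K0)); [exact: aK|exact: h].
Qed.

Lemma uhf_nullMr (a b : uhf_fun) : a \in uhf_null -> a * b \in uhf_null.
Proof.
move=> /asboolP ha; apply/asboolP => e e0.
have /asboolP/uhf_boundedP[K K0 bK] := uhf_valP b.
have [n h] := ha _ (divr_gt0 e0 K0); exists n => m nm.
rewrite -[X in mxnorm_le X]/(uhf_val a m *m uhf_val b m).
have -> : e = e / K * K by rewrite divfK// gt_eqF.
apply: mxnorm_leM; [by rewrite ltW// divr_gt0|exact: h|exact: bK].
Qed.

Lemma uhf_null1 : 1 \notin uhf_null.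
Proof.
apply/negP => /asboolP /(_ (2^-1)) [|n /(_ n (leqnn n))]; first by rewrite invr_gt0.
move=> /(mxnorm_le_sq _ _) => /(_ (ltW _)) h.
have /h/(_ (delta_mx (Ordinal (fact_gt0 n.+1)) 0)) : 0 < 2^-1 :> R by rewrite invr_gt0.
rewrite -[X in X *m _]/(1%:M : 'M[C]_((n.+1)`!)) mul1mx; apply/negP; rewrite -ltNge.
rewrite -[ltRHS]mul1r ltr_pM2r; first by rewrite expr_lt1// invf_lt1// ltr1n.
rewrite lt_neqAle sqnorm_ge0 andbT eq_sym; apply/eqP => /sqnorm_eq0.
move=> /matrixP/(_ (Ordinal (fact_gt0 n.+1)) 0) /eqP.
by rewrite !mxE !eqxx oner_eq0.
Qed.

Definition uhf_fun_star (a : uhf_fun) : uhf_fun :=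
  UhfFun (uhf_star_closed (uhf_valP a)).

Lemma uhf_null_star (a : uhf_fun) : a \in uhf_null -> uhf_fun_star a \in uhf_null.
Proof.
move=> /asboolP ha; apply/asboolP => e e0; have [n h] := ha _ e0.
by exists n => m nm; apply: mxnorm_leT; [exact: ltW|exact: h].
Qed.

Definition uhf : Type := quotmod uhf_null.

HB.instance Definition _ := GRing.Lmodule.on uhf.
HB.instance Definition _ := EqQuotient.on uhf.

Lemma uhf_eqP (a b : uhf_fun) : reflect (a = b %[mod uhf]) (a - b \in uhf_null).
Proof. exact: (quotmod_eqP uhf_null). Qed.

Definition uhf_one : uhf := lift_cst uhf 1.
Definition uhf_mul := lift_op2 uhf *%R.
Definition uhf_star := lift_op1 uhf uhf_fun_star.

Lemma pi_uhf_mul : {morph \pi_uhf : a b / a * b >-> uhf_mul a b}.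
Proof.
move=> a b; unlock uhf_mul; apply/uhf_eqP.
rewrite -[a * b](subrK (a * repr (\pi_uhf b))) -mulrBr -addrA -mulrBl.
apply: (@rpredD uhf_fun uhf_null).
  by apply: uhf_nullMl; apply/uhf_eqP; rewrite reprK.
by apply: uhf_nullMr; apply/uhf_eqP; rewrite reprK.
Qed.

Lemma pi_uhf_star : {morph \pi_uhf : a / uhf_fun_star a >-> uhf_star a}.
Proof.
move=> a; unlock uhf_star; apply/uhf_eqP.
rewrite (_ : _ - _ = uhf_fun_star (a - repr (\pi_uhf a))).
  by apply: uhf_null_star; apply/uhf_eqP; rewrite reprK.
by apply: val_inj; apply: functional_extensionality_dep => n;
  rewrite /= [RHS]adjmxB.
Qed.

Lemma pi_uhf_one : \pi_uhf 1 = uhf_one.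
Proof. by rewrite /uhf_one; unlock. Qed.

Fact uhf_mulA : associative uhf_mul.
Proof.
by move=> a b c; rewrite -[a]reprK -[b]reprK -[c]reprK -!pi_uhf_mul mulrA.
Qed.
Fact uhf_mul1l : left_id uhf_one uhf_mul.
Proof. by move=> a; rewrite -[a]reprK -pi_uhf_one -pi_uhf_mul mul1r. Qed.
Fact uhf_mul1r : right_id uhf_one uhf_mul.
Proof. by move=> a; rewrite -[a]reprK -pi_uhf_one -pi_uhf_mul mulr1. Qed.
Fact uhf_mulDl : left_distributive uhf_mul +%R.
Proof.
move=> a b c; rewrite -[a]reprK -[b]reprK -[c]reprK.
by rewrite -raddfD -!pi_uhf_mul -raddfD mulrDl.
Qed.
Fact uhf_mulDr : right_distributive uhf_mul +%R.
Proof.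
move=> a b c; rewrite -[a]reprK -[b]reprK -[c]reprK.
by rewrite -raddfD -!pi_uhf_mul -raddfD mulrDr.
Qed.
Fact uhf_one_neq0 : uhf_one != 0.
Proof.
rewrite -pi_uhf_one -(raddf0 \pi_uhf); apply/eqP => /uhf_eqP.
by rewrite subr0; apply/negP/uhf_null1.
Qed.

HB.instance Definition _ := GRing.Zmodule_isNzRing.Build uhf uhf_mulA
  uhf_mul1l uhf_mul1r uhf_mulDl uhf_mulDr uhf_one_neq0.

Lemma pi_uhf_mulE (a b : uhf_fun) :
  \pi_uhf (a * b) = \pi_uhf a * \pi_uhf b :> uhf.
Proof. exact: pi_uhf_mul. Qed.

Lemma pi_uhf_scale (k : C) (a : uhf_fun) : \pi_uhf (k *: a) = k *: \pi_uhf a.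
Proof. exact: (pi_quot_scale uhf_null). Qed.

Fact uhf_scaleAl (k : C) (a b : uhf) : k *: (a * b) = k *: a * b.
Proof.
rewrite -[a]reprK -[b]reprK -!(pi_uhf_scale, pi_uhf_mulE).
by rewrite scalerAl.
Qed.
Fact uhf_scaleAr (k : C) (a b : uhf) : k *: (a * b) = a * (k *: b).
Proof.
rewrite -[a]reprK -[b]reprK -!(pi_uhf_scale, pi_uhf_mulE).
by rewrite scalerAr.
Qed.

HB.instance Definition _ := GRing.Lmodule_isLalgebra.Build C uhf uhf_scaleAl.
HB.instance Definition _ := GRing.Lalgebra_isAlgebra.Build C uhf uhf_scaleAr.

Fact uhf_starK : involutive uhf_star.
Proof.
move=> a; rewrite -[a]reprK -!pi_uhf_star; congr (\pi_uhf _).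
exact/val_inj/mxseq_starK.
Qed.
Fact uhf_starD : {morph uhf_star : a b / a + b}.
Proof.
move=> a b; rewrite -[a]reprK -[b]reprK -raddfD -!pi_uhf_star -raddfD.
congr (\pi_uhf _); exact/val_inj/mxseq_starD.
Qed.
Fact uhf_starM (a b : uhf) : uhf_star (a * b) = uhf_star b * uhf_star a.
Proof.
rewrite -[a]reprK -[b]reprK -pi_uhf_mulE -!pi_uhf_star -pi_uhf_mulE.
congr (\pi_uhf _); exact/val_inj/mxseq_starM.
Qed.
Fact uhf_starZ (k : C) (a : uhf) : uhf_star (k *: a) = Num.conj k *: uhf_star a.
Proof.
rewrite -[a]reprK -pi_uhf_scale -!pi_uhf_star -pi_uhf_scale.
congr (\pi_uhf _); exact/val_inj/mxseq_starZ.
Qed.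

HB.instance Definition _ := isStarAlgebra.Build C uhf
  uhf_starK uhf_starD uhf_starM uhf_starZ.

End inductive_limit.

(* The connecting maps A |-> 1 (x) A of the infinite tensor product; in
   particular, uhf_system R is inhabited. *)
Section uhf_tensor_system.
Variable R : realType.
Local Notation C := R[i].

Definition uhf_tens_map n (A : 'M[C]_((n.+1)`!)) : 'M[C]_((n.+2)`!) :=
  mxtens.tensmx (1%:M : 'M[C]_n.+2) A.

Lemma uhf_tens_mapP n : unital_star_embedding (@uhf_tens_map n).
Proof.
split.
- move=> c A B; apply/matrixP => i j; rewrite /uhf_tens_map !mxE.
  by rewrite mulrDr mulrCA.
- by move=> A B; rewrite /uhf_tens_map [RHS]mxtens.tensmx_mul mulmx1.
- apply/matrixP => i j.
  rewrite /uhf_tens_map !mxE -natrM mulnb; congr (_%:R); congr nat_of_bool.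
  apply/andP/eqP => [[/eqP i1 /eqP i2]|->//].
  rewrite -(@mxtens.mxtens_unindexK _ _ i) -(@mxtens.mxtens_unindexK _ _ j).
  by congr (mxtens.mxtens_index _); rewrite [LHS]surjective_pairing i1 i2.
- by move=> A; rewrite /uhf_tens_map mxtens.trmx_tens mxtens.map_mxT
    trmx1 map_mx1.
- move=> A B /matrixP AB; apply/matrixP => i j.
  have := AB (mxtens.mxtens_index (ord0, i)) (mxtens.mxtens_index (ord0, j)).
  by rewrite !mxtens.tensmxE mxE eqxx !mul1r.
Qed.

Definition uhf_tensor_system : uhf_system R := UhfSystem uhf_tens_mapP.

End uhf_tensor_system.

Section L2_space.
Variables (R : realType) (N M : nat).
Local Notation C := R[i].
Local Notation mu := (torus_measure R N).
Local Notation L2 := (L2 R N M).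

(* A representative of u; the constructions below do not depend on its choice. *)
Definition L2_fun (u : L2) : torus R N -> 'cV[C]_M := repr u.

(* The class of f; the default value 0 is only used for functions f that are not
   square-integrable. *)
Definition L2_class (f : torus R N -> 'cV[C]_M) : L2 :=
  \pi_L2 (insubd (0 : sqint_fun R N M) f).

Definition L2_norm (u : L2) : R :=
  Num.sqrt (\int[mu]_x sqnorm (L2_fun u x)).

Definition L2_dot (u v : L2) : C :=
  let uv x := \sum_j L2_fun u x j 0 * Num.conj (L2_fun v x j 0) in
  Complex (\int[mu]_x Re (uv x)) (\int[mu]_x Im (uv x)).

Definition bounded_ops : set (L2 -> L2) :=
  [set A | linear A /\ exists k, opnorm_le L2_norm L2_norm A k].

Definition is_adjoint (A B : L2 -> L2) : Prop :=
  forall u v, L2_dot (A u) v = L2_dot u (B v).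

Definition finite_derivative (i : 'I_N) (h : rat) (u : L2) : L2 :=
  L2_class (fun x =>
    (ratr h)^-1 *: (L2_fun u (torus_shift i (ratr h) x) - L2_fun u x)).

Definition step_fun (S : torus R N -> 'M[C]_M) : Prop :=
  exists (P : nat) (p q : 'I_P -> 'I_N -> rat) (s : 'I_P -> 'M[C]_M),
    (0 < P)%N /\
    forall x, S x = \sum_(n < P) \1_(box (p n) (q n)) x *: s n.

Definition regulated (S : torus R N -> 'M[C]_M) : Prop :=
  forall e, 0 < e ->
    exists2 S', step_fun S' & forall x, mxnorm_le (S x - S' x) e.

Definition multiplication_op (S : torus R N -> 'M[C]_M) (u : L2) : L2 :=
  L2_class (fun x => S x *m L2_fun u x).

Definition op_subalgebra (X : set (L2 -> L2)) : Prop :=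
  [/\ X 0, forall (c : C) A B, X A -> X B -> X (c *: A + B) &
      forall A B, X A -> X B -> X (A \o B)].

Definition H_generators : set (L2 -> L2) :=
  [set A | exists i h, h != 0 /\ A = finite_derivative i h] `|`
  [set A | exists2 S, regulated S & A = multiplication_op S].

Definition op_norm_closure (X : set (L2 -> L2)) : set (L2 -> L2) :=
  [set A | bounded_ops A /\ forall e, 0 < e ->
     exists2 B, X B & opnorm_le L2_norm L2_norm (A - B) e].

Definition H_algebra : set (L2 -> L2) :=
  op_norm_closure (smallest op_subalgebra H_generators).

(* A *-isomorphism of an abstract *-algebra onto a *-algebra X of operators, the
   involution of X being the Hilbert space adjoint. *)
Definition star_isomorphism (A : starAlgType C) (X : set (L2 -> L2))
    (f : A -> (L2 -> L2)) : Prop :=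
  [/\ linear f, forall a b, f (a * b) = f a \o f b,
      forall a, is_adjoint (f a) (f (star a)) & set_bij [set: A] X f].

Definition star_isomorphic (X : set (L2 -> L2)) (A : starAlgType C) : Prop :=
  exists f : A -> (L2 -> L2), star_isomorphism X f.

End L2_space.

Arguments H_algebra : clear implicits.

Definition unitary_op (R : realType) (N M N' M' : nat)
    (W : L2 R N M -> L2 R N' M') : Prop :=
  [/\ linear W, forall u v, L2_dot (W u) (W v) = L2_dot u v & bijective W].

(* Main.v *)
Require Import Defs.
From HB Require Import structures.
From mathcomp Require Import all_boot all_order all_algebra.
From mathcomp Require Import complex.
From mathcomp Require Import all_classical all_reals all_analysis.
From mathcomp Require Import measurable_realfun.
From mathcomp Require Import ring lra zify.

(** Both claims follow from one description of the algebra.  Cut the torus into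
    m ^ N cells of side 1 / m.  For two pairs x, y of a cell and a component of
    C ^ M, the partial shift from y to x translates the component y.2 on the
    cell y.1 to the component x.2 on the cell x.1.  These m ^ N * M pairs index
    a full system of matrix units, and when m divides m' every partial shift of
    mesh 1 / m is a sum of partial shifts of mesh 1 / m'.  Hence, along a chain
    m l of meshes in which every positive integer divides some m l, the partial
    shifts span an increasing union of full matrix algebras of sizes m l ^ N * M.

    The norm closure of this union is the algebra generated by finite
    derivatives and multiplications ([H_algebraE]).  A translation by a rational
    vector permutes the cells of a fine mesh, and multiplication by a step
    function with rational jumps is constant on each of them, so both are
    combinations of partial shifts; regulated functions are uniform limits of
    step functions.  Conversely a partial shift is the composite of a rational
    translation, which is a product of operators 1 + h D, with multiplication by
    a matrix supported on one cell.

    Only the sizes of the matrix algebras matter.  The record [munits] collects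
    what is used of the chain on the Hilbert space: matrix units that refine one
    another, and the normalized indicators of the cells, which the matrix units
    permute and whose linear combinations are dense.  The inner products of
    these combinations depend on the sizes alone, so two chains of the same
    sizes are intertwined by a unitary operator ([unitary_equivalence]).  The
    sizes (l+1)! ^ N * M are those of the meshes (l+1)! in dimension N with M
    components, and also those of the meshes (l+1)! ^ N * M on the circle with
    one component; this gives the unitary operator of the theorem.

    For the circle with meshes (l+1)! the sizes are the factorials.  Two unital
    *-homomorphisms between full matrix algebras are unitarily conjugate
    ([unitary_equivalent]), so that arbitrary connecting maps of the inductive
    limit can be turned into the refinement of matrix units by a unitary at each
    level.  The representations of the levels then fit together, and they
    extend to an isomorphism of the limit algebra onto the norm closure
    ([uhf_isomorphism]) because each of them is isometric.  Conjugation by the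
    unitary operator carries this isomorphism to all N and M. *)

Set Implicit Arguments.
Unset Strict Implicit.
Unset Printing Implicit Defensive.

Import Order.TTheory GRing.Theory Num.Theory.
Import numFieldNormedType.Exports.

Local Open Scope classical_set_scope.
Local Open Scope ring_scope.
Local Open Scope sesquilinear_scope.
Local Notation Re := complex.Re.
Local Notation Im := complex.Im.


(** * Matrices over an algebraically closed numeric field *)
Section complex_matrices.
Variable C : numClosedFieldType.

(** The factor is the square root given by the spectral theorem. *)
Lemma psd_factor n (h : 'M[C]_n) : h^t* = h ->
  (forall v : 'cV_n, 0 <= (v^t* *m h *m v) 0 0) -> exists b : 'M[C]_n, h = b^t* *m b.
Proof.
move=> hh hp.
have /orthomx_spectralP hE : h \is normalmx by apply/normalmxP; rewrite hh.
set P := spectralmx h in hE; set d := spectral_diag h in hE.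
have uP : P \is unitarymx by exact: spectral_unitarymx.
have PP : P *m P^t* = 1%:M by exact/unitarymxP.
rewrite (invmx_unitary uP) in hE.
have d0 i : 0 <= d 0 i.
  have := hp (P^t* *m delta_mx i 0).
  rewrite hE trmx_mul map_mxM trmxCK !mulmxA -(mulmxA _ P) PP mulmx1.
  rewrite -(mulmxA _ P) PP mulmx1 trmx_delta map_delta_mx -rowE.
  by rewrite -colE !mxE eqxx mulr1n.
exists (diag_mx (map_mx sqrtC d) *m P).
rewrite trmx_mul map_mxM tr_diag_mx map_diag_mx mulmxA -(mulmxA _ (diag_mx _)).
rewrite mulmx_diag {1}hE; congr (_ *m diag_mx _ *m _).
apply/rowP => i; rewrite !mxE /=.
rewrite (CrealP (_ : sqrtC (d 0 i) \is Num.real)).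
  by rewrite -expr2 sqrtCK.
by rewrite ger0_real// sqrtC_ge0.
Qed.

(** The rows of x are an orthonormal basis of the row space of p; the trace of p
   is the dimension of this space. *)
Lemma projection_factor n (p : 'M[C]_n) : p^t* = p -> p *m p = p ->
  exists k (x : 'M[C]_(k, n)), [/\ x *m x^t* = 1%:M, x^t* *m x = p & \tr p = k%:R].
Proof.
move=> ph pp; exists (\rank p), (schmidt (row_base p)).
set x := schmidt _.
have /unitarymxP xx : x \is unitarymx by apply: schmidt_unitarymx; exact: rank_leq_col.
have xp : (x :=: p)%MS.
  apply: (eqmx_trans _ (eq_row_base p)).
  by apply: eqmx_schmidt_free; exact: row_base_free.
have xpx : x *m p = x.
  have /submxP[c ->] : (x <= p)%MS by rewrite xp.
  by rewrite -mulmxA pp.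
have pxx : p *m (x^t* *m x) = p.
  have /submxP[c pE] : (p <= x)%MS by rewrite xp.
  by rewrite [X in X *m _]pE -mulmxA (mulmxA x) xx mul1mx -pE.
have xxp : x^t* *m x = p.
  rewrite -[RHS]ph -[in RHS]pxx !trmx_mul !map_mxM trmxCK ph.
  by rewrite -mulmxA xpx.
split=> //; transitivity (\tr (x *m x^t*)); first by rewrite mxtrace_mulC xxp.
by rewrite xx mxtrace1.
Qed.

Lemma projections_equivalent n (p q : 'M[C]_n) :
  p^t* = p -> p *m p = p -> q^t* = q -> q *m q = q -> \tr p = \tr q ->
  exists w : 'M[C]_n, w *m w^t* = p /\ w^t* *m w = q.
Proof.
move=> ph pp qh qq; have [k [x [xx xp ->]]] := projection_factor ph pp.
have [l [y [yy yq ->]]] := projection_factor qh qq.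
move/eqP; rewrite eqr_nat => /eqP kl; subst l.
exists (x^t* *m y); rewrite !trmx_mul !map_mxM !trmxCK -!mulmxA.
by rewrite (mulmxA y) yy mul1mx (mulmxA x) xx mul1mx.
Qed.

(** Unital homomorphisms send all diagonal matrix units to projections of trace
   m / n, so that a partial isometry w leads from [g (e 0 0)] to [f (e 0 0)]; the
   translates of w by the matrix units of f and g add up to the unitary u. *)
Lemma unitary_equivalent n m (f g : 'M[C]_n -> 'M[C]_m) : (0 < n)%N ->
  linear f -> {morph f : a b / a *m b} -> f 1%:M = 1%:M -> {morph f : a / a^t*} ->
  linear g -> {morph g : a b / a *m b} -> g 1%:M = 1%:M -> {morph g : a / a^t*} ->
  exists u : 'M[C]_m, u^t* *m u = 1%:M /\ forall a, f a = u *m g a *m u^t*.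
Proof.
case: n f g => // n f g _ fl fM f1 fs gl gM g1 gs.
have linS (h : 'M[C]_n.+1 -> 'M[C]_m) : linear h ->
    forall I (r : seq I) P F, h (\sum_(i <- r | P i) F i) = \sum_(i <- r | P i) h (F i).
  move=> hl I r P F.
  pose hL : {linear 'M[C]_n.+1 -> 'M[C]_m} := HB.pack h (GRing.isLinear.Build _ _ _ _ h hl).
  exact: (raddf_sum hL).
have linZ (h : 'M[C]_n.+1 -> 'M[C]_m) : linear h -> forall c a, h (c *: a) = c *: h a.
  move=> hl c a.
  pose hL : {linear 'M[C]_n.+1 -> 'M[C]_m} := HB.pack h (GRing.isLinear.Build _ _ _ _ h hl).
  have h0 : h 0 = 0 := raddf0 hL.
  by have := hl c a 0; rewrite !addr0 h0 addr0.
pose e (i j : 'I_n.+1) : 'M[C]_n.+1 := delta_mx i j.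
have eM i j k l : e i j *m e k l = (j == k)%:R *: e i l.
  by rewrite /e mul_delta_mx_cond; case: eqP => _; rewrite ?scale1r ?scale0r.
have es i j : (e i j)^t* = e j i by rewrite /e trmx_delta map_delta_mx.
have e1 : \sum_i e i i = 1%:M by rewrite -mx1_sum_delta.
have tr0 (h : 'M[C]_n.+1 -> 'M[C]_m) : linear h -> {morph h : a b / a *m b} ->
    h 1%:M = 1%:M -> n.+1%:R * \tr (h (e 0 0)) = m%:R.
  move=> hl hM h1; rewrite -(mxtrace1 C m) -h1 -e1 linS// raddf_sum /=.
  rewrite (eq_bigr (fun=> \tr (h (e 0 0)))) => [|i _].
    by rewrite sumr_const card_ord mulr_natl.
  rewrite -[e i i]scale1r (_ : 1 = (0 == 0 :> 'I_n.+1)%:R) // -(eM i 0 0 i).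
  rewrite hM mxtrace_mulC -hM eM eqxx scale1r //.
have tr_eq : \tr (f (e 0 0)) = \tr (g (e 0 0)).
  by apply: (mulfI (_ : n.+1%:R != 0)); rewrite ?pnatr_eq0// !tr0.
have [|||||w [wf wg]] := @projections_equivalent _ (f (e 0 0)) (g (e 0 0)).
- by rewrite -fs es.
- by rewrite -fM eM eqxx scale1r.
- by rewrite -gs es.
- by rewrite -gM eM eqxx scale1r.
- by [].
pose u := \sum_i f (e i 0) *m w *m g (e 0 i).
have ge (i j k l : 'I_n.+1) : g (e i j) *m g (e k l) = (j == k)%:R *: g (e i l).
  by rewrite -gM eM linZ.
have fe (i j k l : 'I_n.+1) : f (e i j) *m f (e k l) = (j == k)%:R *: f (e i l).
  by rewrite -fM eM linZ.
have us : u^t* = \sum_i g (e i 0) *m w^t* *m f (e 0 i).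
  rewrite /u raddf_sum /= map_mx_sum; apply: eq_bigr => i _.
  by rewrite !trmx_mul !map_mxM -fs -gs !es mulmxA.
have fu a : f a *m u = u *m g a.
  rewrite (matrix_sum_delta a) !linS// mulmx_suml mulmx_sumr; apply: eq_bigr => i _.
  rewrite !linS// mulmx_suml mulmx_sumr; apply: eq_bigr => j _.
  rewrite !linZ// -scalemxAl -scalemxAr -/(e i j); congr (_ *: _).
  rewrite /u mulmx_sumr mulmx_suml (bigD1 j)//= big1 ?addr0 => [|k kj]; last first.
    by rewrite !mulmxA fe eq_sym (negbTE kj) scale0r !mul0mx.
  rewrite (bigD1 i)//= big1 ?addr0 => [|k ki]; last first.
    by rewrite -[LHS]mulmxA ge (negbTE ki) scale0r mulmx0.
  by rewrite !mulmxA fe eqxx -!mulmxA ge eqxx !scale1r.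
have w3 : w *m g (e 0 0) *m w^t* = f (e 0 0).
  by rewrite -wg !mulmxA wf -mulmxA wf fe eqxx scale1r.
have uu : u *m u^t* = 1%:M.
  rewrite us {1}/u mulmx_suml -[RHS]f1 -e1 linS//; apply: eq_bigr => i _.
  rewrite mulmx_sumr (bigD1 i)//= big1 ?addr0 => [|k ki]; last first.
    by rewrite !mulmxA -(mulmxA _ (g (e 0 i))) ge eq_sym (negbTE ki) scale0r mulmx0 !mul0mx.
  rewrite !mulmxA -(mulmxA _ (g (e 0 i))) ge eqxx scale1r -(mulmxA _ w) -(mulmxA _ (w *m _)) w3.
  by rewrite !fe eqxx !scale1r fe eqxx scale1r.
exists u; split; first exact: mulmx1C.
by move=> a; rewrite -fu -mulmxA uu mulmx1.
Qed.
End complex_matrices.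

(** * Hilbert spaces *)
Section hilbert_spaces.
Variable R : realType.
Local Notation C := R[i].

Section linear_maps.
Variables (U V : lmodType C) (A : U -> V).
Hypothesis l : linear A.

Lemma lin0 : A 0 = 0.
Proof. by have := l (-1) 0 0; rewrite scaler0 addr0 scaleN1r addNr. Qed.

Lemma linD : {morph A : u v / u + v}.
Proof. by move=> u v; have := l 1 u v; rewrite !scale1r. Qed.

Lemma linZ a : {morph A : u / a *: u}.
Proof. by move=> u; have := l a u 0; rewrite !addr0 lin0 addr0. Qed.

Lemma linB : {morph A : u v / u - v}.
Proof. by move=> u v; rewrite linD -scaleN1r linZ scaleN1r. Qed.

Lemma lin_sum I (r : seq I) P (F : I -> U) :
  A (\sum_(i <- r | P i) F i) = \sum_(i <- r | P i) A (F i).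
Proof. by apply: (big_morph A) => [u v|]; [exact: linD|exact: lin0]. Qed.
End linear_maps.

Definition hnorm (V : lmodType C) (dot : V -> V -> C) (u : V) : R :=
  Num.sqrt (Re (dot u u)).

Record prehilbert (V : lmodType C) (dot : V -> V -> C) : Prop := Prehilbert {
  hdotL : forall a u v w, dot (a *: u + v) w = a * dot u w + dot v w;
  hdotC : forall u v, dot v u = Num.conj (dot u v);
  hdot_ge0 : forall u, 0 <= dot u u;
  hdot_eq0 : forall u, dot u u = 0 -> u = 0 }.

Record hilbert (V : lmodType C) (dot : V -> V -> C) : Prop := Hilbert {
  hilbert_pre :> prehilbert dot;
  hcomplete : forall u : nat -> V,
    (forall e, 0 < e -> exists n, forall m k, (n <= m)%N -> (n <= k)%N ->
       hnorm dot (u m - u k) <= e) ->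
    exists v, forall e, 0 < e -> exists n, forall m, (n <= m)%N ->
      hnorm dot (u m - v) <= e }.

Section theory.
Variables (V : lmodType C) (dot : V -> V -> C) (H : prehilbert dot).
Local Notation nrm := (hnorm dot).
Implicit Types (u v w : V) (a b c : C).

Lemma hdotDl u v w : dot (u + v) w = dot u w + dot v w.
Proof. by have := hdotL H 1 u v w; rewrite scale1r mul1r. Qed.

Lemma hdot0l w : dot 0 w = 0.
Proof. by apply: (addrI (dot 0 w)); rewrite -hdotDl !addr0. Qed.

Lemma hdotZl a u w : dot (a *: u) w = a * dot u w.
Proof. by have := hdotL H a u 0 w; rewrite addr0 hdot0l addr0. Qed.

Lemma hdotDr u v w : dot w (u + v) = dot w u + dot w v.
Proof. by rewrite (hdotC H) hdotDl rmorphD /= -!(hdotC H). Qed.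

Lemma hdotZr a u w : dot w (a *: u) = Num.conj a * dot w u.
Proof. by rewrite (hdotC H) hdotZl rmorphM /= -(hdotC H). Qed.

Lemma hdot0r w : dot w 0 = 0.
Proof. by rewrite (hdotC H) hdot0l rmorph0. Qed.

Lemma hdotNl u w : dot (- u) w = - dot u w.
Proof. by rewrite -scaleN1r hdotZl mulN1r. Qed.

Lemma hdotNr u w : dot w (- u) = - dot w u.
Proof. by rewrite -scaleN1r hdotZr rmorphN1 mulN1r. Qed.

Lemma hdot_suml I (r : seq I) P (F : I -> V) w :
  dot (\sum_(i <- r | P i) F i) w = \sum_(i <- r | P i) dot (F i) w.
Proof. by apply: (big_morph (dot^~ w)) => [u v|]; [exact: hdotDl|exact: hdot0l]. Qed.

Lemma hdot_sumr I (r : seq I) P (F : I -> V) w :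
  dot w (\sum_(i <- r | P i) F i) = \sum_(i <- r | P i) dot w (F i).
Proof. by apply: (big_morph (dot w)) => [u v|]; [exact: hdotDr|exact: hdot0r]. Qed.

Lemma hnorm_ge0 u : 0 <= nrm u.
Proof. exact: sqrtr_ge0. Qed.

Lemma hdot_Re u : 0 <= Re (dot u u).
Proof. by have := hdot_ge0 H u; rewrite lecE /= => /andP[]. Qed.

Lemma hnorm_sq u : nrm u ^+ 2 = Re (dot u u).
Proof. by rewrite sqr_sqrtr// hdot_Re. Qed.

Lemma hdot_normE u : dot u u = (nrm u ^+ 2)%:C%C.
Proof.
rewrite hnorm_sq; have := hdot_ge0 H u; rewrite lecE /= => /andP[/eqP e _].
by move: e; case: (dot u u) => x y /= ->.
Qed.

Lemma hnorm_eq0 u : nrm u = 0 -> u = 0.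
Proof. by move=> e; apply: (hdot_eq0 H); rewrite hdot_normE e expr0n. Qed.

Lemma hnorm0 : nrm 0 = 0.
Proof. by rewrite /hnorm hdot0l sqrtr0. Qed.

Definition cmod a : R := Num.sqrt (Re a ^+ 2 + Im a ^+ 2).

Lemma cmod_ge0 a : 0 <= cmod a. Proof. exact: sqrtr_ge0. Qed.

Lemma cmod_conj a : a * Num.conj a = (cmod a ^+ 2)%:C%C.
Proof.
rewrite /cmod sqr_sqrtr ?addr_ge0 ?sqr_ge0//.
by case: a => x y; apply/eqP; rewrite eq_complex /=; apply/andP; split; apply/eqP; ring.
Qed.

Lemma hnormZ a u : nrm (a *: u) = cmod a * nrm u.
Proof.
apply/eqP; rewrite -(@eqrXn2 _ 2) ?mulr_ge0 ?hnorm_ge0 ?cmod_ge0//; apply/eqP.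
apply: (@complexI R); rewrite -hdot_normE hdotZl hdotZr mulrA cmod_conj.
by rewrite hdot_normE exprMn; apply/eqP; rewrite eq_complex /=; apply/andP; split; apply/eqP; ring.
Qed.

Lemma hnormN u : nrm (- u) = nrm u.
Proof. by rewrite /hnorm hdotNl hdotNr opprK. Qed.

Lemma hnormB u v : nrm (u - v) = nrm (v - u).
Proof. by rewrite -hnormN opprB. Qed.

Lemma hnorm_sqD u v :
  nrm (u + v) ^+ 2 = nrm u ^+ 2 + 2 * Re (dot u v) + nrm v ^+ 2.
Proof.
rewrite !hnorm_sq hdotDl !hdotDr (hdotC H u v).
case: (dot u u) (dot u v) (dot v v) => [x1 y1] [x2 y2] [x3 y3] /=; ring.
Qed.

Lemma cauchy_schwarz_Re u v : Re (dot u v) <= nrm u * nrm v.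
Proof.
have [e|v0] := eqVneq (nrm v) 0.
  by rewrite (hnorm_eq0 e) hdot0r hnorm0 mulr0.
have vp : 0 < nrm v by rewrite lt_neqAle eq_sym v0 hnorm_ge0.
(* with this t the vectors u and t *: v have the same norm *)
pose t := (nrm u / nrm v)%:C%C.
have := sqr_ge0 (nrm (u - t *: v)); rewrite hnorm_sqD hdotNr hdotZr hnormN hnormZ.
have -> : cmod t = nrm u / nrm v.
  by rewrite /cmod /= expr0n addr0 sqrtr_sqr ger0_norm// divr_ge0// hnorm_ge0.
have -> : Re (- (Num.conj t * dot u v)) = - (nrm u / nrm v * Re (dot u v)).
  by rewrite /t; case: (dot u v) => x y /=; ring.
rewrite divfK// => h; have [e|u0] := eqVneq (nrm u) 0.
  by rewrite (hnorm_eq0 e) hdot0l hnorm0 mul0r.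
have up : 0 < nrm u by rewrite lt_neqAle eq_sym u0 hnorm_ge0.
rewrite -(ler_pM2l (divr_gt0 up vp)).
have -> : nrm u / nrm v * (nrm u * nrm v) = nrm u ^+ 2 by field.
by lra.
Qed.

Lemma hnormD u v : nrm (u + v) <= nrm u + nrm v.
Proof.
rewrite -(@ler_pXn2r _ 2) ?nnegrE ?addr_ge0 ?hnorm_ge0// hnorm_sqD.
by have := cauchy_schwarz_Re u v; lra.
Qed.

Lemma hnorm_tri w u v : nrm (u - v) <= nrm (u - w) + nrm (w - v).
Proof. by rewrite -(subrKA w u); exact: hnormD. Qed.

Lemma hnorm_small u : (forall e, 0 < e -> nrm u <= e) -> u = 0.
Proof.
move=> h; apply: hnorm_eq0; apply: le_anti; rewrite hnorm_ge0 andbT.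
by apply/ler_addgt0Pr => e e0; rewrite add0r; exact: h.
Qed.

Definition hcvg (u : nat -> V) v :=
  forall e, 0 < e -> exists n, forall m, (n <= m)%N -> nrm (u m - v) <= e.

Lemma hcvg_unique (u : nat -> V) v w : hcvg u v -> hcvg u w -> v = w.
Proof.
move=> uv uw; apply/eqP; rewrite -subr_eq0; apply/eqP/hnorm_small => e e0.
have e2 : 0 < e / 2 by rewrite divr_gt0.
have [n1 h1] := uv _ e2; have [n2 h2] := uw _ e2.
apply: le_trans (hnorm_tri (u (maxn n1 n2)) _ _) _.
rewrite hnormB (splitr e) lerD//; [exact/h1/leq_maxl|exact/h2/leq_maxr].
Qed.

Lemma hcvg_lin a (u u' : nat -> V) v v' : hcvg u v -> hcvg u' v' ->
  hcvg (fun n => a *: u n + u' n) (a *: v + v').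
Proof.
move=> uv uv' e e0.
have c0 : 0 < cmod a + 1 by rewrite ltr_wpDl// cmod_ge0.
have e2 : 0 < e / 2 by rewrite divr_gt0.
have [n1 h1] := uv _ (divr_gt0 e2 c0); have [n2 h2] := uv' _ e2.
exists (maxn n1 n2) => m; rewrite geq_max => /andP[m1 m2].
rewrite opprD addrACA -scalerBr; apply: le_trans (hnormD _ _) _.
rewrite (splitr e) lerD ?h2// hnormZ.
apply: (@le_trans _ _ ((cmod a + 1) * (e / 2 / (cmod a + 1)))).
  by apply: ler_pM; rewrite ?cmod_ge0 ?hnorm_ge0 ?lerDl ?h1.
by rewrite mulrC divfK// gt_eqF.
Qed.

Lemma hdot_inj u v : (forall w, dot u w = dot v w) -> u = v.
Proof.
move=> h; apply/eqP; rewrite -subr_eq0; apply/eqP/(hdot_eq0 H).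
by rewrite hdotDl hdotNl h subrr.
Qed.

Lemma Im_hdot u v : Im (dot u v) = Re (dot u ('i%C *: v)).
Proof. by rewrite hdotZr; case: (dot u v) => x y /=; ring. Qed.

Lemma abs_Re_hdot u v : `|Re (dot u v)| <= nrm u * nrm v.
Proof.
rewrite ler_norml cauchy_schwarz_Re andbT lerNl -[- Re _]/(- _).
by have := cauchy_schwarz_Re (- u) v; rewrite hdotNl raddfN hnormN.
Qed.

Lemma abs_Im_hdot u v : `|Im (dot u v)| <= nrm u * nrm v.
Proof.
rewrite Im_hdot; apply: le_trans (abs_Re_hdot _ _) _; rewrite hnormZ.
by rewrite /cmod /= expr0n add0r expr1n sqrtr1 mul1r.
Qed.

(** Cauchy-Schwarz makes both sides continuous. *)
Lemma hdot_cvg (x y : nat -> V) u v w z : hcvg x u -> hcvg y v ->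
  (forall n, dot (x n) z = dot w (y n)) -> dot u z = dot w v.
Proof.
move=> xu yv e; pose K := nrm z + nrm w + 1.
have K0 : 0 < K by rewrite ltr_wpDl// addr_ge0// hnorm_ge0.
have small r : 0 < r -> exists n, nrm (u - x n) * nrm z + nrm w * nrm (y n - v) <= r.
  move=> r0; have [n1 h1] := xu _ (divr_gt0 r0 K0); have [n2 h2] := yv _ (divr_gt0 r0 K0).
  exists (maxn n1 n2); apply: (@le_trans _ _ (r / K * nrm z + nrm w * (r / K))).
    apply: lerD; [rewrite ler_wpM2r ?hnorm_ge0//|rewrite ler_wpM2l ?hnorm_ge0//].
      by rewrite hnormB h1// leq_maxl.
    by rewrite h2// leq_maxr.
  rewrite [nrm w * _]mulrC -mulrDr mulrAC ler_pdivrMr// ler_pM2l// lerDl//.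
have diff n : dot u z - dot w v = dot (u - x n) z + dot w (y n - v).
  by rewrite hdotDl hdotDr hdotNl hdotNr -e addrA subrK.
apply/eqP; rewrite -subr_eq0 eq_complex; apply/andP; split; rewrite -normr_eq0;
  apply/eqP/le_anti; rewrite normr_ge0 andbT; apply/ler_addgt0Pr => r r0; rewrite add0r;
  have [n] := small _ r0; apply: le_trans; rewrite (diff n) raddfD;
  apply: le_trans (ler_normD _ _) _; apply: lerD;
  by [exact: abs_Re_hdot|exact: abs_Im_hdot].
Qed.

(** * Bounded operators *)
Local Notation bnd := (opnorm_le nrm nrm).

Definition bounded_op (A : V -> V) := linear A /\ exists k, bnd A k.

Lemma opB (A B : V -> V) u : (A - B) u = A u - B u. Proof. by []. Qed.

Lemma opL a (A B : V -> V) u : (a *: A + B) u = a *: A u + B u. Proof. by []. Qed.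

Lemma bndW (A : V -> V) k l : k <= l -> bnd A k -> bnd A l.
Proof.
by move=> kl h u; apply: le_trans (h u) _; rewrite ler_wpM2r ?hnorm_ge0.
Qed.

Lemma bnd_lin (a : C) (A B : V -> V) k l : bnd A k -> bnd B l ->
  bnd (a *: A + B) (cmod a * k + l).
Proof.
move=> hA hB u; apply: le_trans (hnormD _ _) _; rewrite mulrDl lerD//.
by rewrite hnormZ -mulrA ler_wpM2l ?cmod_ge0.
Qed.

Lemma bnd_sub (A B : V -> V) k l : bnd A k -> bnd B l -> bnd (A - B) (k + l).
Proof.
move=> hA hB u; apply: le_trans (hnormD _ _) _; rewrite hnormN mulrDl lerD//.
Qed.

Lemma bnd_comp (A B : V -> V) k l : 0 <= k -> bnd A k -> bnd B l ->
  bnd (A \o B) (k * l).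
Proof. by move=> k0 hA hB u; apply: le_trans (hA _) _; rewrite -mulrA ler_wpM2l. Qed.

Lemma bounded_op_bnd A : bounded_op A -> exists2 k, 0 < k & bnd A k.
Proof.
move=> [_ [k hk]]; exists (Num.max 1 k); first by rewrite lt_max ltr01.
by apply: bndW hk; rewrite le_max lexx orbT.
Qed.

Definition op_closure (X : set (V -> V)) : set (V -> V) :=
  [set A | bounded_op A /\ forall e, 0 < e -> exists2 B, X B & bnd (A - B) e].

Definition subalg (X : set (V -> V)) : Prop :=
  [/\ X 0, forall a A B, X A -> X B -> X (a *: A + B) &
      forall A B, X A -> X B -> X (A \o B)].

Lemma bounded_op0 : bounded_op 0.
Proof.
split; first by move=> a u v; rewrite [LHS]/0 scaler0 add0r.
by exists 0 => u; rewrite mul0r [X in nrm X]/(0 : V) hnorm0.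
Qed.

Lemma bounded_op_lin a A B : bounded_op A -> bounded_op B -> bounded_op (a *: A + B).
Proof.
move=> [lA [k hA]] [lB [l hB]]; split; last by exists (cmod a * k + l); exact: bnd_lin.
move=> b u v; rewrite -[LHS]/(a *: A (b *: u + v) + B (b *: u + v)) lA lB.
rewrite -[X in _ = _ *: X + _]/(a *: A u + B u) -[X in _ = _ + X]/(a *: A v + B v).
by rewrite !scalerDr !scalerA (mulrC a b) -!addrA; congr (_ + _); rewrite addrCA.
Qed.

Lemma bounded_op_comp A B : bounded_op A -> bounded_op B -> bounded_op (A \o B).
Proof.
move=> hA hB; split; first by move=> a u v /=; rewrite hB.1 hA.1.
have [k k0 bA] := bounded_op_bnd hA; have [l _ bB] := bounded_op_bnd hB.
by exists (k * l); apply: bnd_comp => //; exact: ltW.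
Qed.

Lemma op_closure_subalg X : X `<=` bounded_op -> subalg X -> subalg (op_closure X).
Proof.
move=> Xb [X0 Xl Xc]; split.
- split; first exact: bounded_op0.
  move=> e e0; exists 0 => // u; rewrite subrr [(0 : V -> V) u]/(0 : V) hnorm0.
  by rewrite mulr_ge0 ?hnorm_ge0 ?ltW.
- move=> a A B [hA cA] [hB cB]; split; first exact: bounded_op_lin.
  move=> e e0; have c0 : 0 < cmod a + 1 by rewrite ltr_wpDl// cmod_ge0.
  have d0 : 0 < e / (cmod a + 1) by exact: divr_gt0.
  have [A' XA' hA'] := cA _ d0; have [B' XB' hB'] := cB _ d0.
  exists (a *: A' + B'); first exact: Xl.
  rewrite (_ : _ - _ = a *: (A - A') + (B - B')).
    rewrite (_ : e = cmod a * (e / (cmod a + 1)) + e / (cmod a + 1)).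
      exact: bnd_lin.
    by field; rewrite gt_eqF.
  by rewrite scalerBr opprD addrACA.
- move=> A B [hA cA] [hB cB]; split; first exact: bounded_op_comp.
  move=> e e0; have [k k0 bA] := bounded_op_bnd hA; have [l l0 bB] := bounded_op_bnd hB.
  have e2 : 0 < e / 2 by exact: divr_gt0.
  have [B' XB' hB'] := cB _ (divr_gt0 e2 k0).
  have [m m0 bB'] := bounded_op_bnd (Xb _ XB').
  have [A' XA' hA'] := cA _ (divr_gt0 e2 m0).
  exists (A' \o B'); first exact: Xc.
  move=> u; rewrite (_ : ((A \o B) - (A' \o B')) u = A ((B - B') u) + (A - A') (B' u)).
    apply: le_trans (hnormD _ _) _; rewrite (splitr e) mulrDl lerD//.
      apply: le_trans (bA _) _; apply: le_trans (ler_wpM2l (ltW k0) (hB' u)) _.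
      by rewrite mulrA (mulrC k) divfK ?gt_eqF.
    apply: le_trans (hA' _) _; apply: le_trans (ler_wpM2l _ (bB' u)) _.
      by rewrite ltW// divr_gt0.
    by rewrite mulrA divfK ?gt_eqF.
  by rewrite !opB (linB hA.1) subrKA.
Qed.

Lemma op_closure_idem X : op_closure (op_closure X) `<=` op_closure X.
Proof.
move=> A [hA cA]; split=> // e e0; have e2 : 0 < e / 2 by exact: divr_gt0.
have [B [_ cB] hB] := cA _ e2; have [B' XB' hB'] := cB _ e2.
exists B' => // u; apply: le_trans (hnorm_tri (B u) _ _) _.
by rewrite (splitr e) mulrDl; apply: lerD; [exact: hB|exact: hB'].
Qed.

Lemma sub_op_closure X : X `<=` bounded_op -> X `<=` op_closure X.
Proof.
move=> Xb A XA; split; first exact: Xb.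
move=> e e0; exists A => // u.
by rewrite opB subrr hnorm0 mulr_ge0 ?hnorm_ge0 ?ltW.
Qed.

Lemma op_closure_mono X Y : X `<=` Y -> op_closure X `<=` op_closure Y.
Proof. by move=> XY A [hA cA]; split=> // e /cA[B /XY]; exists B. Qed.
End theory.
End hilbert_spaces.

(** * Chains of matrix units *)
Section matrix_units.
Variable R : realType.
Local Notation C := R[i].

Lemma sum_blocks (U : nmodType) (F : nat -> U) n r :
  \sum_(i < n * r) F i = \sum_(p < n) \sum_(k < r) F (p * r + k)%N.
Proof.
elim: n => [|n IH]; first by rewrite !big_ord0.
rewrite big_ord_recr /= -IH mulSn addnC big_split_ord /=.
by congr (_ + _).
Qed.

(** An increasing chain of full matrix algebras on a Hilbert space.  The matrix
   units of level l are E l p q with p, q < d l.  The unit (p, q) is the sum of the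
   units of the next level with indices (p r + k, q r + k), k < r, where r is the
   ratio of the sizes.  The vectors chi l p form an orthogonal family that is
   permuted by the units and refined in the same way, so that their sum is the
   same unit vector at every level. *)
Record munits (V : lmodType C) (dot : V -> V -> C) (d : nat -> nat)
    (E : nat -> nat -> nat -> V -> V) (chi : nat -> nat -> V) : Prop := Munits {
  mu_hilbert : hilbert dot;
  mu_size : forall l, (0 < d l)%N;
  mu_dvd : forall l, (d l %| d l.+1)%N;
  mu_lin : forall l p q, linear (E l p q);
  mu_mul : forall l p q p' q' u, (q < d l)%N -> (p' < d l)%N ->
    E l p q (E l p' q' u) = (q == p')%:R *: E l p q' u;
  mu_sum : forall l u, \sum_(p < d l) E l p p u = u;
  mu_adj : forall l p q u v, (p < d l)%N -> (q < d l)%N ->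
    dot (E l p q u) v = dot u (E l q p v);
  mu_refine : forall l p q u, (p < d l)%N -> (q < d l)%N ->
    E l p q u = \sum_(k < d l.+1 %/ d l)
      E l.+1 (p * (d l.+1 %/ d l) + k)%N (q * (d l.+1 %/ d l) + k)%N u;
  mu_act : forall l p q s, (q < d l)%N -> (s < d l)%N ->
    E l p q (chi l s) = (q == s)%:R *: chi l p;
  mu_chi : forall l p, (p < d l)%N ->
    chi l p = \sum_(k < d l.+1 %/ d l) chi l.+1 (p * (d l.+1 %/ d l) + k)%N;
  mu_unit : dot (\sum_(p < d 0%N) chi 0%N p) (\sum_(p < d 0%N) chi 0%N p) = 1;
  mu_dense : forall u e, 0 < e -> exists l (c : nat -> C),
    hnorm dot (u - \sum_(p < d l) c p *: chi l p) <= e }.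

Section one_system.
Variables (V : lmodType C) (dot : V -> V -> C) (d : nat -> nat).
Variables (E : nat -> nat -> nat -> V -> V) (chi : nat -> nat -> V).
Hypothesis S : munits dot d E chi.
Let H := mu_hilbert S.
Local Notation nrm := (hnorm dot).
Local Notation bnd := (opnorm_le nrm nrm).
Local Notation r := (fun l => d l.+1 %/ d l)%N.

Lemma mu_sizeS l : d l.+1 = (d l * r l)%N.
Proof. by rewrite mulnC divnK// (mu_dvd S). Qed.

Lemma mu_ratio l : (0 < r l)%N.
Proof. by rewrite divn_gt0 ?(mu_size S)// dvdn_leq ?(mu_dvd S)// (mu_size S). Qed.

Lemma sum_level (U : nmodType) (F : nat -> U) l :
  \sum_(s < d l.+1) F s = \sum_(p < d l) \sum_(k < r l) F (p * r l + k)%N.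
Proof. by rewrite -sum_blocks -mu_sizeS. Qed.

Lemma mu_lt l p k : (p < d l)%N -> (k < r l)%N -> (p * r l + k < d l.+1)%N.
Proof.
move=> pl kr; rewrite mu_sizeS; apply: (@leq_trans (p.+1 * r l)).
  by rewrite mulSn addnC ltn_add2r.
by rewrite leq_mul2r pl orbT.
Qed.

(** The coefficients are a function on [nat], so that passing to another level
   needs no cast. *)
Definition comb l (c : nat -> C) : V := \sum_(p < d l) c p *: chi l p.

Lemma comb_lin l a c c' :
  comb l (fun p => a * c p + c' p) = a *: comb l c + comb l c'.
Proof.
rewrite /comb scaler_sumr -big_split /=; apply: eq_bigr => p _.
by rewrite scalerDl scalerA.
Qed.

Lemma comb_refine l c : comb l c = comb l.+1 (fun s => c (s %/ r l)%N).
Proof.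
rewrite /comb (sum_level (fun s => c (s %/ r l)%N *: chi l.+1 s)).
apply: eq_bigr => p _; rewrite (mu_chi S)// scaler_sumr; apply: eq_bigr => k _.
by rewrite divnMDl ?mu_ratio// (divn_small (ltn_ord k)) addn0.
Qed.

(** A unit moves chi l p to chi l q isometrically, so these vectors have the same
   norm; diagonal units separate them, so they are orthogonal; and their sum has
   norm 1. *)
Lemma dot_chi l p q : (p < d l)%N -> (q < d l)%N ->
  dot (chi l p) (chi l q) = (p == q)%:R / (d l)%:R.
Proof.
move=> pl ql; have diag s : (s < d l)%N ->
    dot (chi l s) (chi l s) = dot (chi l 0%N) (chi l 0%N).
  move=> sl; have z := mu_size S l.
  have e : chi l s = E l s 0 (chi l 0%N) by rewrite (mu_act S)// scale1r.
  by rewrite [in LHS]e (mu_adj S)// (mu_mul S)// eqxx scale1r (mu_act S)// scale1r.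
have off s t : (s < d l)%N -> (t < d l)%N -> s != t -> dot (chi l s) (chi l t) = 0.
  move=> sl tl st.
  have e : chi l s = E l s s (chi l s) by rewrite (mu_act S)// eqxx scale1r.
  by rewrite e (mu_adj S)// (mu_act S)// (negbTE st) scale0r (hdot0r H).
have tot : forall m, \sum_(p < d m) chi m p = \sum_(p < d 0%N) chi 0%N p.
  elim=> [//|m <-]; have := comb_refine m (fun=> 1).
  rewrite /comb => e; transitivity (\sum_(p < d m) 1 *: chi m p).
    by rewrite e; apply: eq_bigr => i _; rewrite scale1r.
  by apply: eq_bigr => i _; rewrite scale1r.
have one : (d l)%:R * dot (chi l 0%N) (chi l 0%N) = 1.
  rewrite -[RHS](mu_unit S) -(tot l) (hdot_suml H).
  rewrite (eq_bigr (fun=> dot (chi l 0%N) (chi l 0%N))).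
    by rewrite sumr_const card_ord mulr_natl.
  move=> i _; rewrite (hdot_sumr H) (bigD1 i)//= big1 ?addr0 => [|j ji].
    exact: diag.
  by rewrite off// eq_sym.
have [->|pq] := eqVneq p q; last by rewrite mul0r off.
rewrite diag// mul1r; apply: (mulfI (_ : (d l)%:R != 0)).
  by rewrite pnatr_eq0 -lt0n (mu_size S).
by rewrite one divff// pnatr_eq0 -lt0n (mu_size S).
Qed.

Lemma dot_comb l c c' :
  dot (comb l c) (comb l c') = \sum_(p < d l) c p * Num.conj (c' p) / (d l)%:R.
Proof.
rewrite /comb (hdot_suml H); apply: eq_bigr => p _.
rewrite (hdotZl H) (hdot_sumr H) (bigD1 p)//= big1 ?addr0 => [|q qp].
  by rewrite (hdotZr H) dot_chi// eqxx mul1r mulrA.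
by rewrite (hdotZr H) dot_chi// eq_sym val_eqE (negbTE qp) mul0r mulr0.
Qed.

(** E l p q is an isometry on the range of the projection E l q q, and the
   ranges of the diagonal units are orthogonal. *)
Lemma munit_contr l p q : (p < d l)%N -> (q < d l)%N -> bnd (E l p q) 1.
Proof.
move=> pl ql u; rewrite mul1r -(@ler_pXn2r _ 2) ?nnegrE ?hnorm_ge0// !(hnorm_sq H).
have e (s : 'I_(d l)) : dot (E l s s u) u = dot (E l s s u) (E l s s u).
  by rewrite -(mu_adj S)// (mu_mul S)// eqxx scale1r.
rewrite (mu_adj S)// (mu_mul S)// eqxx scale1r.
rewrite -[X in _ <= Re (dot _ X)](mu_sum S l u) (hdot_sumr H) raddf_sum /=.
rewrite (bigD1 (Ordinal ql))//= lerDl; apply: sumr_ge0 => s _.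
by rewrite -(mu_adj S)// e (hdot_Re H).
Qed.

(** ** The representation of a full matrix algebra by its matrix units *)
Definition rho l (a : 'M[C]_(d l)) (u : V) : V :=
  \sum_p \sum_q a p q *: E l p q u.

Lemma rho_linear l : linear (@rho l).
Proof.
move=> c a b; apply/funext => u; rewrite opL /rho scaler_sumr -big_split.
apply: eq_bigr => p _; rewrite scaler_sumr -big_split; apply: eq_bigr => q _.
by rewrite !mxE scalerDl scalerA.
Qed.

Lemma rho0 l : rho (0 : 'M[C]_(d l)) = 0.
Proof.
apply/funext => u; rewrite /rho big1// => p _; rewrite big1// => q _.
by rewrite mxE scale0r.
Qed.

Lemma rhoZ l c (a : 'M[C]_(d l)) : rho (c *: a) = c *: rho a.
Proof. by have := rho_linear c a 0; rewrite rho0 !addr0. Qed.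

Lemma rhoB l (a b : 'M[C]_(d l)) : rho (a - b) = rho a - rho b.
Proof. by have := rho_linear (-1) b a; rewrite !scaleN1r => h; rewrite addrC h addrC. Qed.

Lemma rho_sum l I (s : seq I) P (F : I -> 'M[C]_(d l)) :
  rho (\sum_(i <- s | P i) F i) = \sum_(i <- s | P i) rho (F i).
Proof.
apply: (big_morph (@rho l)) => [a b|]; last exact: rho0.
by have := rho_linear 1 a b; rewrite !scale1r.
Qed.

Lemma rho_lin l (a : 'M[C]_(d l)) : linear (rho a).
Proof.
move=> c u v; rewrite /rho scaler_sumr -big_split.
apply: eq_bigr => p _; rewrite scaler_sumr -big_split; apply: eq_bigr => q _.
by rewrite (mu_lin S) scalerDr !scalerA mulrC.
Qed.

Lemma rhoM l (a b : 'M[C]_(d l)) : rho (a *m b) = rho a \o rho b.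
Proof.
apply/funext => u; rewrite /= /rho; apply: eq_bigr => p _.
under eq_bigr => q _ do rewrite mxE scaler_suml.
rewrite exchange_big /=; apply: eq_bigr => s _.
rewrite (lin_sum (mu_lin S l p s)) scaler_sumr.
rewrite [RHS](bigD1 s)//= [X in _ + X]big1 ?addr0 => [|t ts]; last first.
  rewrite (lin_sum (mu_lin S l p s)) big1 ?scaler0// => q _.
  rewrite (linZ (mu_lin S l p s)) (mu_mul S)// eq_sym val_eqE (negbTE ts).
  by rewrite scale0r scaler0.
rewrite (lin_sum (mu_lin S l p s)) scaler_sumr; apply: eq_bigr => q _.
by rewrite (linZ (mu_lin S l p s)) (mu_mul S)// eqxx scale1r scalerA.
Qed.

Lemma rho1 l : rho (1%:M : 'M[C]_(d l)) = id.
Proof.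
apply/funext => u; rewrite -[RHS](mu_sum S l u) /rho; apply: eq_bigr => p _.
rewrite (bigD1 p)//= big1 ?addr0 => [|q qp]; first by rewrite mxE eqxx scale1r.
by rewrite mxE eq_sym (negbTE qp) scale0r.
Qed.

Lemma rho_adj l (a : 'M[C]_(d l)) u v : dot (rho a u) v = dot u (rho (a^t*) v).
Proof.
rewrite /rho (hdot_suml H) (hdot_sumr H).
under eq_bigr => p _ do rewrite (hdot_suml H).
under [RHS]eq_bigr => p _ do rewrite (hdot_sumr H).
rewrite exchange_big /=; apply: eq_bigr => p _; apply: eq_bigr => q _.
by rewrite (hdotZl H) (hdotZr H) !mxE conjCK (mu_adj S).
Qed.

(** If K bounds the norm of a, then K ^ 2 minus the square of the modulus of a is
   positive semidefinite, hence equal to the square of the modulus of some b; since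
   rho is a *-homomorphism, K ^ 2 |u| ^ 2 - |rho a u| ^ 2 = |rho b u| ^ 2. *)
Lemma rho_bnd l (a : 'M[C]_(d l)) K : 0 <= K -> mxnorm_le a K -> bnd (rho a) K.
Proof.
move=> K0 /(mxnorm_le_sq _ K0) aK u.
have [b bE] : exists b : 'M[C]_(d l), ((K ^+ 2)%:C%C)%:M - a^t* *m a = b^t* *m b.
  apply: psd_factor.
    rewrite linearB /= map_mxB trmx_mul map_mxM trmxCK tr_scalar_mx map_scalar_mx /=.
    by congr (_%:M - _); apply/eqP; rewrite eq_complex /= oppr0 !eqxx.
  move=> v; rewrite mulmxBr mulmxBl mul_mx_scalar -scalemxAl mulmxA.
  have -> : v^t* *m a^t* *m a *m v = (a *m v)^t* *m (a *m v).
    by rewrite trmx_mul map_mxM !mulmxA.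
  have vv n (w : 'cV[C]_n) : (w^t* *m w) 0 0 = (sqnorm w)%:C%C.
    rewrite mxE /sqnorm rmorph_sum; apply: eq_bigr => j _; rewrite !mxE.
    by case: (w j 0) => x y /=; apply/eqP; rewrite eq_complex /=; apply/andP; split;
      apply/eqP; ring.
  rewrite mxE [X in X + _]mxE [X in _ + X]mxE !vv -rmorphM -rmorphB /= lecE /= eqxx.
  by rewrite subr_ge0; exact: aK.
rewrite -(@ler_pXn2r _ 2) ?nnegrE ?mulr_ge0 ?hnorm_ge0// exprMn !(hnorm_sq H).
have := hdot_Re H (rho b u); rewrite rho_adj -[rho _ (rho b u)]/((rho (b^t*) \o rho b) u).
rewrite -rhoM -bE rhoB -scalemx1 rhoZ rho1 opB (hdotDr H) (hdotNr H).
rewrite -[(_ *: id) u]/(_ *: u) (hdotZr H) rhoM /= -rho_adj.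
case: (dot u u) => x y; case: (dot (rho a u) (rho a u)) => x' y' /=.
by rewrite oppr0 mul0r subr0 subr_ge0.
Qed.

Lemma rho_comb l (a : 'M[C]_(d l)) (v : 'cV[C]_(d l)) :
  rho a (\sum_p v p 0 *: chi l p) = \sum_p (a *m v) p 0 *: chi l p.
Proof.
rewrite /rho; apply: eq_bigr => p _; rewrite mxE scaler_suml; apply: eq_bigr => q _.
rewrite (lin_sum (mu_lin S l p q)) (bigD1 q)//= big1 ?addr0 => [|s sq].
  by rewrite (linZ (mu_lin S l p q)) (mu_act S)// eqxx scale1r scalerA.
rewrite (linZ (mu_lin S l p q)) (mu_act S)// eq_sym val_eqE (negbTE sq).
by rewrite scale0r scaler0.
Qed.

Lemma norm_vec l (v : 'cV[C]_(d l)) :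
  nrm (\sum_p v p 0 *: chi l p) ^+ 2 = sqnorm v / (d l)%:R.
Proof.
apply: (@complexI R); rewrite -(hdot_normE H).
pose c k := if insub k is Some p then v p 0 else 0.
have -> : \sum_p v p 0 *: chi l p = comb l c.
  by apply: eq_bigr => p _; rewrite /c valK.
rewrite dot_comb -mulr_suml rmorphM fmorphV /= rmorph_nat; congr (_ / _).
rewrite /sqnorm rmorph_sum; apply: eq_bigr => p _; rewrite /c valK.
rewrite cmod_conj /cmod sqr_sqrtr// addr_ge0 ?sqr_ge0//.
Qed.

(** On the combinations of the vectors chi l p, which are orthogonal and of equal
   norm, rho a acts as the matrix a on coordinates. *)
Lemma rho_faithful l (a : 'M[C]_(d l)) K : 0 <= K -> bnd (rho a) K -> mxnorm_le a K.
Proof.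
move=> K0 aK; apply/mxnorm_le_sq => // v.
have := aK (\sum_p v p 0 *: chi l p).
rewrite -(@ler_pXn2r _ 2) ?nnegrE ?mulr_ge0 ?hnorm_ge0// rho_comb exprMn !norm_vec.
by rewrite mulrA ler_pM2r// invr_gt0 ltr0n (mu_size S).
Qed.

Lemma rho_inj l : injective (@rho l).
Proof.
move=> a b ab; apply/eqP; rewrite -subr_eq0; apply/eqP.
have : mxnorm_le (a - b) 0.
  apply: rho_faithful => // u; rewrite rhoB opB ab subrr (hnorm0 H) mul0r//.
move=> /(mxnorm_le_sq _ (lexx 0)) h; apply/matrixP => i j.
have := h (delta_mx j 0); rewrite expr0n mul0r => h0.
have /sqnorm_eq0 : sqnorm ((a - b) *m delta_mx j 0) = 0.
  by apply: le_anti; rewrite h0 sqnorm_ge0.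
by rewrite -colE => /matrixP/(_ i 0); rewrite !mxE.
Qed.

(** ** Refinement *)
Definition mxunit l (i j : nat) : 'M[C]_(d l) :=
  \matrix_(p, q) ((p == i :> nat) && (q == j :> nat))%:R.

Lemma rho_unit l i j : (i < d l)%N -> (j < d l)%N -> rho (mxunit l i j) = E l i j.
Proof.
move=> il jl; apply/funext => u; rewrite /rho (bigD1 (Ordinal il))//=.
rewrite [X in _ + X]big1 ?addr0 => [|p pi]; last first.
  rewrite big1// => q _; rewrite mxE (_ : (p == i :> nat) = false) ?scale0r//.
  by apply: contra_neqF pi => /eqP e; exact: val_inj.
rewrite (bigD1 (Ordinal jl))//= big1 ?addr0 => [|q qj].
  by rewrite mxE !eqxx scale1r.
rewrite mxE (_ : (q == j :> nat) = false) ?andbF ?scale0r//.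
by apply: contra_neqF qj => /eqP e; exact: val_inj.
Qed.

(** The matrix of rho a in the units of the next level. *)
Definition mxrefine l (a : 'M[C]_(d l)) : 'M[C]_(d l.+1) :=
  \sum_p \sum_q a p q *: \sum_(k < r l) mxunit l.+1 (p * r l + k) (q * r l + k).

Lemma rho_refine l (a : 'M[C]_(d l)) : rho (mxrefine a) = rho a.
Proof.
apply/funext => u; rewrite /mxrefine rho_sum [RHS]/rho.
rewrite fct_sumE; apply: eq_bigr => p _; rewrite rho_sum fct_sumE; apply: eq_bigr => q _.
rewrite rhoZ rho_sum (mu_refine S)//; congr (_ *: _).
by rewrite fct_sumE; apply: eq_bigr => k _; rewrite rho_unit// mu_lt.
Qed.

(** As rho is injective at each level and refinement does not change rho a, the
   algebraic properties of the refinement are those of rho. *)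
Lemma mxrefine_linear l : linear (@mxrefine l).
Proof. by move=> c a b; apply: rho_inj; rewrite rho_linear !rho_refine rho_linear. Qed.

Lemma mxrefineM l : {morph @mxrefine l : a b / a *m b}.
Proof. by move=> a b; apply: rho_inj; rewrite rhoM !rho_refine rhoM. Qed.

Lemma mxrefine1 l : mxrefine (1%:M : 'M[C]_(d l)) = 1%:M.
Proof. by apply: rho_inj; rewrite rho_refine !rho1. Qed.

Lemma mxrefine_adj l : {morph @mxrefine l : a / a^t*}.
Proof.
move=> a; apply: rho_inj; rewrite rho_refine; apply/funext => u.
apply: (hdot_inj H) => w; rewrite (hdotC H) [RHS](hdotC H); congr Num.conj.
by rewrite -!rho_adj rho_refine.
Qed.

Definition ops : set (V -> V) := [set A | exists l (a : 'M[C]_(d l)), A = rho a].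

Lemma rho_level l k (a : 'M[C]_(d l)) : exists b : 'M[C]_(d (k + l)), rho b = rho a.
Proof.
by elim: k => [|k [b <-]]; [exists a|exists (mxrefine b); rewrite rho_refine].
Qed.

(** Two operators of the union lie in a common level, so that the union is an
   algebra. *)
Lemma ops_common l m (a : 'M[C]_(d l)) (b : 'M[C]_(d m)) :
  exists n (a' b' : 'M[C]_(d n)), rho a' = rho a /\ rho b' = rho b.
Proof.
exists (m + l)%N; have [a' ha] := rho_level m a; have [b' hb] := rho_level l b.
by move: b' hb; rewrite addnC => b' hb; exists a', b'.
Qed.

Lemma rho_bounded l (a : 'M[C]_(d l)) : bounded_op dot (rho a).
Proof.
rewrite (matrix_sum_delta a) rho_sum.
apply: (big_rec (bounded_op dot)) => [|i A _ bA]; first exact: (bounded_op0 H).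
rewrite rho_sum -[X in X + _]scale1r; apply: (bounded_op_lin H) => //.
apply: (big_rec (bounded_op dot)) => [|j A' _ bA']; first exact: (bounded_op0 H).
rewrite rhoZ; apply: (bounded_op_lin H) => //; split; first exact: rho_lin.
exists 1; rewrite (_ : delta_mx i j = mxunit l i j).
  by rewrite rho_unit//; exact: munit_contr.
by apply/matrixP => p q; rewrite !mxE.
Qed.

Lemma ops_subalg : subalg ops.
Proof.
split.
- by exists 0%N, 0; rewrite rho0.
- move=> c A B [l [a ->]] [m [b ->]]; have [n [a' [b' [<- <-]]]] := ops_common a b.
  by exists n, (c *: a' + b'); rewrite rho_linear.
- move=> A B [l [a ->]] [m [b ->]]; have [n [a' [b' [<- <-]]]] := ops_common a b.
  by exists n, (a' *m b'); rewrite rhoM.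
Qed.

Lemma ops_bounded : ops `<=` bounded_op dot.
Proof. by move=> A [l [a ->]]; exact: rho_bounded. Qed.
End one_system.
End matrix_units.

(** * Chains of matrix units with the same sizes are unitarily equivalent *)
Section intertwiner.
Variable R : realType.
Local Notation C := R[i].
Variables (V V' : lmodType C) (dot : V -> V -> C) (dot' : V' -> V' -> C).
Variables (d : nat -> nat) (E : nat -> nat -> nat -> V -> V) (chi : nat -> nat -> V).
Variables (E' : nat -> nat -> nat -> V' -> V') (chi' : nat -> nat -> V').
Hypotheses (S : munits dot d E chi) (S' : munits dot' d E' chi').
Let H := mu_hilbert S.
Let H' := mu_hilbert S'.
Local Notation nrm := (hnorm dot).
Local Notation nrm' := (hnorm dot').
Local Notation span := (comb d chi).
Local Notation span' := (comb d chi').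

(** The graph of the intertwining operator: the closure of the pairs of
   combinations that have the same level and coefficients on both sides. *)
Definition matched (u : V) (v : V') := forall e, 0 < e ->
  exists l c, nrm (u - span l c) <= e /\ nrm' (v - span' l c) <= e.

Lemma comb_up l k c : exists c', span l c = span (k + l)%N c' /\ span' l c = span' (k + l)%N c'.
Proof.
elim: k => [|k [c' [e e']]]; first by exists c.
by exists (fun s => c' (s %/ (d (k + l).+1 %/ d (k + l)))%N);
  rewrite e e' (comb_refine S) (comb_refine S').
Qed.

Lemma comb_common l m c c' : exists n b b',
  [/\ span l c = span n b, span' l c = span' n b,
      span m c' = span n b' & span' m c' = span' n b'].
Proof.
have [b [h1 h2]] := comb_up l m c; have [b' [h3 h4]] := comb_up m l c'.
by exists (m + l)%N, b, b'; rewrite h1 h2 h3 h4 addnC.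
Qed.

(** The inner products of the vectors of one level depend on the size alone. *)
Lemma comb_isometry l c : nrm' (span' l c) = nrm (span l c).
Proof. by rewrite /hnorm (dot_comb S) (dot_comb S'). Qed.

Lemma combB l c c' : span l (fun p => -1 * c' p + c p) = span l c - span l c'.
Proof. by rewrite comb_lin scaleN1r addrC. Qed.

Lemma combB' l c c' : span' l (fun p => -1 * c' p + c p) = span' l c - span' l c'.
Proof. by rewrite comb_lin scaleN1r addrC. Qed.

Lemma comb_dist l m c c' : nrm' (span' l c - span' m c') = nrm (span l c - span m c').
Proof.
have [n [b [b' [-> -> -> ->]]]] := comb_common l m c c'.
by rewrite -combB -combB' comb_isometry.
Qed.

(** The combinations that converge to u have Cauchy counterparts on the other
   side, because equal coefficients give equal distances. *)
Lemma matched_total u : exists v, matched u v.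
Proof.
have /choice[f hf] n : exists lc : nat * (nat -> C), nrm (u - span lc.1 lc.2) <= n.+1%:R^-1.
  by have [//|l [c h]] := mu_dense S u (e := n.+1%:R^-1); exists (l, c).
have small e : 0 < e -> exists n, forall m, (n <= m)%N -> m.+1%:R^-1 <= e :> R.
  move=> e0; have [n _ hn] := near_infty_natSinv_lt (PosNum e0).
  by exists n => // m nm; apply: ltW; apply: hn.
have [v hv] : exists v, forall e, 0 < e -> exists n, forall m, (n <= m)%N ->
    nrm' (span' (f m).1 (f m).2 - v) <= e.
  apply: (hcomplete H') => e e0; have [n h] := small _ (divr_gt0 e0 (ltr0n _ 2)).
  exists n => m k nm nk; rewrite comb_dist; apply: le_trans (hnorm_tri H u _ _) _.
  rewrite (splitr e) lerD//; last exact: le_trans (hf _) (h _ nk).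
  by rewrite (hnormB H); exact: le_trans (hf _) (h _ nm).
exists v => e e0; have [n1 h1] := small _ e0; have [n2 h2] := hv _ e0.
exists (f (maxn n1 n2)).1, (f (maxn n1 n2)).2; split.
  exact: le_trans (hf _) (h1 _ (leq_maxl _ _)).
by rewrite (hnormB H') h2// leq_maxr.
Qed.

Lemma matched_lin a u u' v v' : matched u v -> matched u' v' ->
  matched (a *: u + u') (a *: v + v').
Proof.
move=> m1 m2 e e0; have c0 : 0 < cmod a + 1 by rewrite ltr_wpDl// cmod_ge0.
have d0 : 0 < e / (cmod a + 1) by exact: divr_gt0.
have [l [c [h1 h1']]] := m1 _ d0; have [m [c' [h2 h2']]] := m2 _ d0.
have [n [b [b' [e1 e1' e2 e2']]]] := comb_common l m c c'.
have ee : e = cmod a * (e / (cmod a + 1)) + e / (cmod a + 1).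
  by field; rewrite gt_eqF.
exists n, (fun p => a * b p + b' p); rewrite !comb_lin -e1 -e1' -e2 -e2'.
split; rewrite opprD addrACA -scalerBr ee.
  apply: le_trans (hnormD H _ _) _; apply: lerD => //.
  by rewrite (hnormZ H) ler_wpM2l// cmod_ge0.
apply: le_trans (hnormD H' _ _) _; apply: lerD => //.
by rewrite (hnormZ H') ler_wpM2l// cmod_ge0.
Qed.

Lemma matched_norm u v : matched u v -> nrm' v = nrm u.
Proof.
move=> m; have close e : 0 < e -> `|nrm' v - nrm u| <= e.
  move=> e0; have [l [c [h h']]] := m _ (divr_gt0 e0 (ltr0n R 2)).
  have t1 := hnormD H (u - span l c) (span l c); rewrite subrK in t1.
  have t2 := hnormD H (span l c - u) u; rewrite subrK (hnormB H) in t2.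
  have t3 := hnormD H' (v - span' l c) (span' l c); rewrite subrK in t3.
  have t4 := hnormD H' (span' l c - v) v; rewrite subrK (hnormB H') in t4.
  rewrite comb_isometry in t3 t4; rewrite ler_norml; apply/andP; split; lra.
apply/eqP; rewrite -subr_eq0 -normr_eq0; apply/eqP/le_anti; rewrite normr_ge0 andbT.
by apply/ler_addgt0Pr => e e0; rewrite add0r close.
Qed.

Lemma matched_unique u v v' : matched u v -> matched u v' -> v = v'.
Proof.
move=> m m'; have := matched_norm (matched_lin (-1) m m').
rewrite !scaleN1r addNr (hnorm0 H) => /(hnorm_eq0 H') /eqP.
by rewrite addrC subr_eq0 eq_sym => /eqP.
Qed.

(** The units of level l permute the vectors of level l, and through refinement
   those of all further levels, by the same rule on both sides. *)
Lemma munit_comb l p q k c : (p < d l)%N -> (q < d l)%N -> exists c',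
  E l p q (span (k + l)%N c) = span (k + l)%N c' /\
  E' l p q (span' (k + l)%N c) = span' (k + l)%N c'.
Proof.
elim: k l p q => [|k IH] l p q pl ql.
  exists (fun s => (s == p)%:R * c q).
  have base (U : lmodType C) (dt : U -> U -> C) F x (T : munits dt d F x) :
      F l p q (comb d x l c) =
      comb d x l (fun s => (s == p)%:R * c q).
    rewrite /comb (lin_sum (mu_lin T l p q)).
    rewrite (bigD1 (Ordinal ql))//= big1 ?addr0 => [|s sq]; last first.
      rewrite (linZ (mu_lin T l p q)) (mu_act T)// eq_sym.
      by rewrite -[q]/(val (Ordinal ql)) val_eqE (negbTE sq) scale0r scaler0.
    rewrite (bigD1 (Ordinal pl))//= big1 ?addr0 => [|s sp]; last first.
      by rewrite -[p]/(val (Ordinal pl)) val_eqE (negbTE sp) mul0r scale0r.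
    by rewrite (linZ (mu_lin T l p q)) (mu_act T)// !eqxx scale1r mul1r.
  by rewrite !add0n; split; [exact: (base _ _ _ _ S)|exact: (base _ _ _ _ S')].
rewrite addSnnS; set m := (d l.+1 %/ d l)%N.
have /choice[f hf] (j : 'I_m) : exists c',
    E l.+1 (p * m + j)%N (q * m + j)%N (span (k + l.+1)%N c) = span (k + l.+1)%N c' /\
    E' l.+1 (p * m + j)%N (q * m + j)%N (span' (k + l.+1)%N c) = span' (k + l.+1)%N c'.
  by apply: IH; apply: (mu_lt S).
exists (fun s => \sum_(j < m) f j s).
rewrite (mu_refine S)// (mu_refine S')//.
split; rewrite [RHS]/comb; under [RHS]eq_bigr => s _ do rewrite scaler_suml;
  by rewrite exchange_big; apply: eq_bigr => j _; have [] := hf j.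
Qed.

(** The graph is invariant under the units, which are contractions. *)
Lemma matched_munit l p q u v : (p < d l)%N -> (q < d l)%N ->
  matched u v -> matched (E l p q u) (E' l p q v).
Proof.
move=> pl ql m e e0; have [k [c [h h']]] := m _ e0.
have [c1 [e1 e1']] := comb_up k l c; rewrite addnC in e1 e1'.
have [c2 [e2 e2']] := munit_comb k c1 pl ql.
exists (k + l)%N, c2; rewrite -e2 -e2' -e1 -e1' -(linB (mu_lin S l p q)).
rewrite -(linB (mu_lin S' l p q)); split.
  by apply: le_trans (munit_contr S pl ql _) _; rewrite mul1r.
by apply: le_trans (munit_contr S' pl ql _) _; rewrite mul1r.
Qed.
End intertwiner.

Lemma matched_sym (R : realType) (V V' : lmodType R[i]) dot dot' d chi chi' (u : V) (v : V') :
  matched dot dot' d chi chi' u v -> matched dot' dot d chi' chi v u.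
Proof. by move=> m e /m[l [c [h h']]]; exists l, c. Qed.

Section unitary_equivalence.
Variable R : realType.
Local Notation C := R[i].
Variables (V V' : lmodType C) (dot : V -> V -> C) (dot' : V' -> V' -> C).
Variables (d : nat -> nat) (E : nat -> nat -> nat -> V -> V) (chi : nat -> nat -> V).
Variables (E' : nat -> nat -> nat -> V' -> V') (chi' : nat -> nat -> V').
Hypotheses (S : munits dot d E chi) (S' : munits dot' d E' chi').
Let H := mu_hilbert S.
Let H' := mu_hilbert S'.

(** The matching relation is the graph of a unitary operator that intertwines the
   matrix units; conjugation by it preserves operator norms, hence it exchanges
   the closures. *)
Lemma unitary_equivalence : exists (W : V -> V') (W' : V' -> V),
  [/\ linear W, forall u v, dot' (W u) (W v) = dot u v, cancel W W', cancel W' W &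
      op_closure dot (ops d E) = [set W' \o A \o W | A in op_closure dot' (ops d E')]].
Proof.
have /choice[W hW] := matched_total S S'.
have /choice[W' hW'] := matched_total S' S.
have WK : cancel W W'.
  by move=> u; apply: (matched_unique S' S (hW' (W u))); exact/matched_sym/hW.
have W'K : cancel W' W.
  by move=> v; apply: (matched_unique S S' (hW (W' v))); exact/matched_sym/hW'.
have Wl : linear W.
  by move=> a u v; apply: (matched_unique S S' (hW _)); exact: (matched_lin S S').
have W'l : linear W'.
  by move=> a u v; apply: (matched_unique S' S (hW' _)); exact: (matched_lin S' S).
have Wn u : hnorm dot' (W u) = hnorm dot u by exact: (matched_norm S S').
have W'n v : hnorm dot (W' v) = hnorm dot' v by exact: (matched_norm S' S).
have Wre u v : Re (dot' (W u) (W v)) = Re (dot u v).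
  have := hnorm_sqD H' (W u) (W v); have := hnorm_sqD H u v.
  by rewrite -(linD Wl) !Wn; lra.
have WE l p q u : (p < d l)%N -> (q < d l)%N -> W (E l p q u) = E' l p q (W u).
  by move=> pl ql; apply: (matched_unique S S' (hW _)); exact: (matched_munit S S').
have Wrho l (a : 'M[C]_(d l)) u : W (rho E a u) = rho E' a (W u).
  rewrite /rho (lin_sum Wl); apply: eq_bigr => p _.
  rewrite (lin_sum Wl); apply: eq_bigr => q _.
  by rewrite (linZ Wl) WE.
exists W, W'; split=> //.
  move=> u v; apply/eqP; rewrite eq_complex Wre eqxx /=; apply/eqP.
  by rewrite (Im_hdot H) (Im_hdot H') -(linZ Wl) Wre.
apply/seteqP; split => [A [[lA [k bA]] cA]|_ [A [[lA [k bA]] cA] <-]].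
  exists (W \o A \o W'); last by apply/funext => u /=; rewrite !WK.
  split; first split.
  - by move=> a u v /=; rewrite W'l lA Wl.
  - by exists k => u /=; rewrite Wn -(W'n u).
  move=> e /cA[_ [l [a ->]] h]; exists (rho E' a); first by exists l, a.
  move=> u; rewrite -[u]W'K opB /= -Wrho WK -(linB Wl) !Wn; exact: h.
split; first split.
- by move=> a u v /=; rewrite Wl lA W'l.
- by exists k => u /=; rewrite W'n -(Wn u).
move=> e /cA[_ [l [a ->]] h]; exists (rho E a); first by exists l, a.
move=> u; rewrite opB /= -[rho E a u]WK Wrho -(linB W'l) W'n -(Wn u); exact: h.
Qed.
End unitary_equivalence.

(** * Identification of the limit algebra *)
Section uhf_representation.
Variable R : realType.
Local Notation C := R[i].
Variables (V : lmodType C) (dot : V -> V -> C).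
Variables (E : nat -> nat -> nat -> V -> V) (chi : nat -> nat -> V).
Local Notation d := (fun l => (l.+1)`!).
Hypothesis S : munits dot d E chi.
Variable phi : uhf_system R.
Let H := mu_hilbert S.
Local Notation nrm := (hnorm dot).
Local Notation bnd := (opnorm_le nrm nrm).

(** The connecting map and the refinement of the twisted representation are two
   unital *-homomorphisms between the same matrix algebras, hence conjugate. *)
Let step l (u : 'M[C]_((l.+1)`!)) : u^t* *m u = 1%:M ->
  exists w : 'M[C]_((l.+2)`!), w^t* *m w = 1%:M /\
    forall a, rho E (w^t* *m phi l a *m w : 'M[C]_(d l.+1)) =
              rho E (u^t* *m a *m u : 'M[C]_(d l)).
Proof.
move=> uu; have uu' := mulmx1C uu; have [fl fM f1 fs _] := uhf_mapP phi l.
pose g (a : 'M[C]_((l.+1)`!)) : 'M[C]_((l.+2)`!) :=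
  mxrefine (d := d) (u^t* *m a *m u : 'M[C]_(d l)).
have [||||w [ww wE]] := @unitary_equivalent _ _ _ (phi l) g (fact_gt0 _) fl fM f1 fs.
- move=> c a b; rewrite /g mulmxDr mulmxDl -scalemxAr -scalemxAl.
  exact: (mxrefine_linear S).
- move=> a b; rewrite /g -(mxrefineM S); congr (mxrefine _).
  by rewrite !mulmxA -(mulmxA _ u) uu' mulmx1.
- by rewrite /g mulmx1 uu (mxrefine1 S).
- move=> a; rewrite /g -(mxrefine_adj S); congr (mxrefine _).
  by rewrite !trmx_mul !map_mxM trmxCK mulmxA.
exists w; split=> // a; rewrite wE !mulmxA ww mul1mx -mulmxA ww mulmx1.
by rewrite (rho_refine S).
Qed.

Let one_unitary : (1%:M : 'M[C]_((1)`!))^t* *m 1%:M = 1%:M.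
Proof. by rewrite mulmx1 trmx1 map_mx1. Qed.

(** Unitaries that turn the connecting maps of the inductive system into the
   refinement of matrix units. *)
Fixpoint twist l : {u : 'M[C]_((l.+1)`!) | u^t* *m u = 1%:M} :=
  if l is l'.+1 then
    let s := cid (step (svalP (twist l'))) in exist _ (sval s) (svalP s).1
  else exist _ _ one_unitary.

Definition trho l (a : 'M[C]_((l.+1)`!)) : V -> V :=
  rho E ((sval (twist l))^t* *m a *m sval (twist l) : 'M[C]_(d l)).

Let tw1 l : (sval (twist l))^t* *m sval (twist l) = 1%:M.
Proof. exact: svalP (twist l). Qed.

Let tw2 l : sval (twist l) *m (sval (twist l))^t* = 1%:M.
Proof. exact/mulmx1C/tw1. Qed.

Lemma trho_map l a : trho (phi l a) = trho a.
Proof. by rewrite /trho /=; case: cid => w /= [_ ->]. Qed.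

Lemma trho_push m (a : 'M[C]_((m.+1)`!)) k : trho (uhf_push phi a k) = trho a.
Proof. by elim: k => //= k <-; exact: trho_map. Qed.

Lemma trho_linear l : linear (@trho l).
Proof.
move=> c a b; rewrite /trho mulmxDr mulmxDl -scalemxAr -scalemxAl.
exact: (rho_linear E).
Qed.

Lemma trhoB l (a b : 'M[C]_((l.+1)`!)) : trho (a - b) = trho a - trho b.
Proof.
rewrite -[a - b]addrC -scaleN1r trho_linear.
by rewrite scaleN1r addrC.
Qed.

Lemma trhoM l (a b : 'M[C]_((l.+1)`!)) : trho (a *m b) = trho a \o trho b.
Proof.
rewrite /trho -(rhoM S); congr (rho E _).
by rewrite !mulmxA -(mulmxA _ (sval (twist l))) tw2 mulmx1.
Qed.

Lemma trho_adj l (a : 'M[C]_((l.+1)`!)) u v : dot (trho a u) v = dot u (trho (a^t*) v).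
Proof. by rewrite /trho (rho_adj S) !trmx_mul !map_mxM trmxCK mulmxA. Qed.

Let tw_norm l : mxnorm_le (sval (twist l)) 1.
Proof.
apply/mxnorm_le_sq => // v; rewrite expr1n mul1r !sqnormE trmx_mul map_mxM.
by rewrite mulmxA -(mulmxA _ _ (sval (twist l))) tw1 mulmx1.
Qed.

Lemma trho_bnd l (a : 'M[C]_((l.+1)`!)) K : 0 <= K -> mxnorm_le a K -> bnd (trho a) K.
Proof.
move=> K0 aK; apply: (rho_bnd S) => //; rewrite -[K]mulr1.
apply: mxnorm_leM; [exact: K0| |exact: tw_norm].
rewrite -[K]mul1r; apply: mxnorm_leM => //.
by apply: mxnorm_leT; [exact: ler01|exact: tw_norm].
Qed.

Lemma trho_faithful l (a : 'M[C]_((l.+1)`!)) K :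
  0 <= K -> bnd (trho a) K -> mxnorm_le a K.
Proof.
move=> K0 /(rho_faithful S K0) aK.
set u := sval (twist l) in aK.
have -> : a = u *m (u^t* *m a *m u) *m u^t*.
  by rewrite !mulmxA tw2 mul1mx -mulmxA tw2 mulmx1.
rewrite -[K]mulr1; apply: mxnorm_leM; [exact: K0| |].
  by rewrite -[K]mul1r; apply: mxnorm_leM => //; exact: tw_norm.
by apply: mxnorm_leT; [exact: ler01|exact: tw_norm].
Qed.

Lemma trho_lin l (a : 'M[C]_((l.+1)`!)) : linear (trho a).
Proof. exact: (rho_lin S). Qed.

Lemma trho_ops l (a : 'M[C]_((l.+1)`!)) : ops d E (trho a).
Proof. by exists l; eexists. Qed.

Lemma ops_trho A : ops d E A -> exists l (a : 'M[C]_((l.+1)`!)), A = trho a.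
Proof.
move=> [l [a ->]]; exists l, (sval (twist l) *m a *m (sval (twist l))^t*).
rewrite /trho !mulmxA tw1 mul1mx -mulmxA tw1 mulmx1//.
Qed.

(** ** The limit of the representations *)
(** Operator bounds are used pointwise; e' is the operator bound that is needed
   at the vector u for the accuracy e. *)
Lemma bnd_small (e : R) (u : V) : 0 < e -> exists2 e', 0 < e' & e' * nrm u <= e.
Proof.
move=> e0; have c0 : 0 < nrm u + 1 by rewrite ltr_wpDl// hnorm_ge0.
exists (e / (nrm u + 1)); first exact: divr_gt0.
by rewrite mulrAC ler_pdivrMr// ler_pM2l// lerDl.
Qed.

Lemma trho_cauchy a : uhf_coherent phi a -> forall e, 0 < e ->
  exists n, forall m k, (n <= m)%N -> bnd (trho (a (k + m)%N) - trho (a m)) e.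
Proof.
move=> [_ ha] e e0; have [n h] := ha e e0; exists n => m k nm.
by rewrite -(trho_push (a m) k) -trhoB; apply: trho_bnd (ltW e0) _; exact: h.
Qed.

Lemma trho_cvg a u : uhf_coherent phi a ->
  exists v, hcvg dot (fun n => trho (a n) u) v.
Proof.
move=> ha; apply: (hcomplete H) => e e0.
have [e' e'0 he] := bnd_small u (divr_gt0 e0 (ltr0n R 2)).
have [n h] := trho_cauchy ha e'0; exists n => m k nm nk.
apply: le_trans (hnorm_tri H (trho (a n) u) _ _) _; rewrite (splitr e); apply: lerD.
  by rewrite -(subnK nm); apply: le_trans (h _ _ (leqnn n) u) he.
rewrite (hnormB H) -(subnK nk); exact: le_trans (h _ _ (leqnn n) u) he.
Qed.

Definition ulim (a : uhf_fun phi) (u : V) : V :=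
  sval (cid (trho_cvg u (asboolW (uhf_valP a)))).

Lemma ulimP (a : uhf_fun phi) u : hcvg dot (fun n => trho (uhf_val a n) u) (ulim a u).
Proof. by rewrite /ulim; case: cid. Qed.

Lemma hcvg_le (x : nat -> V) v w K n : hcvg dot x v ->
  (forall m, (n <= m)%N -> nrm (x m - w) <= K) -> nrm (v - w) <= K.
Proof.
move=> xv h; apply/ler_addgt0Pr => e e0; have [m hm] := xv _ e0.
apply: le_trans (hnorm_tri H (x (maxn m n)) _ _) _; rewrite addrC.
by apply: lerD; [exact/h/leq_maxr|rewrite (hnormB H); exact/hm/leq_maxl].
Qed.

Lemma ulim_approx a e : 0 < e ->
  exists n, forall m, (n <= m)%N -> bnd (ulim a - trho (uhf_val a m)) e.
Proof.
move=> e0; have [n h] := trho_cauchy (asboolW (uhf_valP a)) e0.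
exists n => m nm u; rewrite opB; apply: (hcvg_le (n := m) (ulimP a u)) => k mk.
by rewrite -(subnK mk); exact: h.
Qed.

Lemma ulim_lin a : linear (ulim a).
Proof.
move=> c u v; apply: (hcvg_unique H (ulimP a _)).
have := hcvg_lin H c (ulimP a u) (ulimP a v).
by under eq_fun => n do rewrite -(trho_lin (uhf_val a n)).
Qed.

Lemma ulim_linear : linear ulim.
Proof.
move=> c a b; apply/funext => u; apply: (hcvg_unique H (ulimP _ u)).
have := hcvg_lin H c (ulimP a u) (ulimP b u).
by under eq_fun => n do rewrite -opL -trho_linear.
Qed.

Lemma ulim_bounded a : bounded_op dot (ulim a).
Proof.
split; first exact: ulim_lin.
have [K K0 aK] := uhf_boundedP (asboolW (uhf_valP a)); exists K => u.
rewrite -[ulim a u]subr0; apply: (hcvg_le (n := 0%N) (ulimP a u)) => m _.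
by rewrite subr0; apply: (trho_bnd (ltW K0)).
Qed.

Lemma ulimM a b : ulim (a * b) = ulim a \o ulim b.
Proof.
apply/funext => u; apply: (hcvg_unique H (ulimP _ u)) => e e0.
have [K K0 aK] := uhf_boundedP (asboolW (uhf_valP a)).
have e2 : 0 < e / 2 by exact: divr_gt0.
have [n1 h1] := ulimP b u (divr_gt0 e2 K0); have [n2 h2] := ulimP a (ulim b u) e2.
exists (maxn n1 n2) => m; rewrite geq_max => /andP[m1 m2].
rewrite -[uhf_val _ m]/(uhf_val a m *m uhf_val b m) trhoM /=.
apply: le_trans (hnorm_tri H (trho (uhf_val a m) (ulim b u)) _ _) _.
rewrite (splitr e); apply: lerD; last exact: h2.
rewrite -(linB (trho_lin _)); apply: le_trans (trho_bnd (ltW K0) (aK m) _) _.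
by rewrite mulrC -ler_pdivlMr// h1.
Qed.

Lemma ulim_adj a u v : dot (ulim a u) v = dot u (ulim (uhf_fun_star a) v).
Proof.
apply: (hdot_cvg H (ulimP a u) (ulimP (uhf_fun_star a) v)) => n.
exact: trho_adj.
Qed.

(** The kernel consists of the null sequences because [trho] is isometric. *)
Lemma ulim_null a : ulim a = 0 <-> a \in @uhf_null R phi.
Proof.
split=> [a0|/asboolP a0].
  apply/asboolP => e e0; have [n h] := ulim_approx a e0; exists n => m nm.
  apply: (trho_faithful (ltW e0)) => u; have := h m nm u.
  by rewrite a0 opB sub0r (hnormN H).
apply/funext => u; apply: (hcvg_unique H (ulimP a u)) => e e0.
have [e' e'0 he] := bnd_small u e0; have [n h] := a0 _ e'0.
exists n => m nm; rewrite subr0; apply: le_trans he.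
exact: (trho_bnd (ltW e'0) (h m nm)).
Qed.

Lemma ulim_op_closure a : op_closure dot (ops d E) (ulim a).
Proof.
split; first exact: ulim_bounded.
move=> e e0; have [n h] := ulim_approx a e0; exists (trho (uhf_val a n)) => //.
  exact: trho_ops.
exact: h.
Qed.

(** An operator of the closure has approximants of every accuracy at all large
   levels.  A sequence with one matrix per level that is eventually as accurate as
   any prescribed bound is coherent, since distances of matrices can be read off
   from the operators. *)
Lemma ulim_surj A : op_closure dot (ops d E) A -> exists a, ulim a = A.
Proof.
move=> [bA cA]; have [K K0 AK] := bounded_op_bnd bA.
pose P l n (x : 'M[C]_((l.+1)`!)) := bnd (A - trho x) n.+1%:R^-1.
have mono (n m : nat) : (n <= m)%N -> m.+1%:R^-1 <= n.+1%:R^-1 :> R.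
  by move=> nm; rewrite lef_pV2 ?posrE// ler_nat.
(* at level l, the matrix x realizes simultaneously all of the accuracies
   1 / (n + 1), n <= N, that some matrix of this level realizes *)
have best l N : exists x : 'M[C]_((l.+1)`!), bnd (A - trho x) (K + 1) /\
    forall n, (n <= N)%N -> (exists y, @P l n y) -> @P l n x.
  elim: N => [|N [x [x1 xn]]].
    have [[y Py]|nP] := pselect (exists y, @P l 0%N y).
      exists y; split; last by case.
      by apply: bndW Py; rewrite invr1 lerDr ltW.
    exists 0; split; last by case.
    have t0 : trho (0 : 'M[C]_((l.+1)`!)) = 0.
      by have := trhoB (0 : 'M[C]_((l.+1)`!)) 0; rewrite subrr => ->; rewrite subrr.
    by rewrite t0 subr0; apply: bndW AK; rewrite lerDl.
  have [[y Py]|nP] := pselect (exists y, @P l N.+1 y).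
    exists y; split.
      apply: bndW Py; apply: le_trans (mono 0%N N.+1 isT) _.
      by rewrite invr1 lerDr ltW.
    by move=> n nN _; apply: bndW Py; exact: mono.
  exists x; split=> // n; rewrite leq_eqVlt => /predU1P[->//|]; exact: xn.
have [a ha] : exists a : mxseq R, forall l, bnd (A - trho (a l)) (K + 1) /\
    forall n, (n <= l)%N -> (exists y, @P l n y) -> @P l n (a l).
  by exists (fun l => sval (cid (best l l))) => l; exact: svalP (cid (best l l)).
have good n : exists l, forall m, (l <= m)%N -> @P m n (a m).
  have n0 : 0 < n.+1%:R^-1 :> R by rewrite invr_gt0.
  have [_ /ops_trho[l [x ->]] hx] := cA _ n0.
  exists (maxn n l) => m; rewrite geq_max => /andP[nm lm].
  apply: (ha m).2 => //; rewrite -(subnK lm).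
  by exists (uhf_push phi x (m - l)); rewrite /P trho_push.
have small e : 0 < e -> exists n, n.+1%:R^-1 <= e :> R.
  move=> e0; have [n _ hn] := near_infty_natSinv_lt (PosNum e0).
  by exists n; apply/ltW/hn => /=.
have coh : uhf_coherent phi a.
  split.
    exists ((K + 1) + K) => l; apply: trho_faithful.
      by rewrite !addr_ge0// ltW.
    have -> : trho (a l) = - ((A - trho (a l)) - A) by rewrite opprB subKr.
    move=> u; rewrite -[(- _ : V -> V) u]/(- (((A - trho (a l)) - A) u)) (hnormN H).
    by apply: (bnd_sub H) => //; exact: (ha l).1.
  move=> e e0; have [n hn] := small _ (divr_gt0 e0 (ltr0n R 2)).
  have [l hl] := good n; exists l => m k lm.
  apply: trho_faithful (ltW e0) _; rewrite trhoB trho_push.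
  have -> : trho (a (k + m)%N) - trho (a m) = (A - trho (a m)) - (A - trho (a (k + m)%N)).
    by rewrite opprB [RHS]addrC subrKA.
  rewrite (splitr e); apply: (bnd_sub H); apply: bndW hn _; apply: hl => //.
  by rewrite (leq_trans lm)// leq_addl.
have acoh : a \in uhf_seq phi by exact/asboolP.
exists (UhfFun acoh); apply/funext => u; apply: (hcvg_unique H (ulimP _ u)) => e e0.
have [e' e'0 he] := bnd_small u e0; have [n hn] := small _ e'0; have [l hl] := good n.
exists l => m lm; rewrite (hnormB H); apply: le_trans (hl m lm u) _.
by apply: le_trans he; rewrite ler_wpM2r// hnorm_ge0.
Qed.

Lemma uhf_isomorphism : exists f : uhf phi -> (V -> V),
  [/\ linear f, forall a b, f (a * b) = f a \o f b,
      forall a u v, dot (f a u) v = dot u (f (star a) v) &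
      set_bij [set: uhf phi] (op_closure dot (ops d E)) f].
Proof.
pose f (a : uhf phi) := ulim (repr a).
have f_pi a : f (\pi_(uhf phi) a)%qT = ulim a.
  apply/eqP; rewrite -subr_eq0; apply/eqP.
  have /ulim_null : repr (\pi_(uhf phi) a)%qT - a \in @uhf_null R phi.
    by apply/uhf_eqP; rewrite reprK.
  by rewrite -scaleN1r addrC ulim_linear scaleN1r addrC.
exists f; split.
- move=> c a b; rewrite -[a]reprK -[b]reprK -pi_uhf_scale -raddfD !f_pi.
  exact: ulim_linear.
- by move=> a b; rewrite -[a]reprK -[b]reprK -pi_uhf_mulE !f_pi ulimM.
- move=> a u v; rewrite -[a]reprK -[star _]pi_uhf_star !f_pi; exact: ulim_adj.
split.
- by move=> a _; exact: ulim_op_closure.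
- move=> a b _ _; rewrite -[a]reprK -[b]reprK !f_pi => ab; apply/uhf_eqP/ulim_null.
  by rewrite -scaleN1r addrC ulim_linear scaleN1r ab addNr.
- by move=> A /ulim_surj[a <-]; exists (\pi_(uhf phi) a)%qT.
Qed.
End uhf_representation.

(** * Rational translations of the torus *)
Section translation_invariance.
Variable R : realType.
Local Notation leb := (@lebesgue_measure R).

Lemma lebesgue_measure_translate (t : R) (A : set (measurableTypeR R)) :
  measurable A -> leb ((fun x => x + t) @^-1` A) = leb A.
Proof.
move=> mA.
have mf : measurable_fun setT (fun x : measurableTypeR R => x + t : measurableTypeR R).
  by apply: measurable_funD; [exact: measurable_id|exact: measurable_cst].
pose f : {mfun measurableTypeR R >-> measurableTypeR R} :=
  HB.pack (fun x : measurableTypeR R => x + t : measurableTypeR R)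
    (isMeasurableFun.Build _ _ _ _ _ mf).
rewrite [RHS](@lebesgue_measure_unique _ (pushforward leb f))//.
move=> X /ocitvP[->|[[a b] /= ab ->]]; first by rewrite !measure0.
rewrite /pushforward (_ : f @^-1` _ = `]a - t, b - t]%classic); last first.
  by apply/seteqP; split => x /=; rewrite !in_itv /= ltrBlDr lerBrDr.
rewrite !lebesgue_measure_itv /= !lte_fin ltrD2r ab -!EFinB; congr _%:E; ring.
Qed.

Lemma to_circleP (x y : R) :
  to_circle x = to_circle y <-> exists k : int, x = y + k%:~R.
Proof.
split=> [/(congr1 val) /= e|[k ->]].
  exists (Num.floor x - Num.floor y).
  by move: e; rewrite intrB => e; lra.
apply: val_inj => /=.
have -> : Num.floor (y + k%:~R) = Num.floor y + k.
  by rewrite floorDrz ?intr_int// intrKfloor.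
by rewrite intrD; ring.
Qed.

Lemma to_circleK (z : circle R) : to_circle (val z) = z.
Proof.
apply: val_inj => /=; rewrite (_ : Num.floor (val z) = 0) ?subr0//.
by apply/eqP; rewrite floor_eq; exact: (valP z).
Qed.

Lemma val_to_circle (x : R) : exists k : int, val (to_circle x) = x + k%:~R.
Proof. by exists (- Num.floor x); rewrite /= mulrNz. Qed.

Lemma measurable_val_circle :
  measurable_fun setT (val : circle R -> measurableTypeR R).
Proof. by move=> _ A mA; rewrite setTI; exists A => //; rewrite setTI. Qed.

Definition circle_shift (t : R) (z : circle R) : circle R := to_circle (val z + t).

Lemma circle_shiftD s t z : circle_shift s (circle_shift t z) = circle_shift (t + s) z.
Proof.
have [k e] := val_to_circle (val z + t).
by apply/to_circleP; exists k; rewrite [val _]e; ring.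
Qed.

Lemma circle_shift_int (k : int) z : circle_shift k%:~R z = z.
Proof. by rewrite -[RHS]to_circleK; apply/to_circleP; exists k. Qed.

Lemma measurable_circle_shift t : measurable_fun setT (circle_shift t).
Proof.
apply: (measurableT_comp (measurable_to_circle (R := R))).
by apply: measurable_funD; [exact: measurable_val_circle|exact: measurable_cst].
Qed.

Let circle_measureE (A : set (circle R)) :
  circle_measure R A = leb ((to_circle (R := R) @^-1` A) `&` `[0, 1[%classic).
Proof. by []. Qed.

(** Cut [0, 1) at the fractional part s of t: the part below 1 - s is translated
   by s, and the rest by s - 1; both translations preserve Lebesgue measure. *)
Lemma circle_measure_shift (t : R) (A : set (circle R)) : measurable A ->
  circle_measure R (circle_shift t @^-1` A) = circle_measure R A.
Proof.
move=> mA; rewrite !circle_measureE.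
set B : set (measurableTypeR R) := (to_circle (R := R)) @^-1` A.
have mB : measurable B.
  by rewrite -[B]setTI; exact: (measurable_to_circle measurableT mA).
have BD (k : int) (x : R) : B (x + k%:~R) = B x.
  by rewrite /B /preimage /= (_ : to_circle (x + k%:~R) = to_circle x)//;
    apply/to_circleP; exists k.
pose s := t - (Num.floor t)%:~R.
have /andP[s0 s1] : 0 <= s < 1 by exact: frac_itv.
have -> : (to_circle (R := R)) @^-1` (circle_shift t @^-1` A) =
    (fun x : measurableTypeR R => x + s) @^-1` B.
  apply/funext => x /=; rewrite /preimage/= -(BD (Num.floor t)).
  rewrite /B /preimage /=; congr A; apply/to_circleP.
  have [k ->] := val_to_circle x; exists k; rewrite /s; ring.
have mc (a b : R) : measurable (`[a, b[%classic : set (measurableTypeR R)).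
  exact: measurable_itv.
have -> : ((fun x : measurableTypeR R => x + s) @^-1` B) `&` `[0, 1[%classic =
    (fun x : measurableTypeR R => x + s) @^-1`
      (B `&` `[s, 1[%classic `|` B `&` `[1, 1 + s[%classic).
  rewrite -setIUr; apply/seteqP; split => x /=; rewrite !in_itv/= => -[Bx xs];
    split=> //.
    by case/andP: xs => x0 x1; case: (ltP (x + s) 1) => h; [left|right];
      apply/andP; split; lra.
  by apply/andP; case: xs => /andP[? ?]; split; lra.
rewrite lebesgue_measure_translate; last by apply: measurableU; exact: measurableI.
rewrite measureU; [|exact: measurableI|exact: measurableI|]; last first.
  apply/seteqP; split => // x /=; rewrite !in_itv/=.
  by move=> [[_ /andP[_ h1]] [_ /andP[h2 _]]]; move: (lt_le_trans h1 h2); rewrite ltxx.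
rewrite [X in (_ + X)%E](_ : _ = leb (B `&` `[0, s[%classic)); last first.
  rewrite -[LHS](@lebesgue_measure_translate 1); last exact: measurableI.
  congr (leb _); apply/seteqP; split => x /=; rewrite !in_itv/=.
    rewrite (BD 1) => -[Bx /andP[h1 h2]]. by split=> //; apply/andP; split; lra.
  by move=> [Bx /andP[h1 h2]]; split; [rewrite (BD 1)|apply/andP; split; lra].
rewrite addeC -measureU; [|exact: measurableI|exact: measurableI|]; last first.
  apply/seteqP; split => // x /=; rewrite !in_itv/=.
  by move=> [[_ /andP[_ h1]] [_ /andP[h2 _]]]; move: (lt_le_trans h1 h2); rewrite ltxx.
rewrite -setIUr; congr (leb (B `&` _)); apply/seteqP; split => x /=; rewrite !in_itv/=.
  by case=> /andP[h1 h2]; apply/andP; split; lra.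
by case/andP => h1 h2; case: (ltP x s) => h; [left|right]; rewrite ?h1 ?h ?h2.
Qed.

Definition vshift N (h : 'I_N -> R) (x : torus R N) : torus R N :=
  [tuple circle_shift (h j) (tnth x j) | j < N].

Lemma measurable_vshift N (h : 'I_N -> R) : measurable_fun setT (vshift h).
Proof.
apply/measurable_fun_tnthP => i.
rewrite (_ : _ \o _ = circle_shift (h i) \o (fun x => tnth x i)); last first.
  by apply/funext => x /=; rewrite tnth_mktuple.
by apply: measurableT_comp; [exact: measurable_circle_shift|exact: measurable_tnth].
Qed.

(** A product measure is determined by its values on rectangles. *)
Lemma torus_measure_vshift N (h : 'I_N -> R) (A : set (torus R N)) :
  measurable A -> torus_measure R N (vshift h @^-1` A) = torus_measure R N A.
Proof.
elim: N h A => [|N IH] h A mA.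
  congr (torus_measure R 0 _); apply/funext => x; rewrite /preimage/=.
  by congr A; apply: eq_from_tnth => -[].
pose h0 := h ord0; pose h' (j : 'I_N) := h (lift ord0 j).
pose s (z : circle R * torus R N) := (circle_shift h0 z.1, vshift h' z.2).
have ms : measurable_fun setT s.
  by apply: measurable_fun_pair; apply: measurableT_comp;
    [exact: measurable_circle_shift|exact: measurable_fst
    |exact: measurable_vshift|exact: measurable_snd].
pose sm : {mfun (circle R * torus R N)%type >-> (circle R * torus R N)%type} :=
  HB.pack s (isMeasurableFun.Build _ _ _ _ _ ms).
have mB : measurable (@torus_cons R N @^-1` A).
  by rewrite -[X in measurable X]setTI; exact: (measurable_torus_cons measurableT mA).
rewrite [RHS]/= [LHS]/= /distribution /pushforward.
have -> : @torus_cons R N @^-1` (vshift h @^-1` A) = s @^-1` (@torus_cons R N @^-1` A).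
  apply/funext => -[z x]; rewrite /preimage/=; congr A.
  apply: eq_from_tnth => j; rewrite tnth_mktuple.
  case: (unliftP ord0 j) => [k ->|->]; first by rewrite !tnthS /= tnth_mktuple.
  by rewrite !tnth0.
symmetry.
apply: (@product_measure_unique _ _ _ _ _ (circle_measure R) (torus_measure R N)
  (pushforward (circle_measure R \x torus_measure R N)%E sm)) => // X Y mX mY.
change ((circle_measure R \x torus_measure R N)%E
  ((circle_shift h0 @^-1` X) `*` (vshift h' @^-1` Y)) =
  (circle_measure R X * torus_measure R N Y)%E).
have mX' : measurable (circle_shift h0 @^-1` X).
  by rewrite -[_ @^-1` _]setTI; exact: (measurable_circle_shift _ measurableT mX).
have mY' : measurable (vshift h' @^-1` Y).
  by rewrite -[_ @^-1` _]setTI; exact: (measurable_vshift _ measurableT mY).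
transitivity (circle_measure R (circle_shift h0 @^-1` X) *
    torus_measure R N (vshift h' @^-1` Y))%E; first exact: product_measure1E.
by congr (_ * _)%E; [exact: circle_measure_shift|exact: IH].
Qed.

Lemma vshiftD N (h k : 'I_N -> R) x : vshift h (vshift k x) = vshift (fun j => k j + h j) x.
Proof. by apply: eq_from_tnth => j; rewrite !tnth_mktuple circle_shiftD. Qed.

Lemma vshift_int N (k : 'I_N -> int) x : vshift (fun j => (k j)%:~R) x = x.
Proof. by apply: eq_from_tnth => j; rewrite !tnth_mktuple circle_shift_int. Qed.

Lemma torus_shiftE N (i : 'I_N) t x :
  torus_shift i t x = vshift (fun j => if j == i then t else 0) x.
Proof.
apply: eq_from_tnth => j; rewrite !tnth_mktuple /circle_shift.
by case: ifP; rewrite ?addr0 ?to_circleK.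
Qed.
End translation_invariance.

(** * The Hilbert space of square-integrable functions *)
Section L2_hilbert.
Variables (R : realType) (N M : nat).
Local Notation C := R[i].
Local Notation mu := (torus_measure R N).
Local Notation fT := (torus R N -> 'cV[C]_M).
Local Notation L2 := (L2 R N M).
Local Notation dot := (@L2_dot R N M).
Local Notation cls := (@L2_class R N M).
Implicit Types (f g : fT) (u v : L2).

Lemma L2_sqint u : sqint_prop (L2_fun u).
Proof. exact: (asboolW (sqint_valP (repr u))). Qed.

Lemma L2_funK u : cls (L2_fun u) = u.
Proof.
rewrite /L2_class; have -> : insubd (0 : sqint_fun R N M) (L2_fun u) = repr u.
  by apply: val_inj; rewrite insubdK//; exact: sqint_valP.
exact: reprK.
Qed.

Lemma L2_fun_class f : sqint_prop f -> {ae mu, forall x, L2_fun (cls f) x = f x}.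
Proof.
move=> hf; have fP : f \in @sqint R N M by exact/asboolP.
have /(quotmod_eqP (@ae_zero R N M))/asboolP :
    (repr (cls f) = insubd (0 : sqint_fun R N M) f %[mod L2])%qT.
  by rewrite reprK.
apply: filterS => x /eqP; rewrite -[X in X x]/(L2_fun (cls f) \- val (insubd (0 : sqint_fun R N M) f)).
by rewrite insubdK//= subr_eq0 => /eqP.
Qed.

Lemma L2_class_eq f g : sqint_prop f -> sqint_prop g ->
  {ae mu, forall x, f x = g x} -> cls f = cls g.
Proof.
move=> hf hg fg; apply/(quotmod_eqP (@ae_zero R N M))/asboolP; move: fg; apply: filterS => x fg.
rewrite -[LHS]/((val (insubd (0 : sqint_fun R N M) f) \- val (insubd (0 : sqint_fun R N M) g)) x).
by rewrite !insubdK/= ?fg ?subrr//; exact/asboolP.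
Qed.

Lemma L2_class_lin (a : C) f g : sqint_prop f -> sqint_prop g ->
  cls (fun x => a *: f x + g x) = a *: cls f + cls g.
Proof.
move=> hf hg; rewrite /L2_class -[a *: _](pi_quot_scale (ae_zero (R := R) (N := N) (M := M))).
rewrite -raddfD; congr (\pi_ _)%qT; apply: val_inj.
have hfg : sqint_prop (a *: f + g).
  by have [_ h] := @sqint_submod_closed R N M; apply/asboolP/h; exact/asboolP.
rewrite [LHS]insubdK; last exact/asboolP.
rewrite -[RHS]/(a *: val (insubd _ f) + val (insubd _ g)).
by rewrite !insubdK//; exact/asboolP.
Qed.

Lemma sqint_lin (a : C) f g : sqint_prop f -> sqint_prop g ->
  sqint_prop (fun x => a *: f x + g x).
Proof.
by move=> hf hg; have [_ h] := @sqint_submod_closed R N M;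
  apply/asboolP/(h a f g); exact/asboolP.
Qed.

Lemma sqintB f g : sqint_prop f -> sqint_prop g -> sqint_prop (fun x => f x - g x).
Proof.
move=> hf hg; have := sqint_lin (-1) hg hf.
by under eq_fun do rewrite scaleN1r addrC.
Qed.

Lemma L2_classB f g : sqint_prop f -> sqint_prop g ->
  cls (fun x => f x - g x) = cls f - cls g.
Proof.
move=> hf hg; have := L2_class_lin (-1) hg hf.
by under eq_fun do rewrite scaleN1r addrC; rewrite scaleN1r addrC.
Qed.

Lemma sqintD f g : sqint_prop f -> sqint_prop g -> sqint_prop (fun x => f x + g x).
Proof.
move=> hf hg; have := sqint_lin 1 hf hg; congr sqint_prop.
by apply/funext => x; rewrite scale1r.
Qed.

Lemma L2_classD f g : sqint_prop f -> sqint_prop g ->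
  cls (fun x => f x + g x) = cls f + cls g.
Proof.
move=> hf hg; rewrite -[cls f]scale1r -L2_class_lin//; congr cls.
by apply/funext => x; rewrite scale1r.
Qed.

Lemma sqint0 : sqint_prop ((fun=> 0) : fT).
Proof. by move: (@sqint_submod_closed R N M) => [/asboolP h _]; exact: h. Qed.

Lemma L2_class0 : cls (fun=> 0) = 0.
Proof.
have := L2_class_lin (-1) sqint0 sqint0; rewrite [_ *: cls _]scaleN1r addNr => <-.
by congr cls; apply/funext => t; rewrite scaler0 addr0.
Qed.

Lemma sqint_scale (a : C) f : sqint_prop f -> sqint_prop (fun t => a *: f t).
Proof.
move=> hf; have := sqint_lin a hf sqint0.
by congr sqint_prop; apply/funext => t; rewrite addr0.
Qed.

Definition pdot (a b : 'cV[C]_M) : C := \sum_j a j 0 * Num.conj (b j 0).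

Lemma pdotL (c : C) a a' b : pdot (c *: a + a') b = c * pdot a b + pdot a' b.
Proof.
rewrite /pdot mulr_sumr -big_split; apply: eq_bigr => j _.
by rewrite !mxE mulrDl mulrA.
Qed.

Lemma pdotC a b : pdot b a = Num.conj (pdot a b).
Proof.
rewrite /pdot rmorph_sum; apply: eq_bigr => j _.
by rewrite rmorphM /= conjCK mulrC.
Qed.

Lemma pdot_sq a : pdot a a = (sqnorm a)%:C%C.
Proof.
rewrite /pdot /sqnorm rmorph_sum; apply: eq_bigr => j _.
by rewrite cmod_conj /cmod sqr_sqrtr// addr_ge0 ?sqr_ge0.
Qed.

Lemma pdot_ReE a b : Re (pdot a b) =
  \sum_j (Re (a j 0) * Re (b j 0) + Im (a j 0) * Im (b j 0)).
Proof.
rewrite /pdot raddf_sum; apply: eq_bigr => j _.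
by case: (a j 0) (b j 0) => [? ?] [? ?] /=; ring.
Qed.

Lemma pdot_Re_le a b : `|Re (pdot a b)| <= sqnorm a + sqnorm b.
Proof.
rewrite pdot_ReE /sqnorm -big_split; apply: le_trans (ler_norm_sum _ _ _) _.
apply: ler_sum => j _; case: (a j 0) (b j 0) => [x y] [z t] /=.
rewrite ler_norml; have := sqr_ge0 (x - z); have := sqr_ge0 (y - t).
have := sqr_ge0 (x + z); have := sqr_ge0 (y + t).
by move=> ? ? ? ?; apply/andP; split; nra.
Qed.

Lemma integrable_sqnorm f : sqint_prop f ->
  mu.-integrable setT (EFin \o (fun x => sqnorm (f x))).
Proof.
move=> [fR fI fi]; apply/integrableP; split.
  by apply/measurable_EFinP; exact: measurable_sqnorm.
by under eq_integral => x _ do rewrite /= ger0_norm ?sqnorm_ge0//.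
Qed.

Lemma integrable_Re f g : sqint_prop f -> sqint_prop g ->
  mu.-integrable setT (EFin \o (fun x => Re (pdot (f x) (g x)))).
Proof.
move=> hf hg; have [fR fI fi] := hf; have [gR gI gi] := hg.
apply: (@le_integrable _ _ _ mu _ measurableT _
  ((EFin \o (fun x => sqnorm (f x))) \+ (EFin \o (fun x => sqnorm (g x))))%E) => //.
- apply/measurable_EFinP; under eq_fun do rewrite pdot_ReE.
  by apply: measurable_sum => j; apply: measurable_funD; apply: measurable_funM.
- move=> x _ /=; rewrite lee_fin (le_trans (pdot_Re_le _ _))// ler_norm//.
- by apply: integrableD => //; exact: integrable_sqnorm.
Qed.

Lemma pdot_Im a b : Im (pdot a b) = Re (pdot a ('i%C *: b)).
Proof.
rewrite /pdot !raddf_sum; apply: eq_bigr => j _; rewrite mxE.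
by case: (a j 0) (b j 0) => [? ?] [? ?] /=; ring.
Qed.

Lemma integrable_Im f g : sqint_prop f -> sqint_prop g ->
  mu.-integrable setT (EFin \o (fun x => Im (pdot (f x) (g x)))).
Proof.
move=> hf hg; rewrite (_ : _ \o _ = EFin \o (fun x => Re (pdot (f x) ('i%C *: g x)))).
  exact: integrable_Re hf (sqint_scale _ hg).
by apply/funext => x /=; rewrite pdot_Im.
Qed.

Definition fdot f g : C :=
  Complex (\int[mu]_x Re (pdot (f x) (g x))) (\int[mu]_x Im (pdot (f x) (g x))).

Lemma fdotL (c : C) f f' g : sqint_prop f -> sqint_prop f' -> sqint_prop g ->
  fdot (fun x => c *: f x + f' x) g = c * fdot f g + fdot f' g.
Proof.
move=> hf hf' hg; have iR := integrable_Re hf hg; have iI := integrable_Im hf hg.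
have iR' := integrable_Re hf' hg; have iI' := integrable_Im hf' hg.
have Z (r : R) (k : torus R N -> R) : mu.-integrable setT (EFin \o k) ->
    mu.-integrable setT (EFin \o (fun x => r * k x)).
  move=> ik; rewrite (_ : _ \o _ = (fun x => r%:E * (k x)%:E)%E)//.
  exact: integrableZl.
apply/eqP; rewrite eq_complex; apply/andP; split; apply/eqP.
  rewrite /fdot; case: c => a b /=.
  under eq_Rintegral => x _ do rewrite pdotL.
  transitivity (\int[mu]_x ((a * Re (pdot (f x) (g x)) - b * Im (pdot (f x) (g x))) +
      Re (pdot (f' x) (g x)))).
    by apply: eq_Rintegral => x _; case: (pdot (f x) _) (pdot (f' x) _) => [? ?] [? ?].
  rewrite RintegralD//; last first.
    by apply: (@integrableB _ _ _ mu _ measurableT (EFin \o _) (EFin \o _)); exact: Z.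
  rewrite RintegralB//; [|exact: Z|exact: Z].
  by rewrite !RintegralZl.
rewrite /fdot; case: c => a b /=.
under eq_Rintegral => x _ do rewrite pdotL.
transitivity (\int[mu]_x ((a * Im (pdot (f x) (g x)) + b * Re (pdot (f x) (g x))) +
    Im (pdot (f' x) (g x)))).
  by apply: eq_Rintegral => x _; case: (pdot (f x) _) (pdot (f' x) _) => [? ?] [? ?].
rewrite RintegralD//; last first.
  by apply: (@integrableD _ _ _ mu _ measurableT (EFin \o _) (EFin \o _)); exact: Z.
rewrite RintegralD//; [|exact: Z|exact: Z].
by rewrite !RintegralZl.
Qed.

Lemma fdot_ae f f' g g' : sqint_prop f -> sqint_prop f' -> sqint_prop g -> sqint_prop g' ->
  {ae mu, forall x, f x = f' x} -> {ae mu, forall x, g x = g' x} -> fdot f g = fdot f' g'.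
Proof.
move=> hf hf' hg hg' ff' gg'; rewrite /fdot /Rintegral; congr (Complex (fine _) (fine _)).
  apply: ae_eq_integral => //.
  - exact: (measurable_int mu (integrable_Re hf hg)).
  - exact: (measurable_int mu (integrable_Re hf' hg')).
  by move: ff' gg'; apply: filterS2 => x -> -> .
apply: ae_eq_integral => //.
- exact: (measurable_int mu (integrable_Im hf hg)).
- exact: (measurable_int mu (integrable_Im hf' hg')).
by move: ff' gg'; apply: filterS2 => x -> -> .
Qed.

Lemma L2_dotE u v : dot u v = fdot (L2_fun u) (L2_fun v). Proof. by []. Qed.

Lemma dot_class f g : sqint_prop f -> sqint_prop g -> dot (cls f) (cls g) = fdot f g.
Proof.
move=> hf hg; rewrite L2_dotE.
by apply: fdot_ae => //; [exact: L2_sqint|exact: L2_sqint|exact: L2_fun_class|exact: L2_fun_class].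
Qed.

Lemma fdot_sq f : fdot f f = (\int[mu]_x sqnorm (f x))%:C%C.
Proof.
rewrite /fdot; congr Complex; first by apply: eq_Rintegral => x _; rewrite pdot_sq.
transitivity (\int[mu]_x (0 : R)); first by apply: eq_Rintegral => x _; rewrite pdot_sq.
by rewrite Rintegral_cst// mul0r.
Qed.

Lemma L2_normE u : L2_norm u = hnorm dot u.
Proof. by rewrite /hnorm L2_dotE fdot_sq. Qed.

Lemma L2_norm_class f : sqint_prop f ->
  ((hnorm dot (cls f)) ^+ 2)%:E = (\int[mu]_x (sqnorm (f x))%:E)%E.
Proof.
move=> hf; rewrite /hnorm dot_class// fdot_sq /= sqr_sqrtr; last first.
  by apply: Rintegral_ge0 => x _; exact: sqnorm_ge0.
rewrite /Rintegral fineK//; apply: integrable_fin_num => //; exact: integrable_sqnorm.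
Qed.

Let dotL a u v w : dot (a *: u + v) w = a * dot u w + dot v w.
Proof.
rewrite -{1}[u]L2_funK -{1}[v]L2_funK -L2_class_lin; [|exact: L2_sqint|exact: L2_sqint].
rewrite -{1}[w]L2_funK dot_class; [|apply: sqint_lin; exact: L2_sqint|exact: L2_sqint].
by rewrite fdotL//; exact: L2_sqint.
Qed.

Let dotC u v : dot v u = Num.conj (dot u v).
Proof.
rewrite !L2_dotE /fdot; apply/eqP; rewrite eq_complex /=; apply/andP; split; apply/eqP.
  by apply: eq_Rintegral => x _; rewrite pdotC; case: (pdot _ _).
rewrite -[RHS]mulN1r -RintegralZl//; last exact: (integrable_Im (L2_sqint u) (L2_sqint v)).
by apply: eq_Rintegral => x _; rewrite pdotC mulN1r; case: (pdot _ _).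
Qed.

Let dot_eq0 u : dot u u = 0 -> u = 0.
Proof.
rewrite L2_dotE fdot_sq => /(@complexI R) e.
have hu := L2_sqint u; have [uR uI ui] := hu.
have i0 : (\int[mu]_x `|(sqnorm (L2_fun u x))%:E| = 0)%E.
  under eq_integral => x _ do rewrite gee0_abs ?lee_fin ?sqnorm_ge0//.
  have fn : (\int[mu]_x (sqnorm (L2_fun u x))%:E)%E \is a fin_num.
    by apply: integrable_fin_num => //; exact: (integrable_sqnorm hu).
  by rewrite -(fineK fn); congr (_%:E).
have mf : measurable_fun setT (EFin \o (fun x => sqnorm (L2_fun u x))).
  by apply/measurable_EFinP; exact: measurable_sqnorm.
have /(_ i0) ae0 := (ae_eq_integral_abs mu measurableT mf).1.
rewrite -[u]L2_funK -L2_class0; apply: L2_class_eq => //; first exact: sqint0.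
move: ae0; apply: filterS => x /(_ I) /= [h]; exact: sqnorm_eq0.
Qed.

Lemma L2_prehilbert : prehilbert dot.
Proof.
split=> [||u|]; [exact: dotL|exact: dotC| |exact: dot_eq0].
by rewrite L2_dotE fdot_sq lecR Rintegral_ge0// => x _; exact: sqnorm_ge0.
Qed.

(** The limit is enclosed by the monotone sequences a k + 2 s / 2 ^ k and
   a k - 2 s / 2 ^ k, which yields the rate of convergence. *)
Lemma geometric_limit (s : R) (a : nat -> R) :
  (forall k, `|a k.+1 - a k| <= s / 2 ^+ k) ->
  exists L, a @ \oo --> L /\ forall k, `|a k - L| <= 2 * s / 2 ^+ k.
Proof.
move=> h.
have s0 : 0 <= s by have := h 0%N; rewrite expr0 divr1; apply: le_trans.
pose b k := a k + 2 * s / 2 ^+ k; pose c k := a k - 2 * s / 2 ^+ k.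
have step k : 2 * s / 2 ^+ k.+1 = s / 2 ^+ k.
  by rewrite exprS invfM mulrACA divff// mul1r.
have dbl k : 2 * s / 2 ^+ k = 2 * (s / 2 ^+ k) by rewrite mulrA.
have p0 k : 0 <= s / 2 ^+ k by rewrite divr_ge0// exprn_ge0.
have bd : nonincreasing_seq b.
  apply/nonincreasing_seqP => k; rewrite /b step dbl.
  by have := h k; rewrite ler_norml => /andP[_ ?]; lra.
have cd : nondecreasing_seq c.
  apply/nondecreasing_seqP => k; rewrite /c step dbl.
  by have := h k; rewrite ler_norml => /andP[? _]; lra.
have cb k : c k <= b k by rewrite /c /b dbl; have := p0 k; lra.
have blb : has_lbound (range b).
  exists (c 0%N) => _ [k _ <-]; apply: le_trans (cb k); exact: cd.
have bc := nonincreasing_is_cvgn bd blb.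
set L := limn b in bc.
have z : (fun k => 2 * s / 2 ^+ k) @ \oo --> (0 : R).
  rewrite (_ : (fun k => _) = geometric (2 * s) (2^-1)).
    by apply: cvg_geometric; rewrite ger0_norm ?invr_ge0// invf_lt1// ltr1n.
  by apply/funext => k /=; rewrite exprVn.
have aL : a @ \oo --> L.
  rewrite (_ : a = fun k => b k - 2 * s / 2 ^+ k); last first.
    by apply/funext => k; rewrite /b addrK.
  by rewrite -[L]subr0; apply: cvgB.
have cL : c @ \oo --> L by rewrite -[L]subr0; apply: cvgB.
exists L; split=> // k; rewrite ler_norml.
have h1 : L <= b k by apply: (nonincreasing_cvgn_ge bd bc).
have h2 : c k <= L.
  by have := nondecreasing_cvgn_le cd (cvgP L cL) k; rewrite (cvg_lim _ cL).
by move: h1 h2; rewrite /b /c => ? ?; apply/andP; split; lra.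
Qed.

Lemma sqnorm_comp (a : 'cV[C]_M) j : Re (a j 0) ^+ 2 + Im (a j 0) ^+ 2 <= sqnorm a.
Proof.
rewrite /sqnorm (bigD1 j)//= lerDl; apply: sumr_ge0 => k _.
by rewrite addr_ge0 ?sqr_ge0.
Qed.

Lemma measurable_Re_sub f g j :
  measurable_fun setT (fun x => Re (f x j 0)) ->
  measurable_fun setT (fun x => Re (g x j 0)) ->
  measurable_fun setT (fun x => Re ((f x - g x) j 0)).
Proof.
move=> mf mg; rewrite (_ : (fun _ => _) = fun x => Re (f x j 0) - Re (g x j 0)).
  exact: measurable_funB.
by apply/funext => x; rewrite mxE [(- g x) _ _]mxE raddfB.
Qed.

Lemma measurable_Im_sub f g j :
  measurable_fun setT (fun x => Im (f x j 0)) ->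
  measurable_fun setT (fun x => Im (g x j 0)) ->
  measurable_fun setT (fun x => Im ((f x - g x) j 0)).
Proof.
move=> mf mg; rewrite (_ : (fun _ => _) = fun x => Im (f x j 0) - Im (g x j 0)).
  exact: measurable_funB.
by apply/funext => x; rewrite mxE [(- g x) _ _]mxE raddfB.
Qed.

(** Riesz-Fischer: along a subsequence whose consecutive distances are at most
   4^-k, the weighted sum h of the squared increments is integrable, and it
   dominates the squared distance to the limit, uniformly in the point. *)
Lemma fast_cauchy (g : nat -> fT) : (forall k, sqint_prop (g k)) ->
  (forall k, (\int[mu]_x (sqnorm (g k.+1 x - g k x))%:E <= ((16 ^+ k)^-1)%:E)%E) ->
  exists f, exists2 K : R, sqint_prop f &
    forall k, (\int[mu]_x (sqnorm (g k x - f x))%:E <= (K / 4 ^+ k)%:E)%E.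
Proof.
move=> gs gd.
pose D k x : R := 4 ^+ k * sqnorm (g k.+1 x - g k x).
have D0 k x : 0 <= D k x by rewrite mulr_ge0 ?exprn_ge0// sqnorm_ge0.
have mD k : measurable_fun setT (D k).
  apply: measurable_funM => //.
  by have [? ? _] := sqintB (gs k.+1) (gs k); exact: measurable_sqnorm.
pose h x : \bar R := (\sum_(k <oo) (D k x)%:E)%E.
have h0 x : (0 <= h x)%E by apply: nneseries_ge0 => k _ _; rewrite lee_fin.
have mh : measurable_fun setT h.
  apply: ge0_emeasurable_sum => [k x _ _|k _] /=; first by rewrite lee_fin.
  by apply/measurable_EFinP; exact: mD.
have Dh k x : ((D k x)%:E <= h x)%E.
  rewrite /h; apply: le_trans (nneseries_lim_ge k.+1 _) => [|i _ _]; last by rewrite lee_fin.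
  rewrite big_nat_recr//= leeDr//; apply: sume_ge0 => i _; by rewrite lee_fin.
have ih : (\int[mu]_x h x <= 2%:E)%E.
  rewrite integral_nneseries; [|exact: measurableT
    |by move=> k; apply/measurable_EFinP; exact: mD|by move=> k x _; rewrite lee_fin].
  apply: lime_le; first by apply: is_cvg_nneseries => k _ _; apply: integral_ge0 => x _; rewrite lee_fin.
  apply: nearW => n.
  apply: (@le_trans _ _ (\sum_(0 <= k < n) ((4 ^+ k)^-1)%:E)%E).
    apply: lee_sum => k _; rewrite /D; under eq_integral => x _ do rewrite EFinM.
    rewrite ge0_integralZl_EFin; [|exact: measurableT
      |by move=> x _; rewrite lee_fin sqnorm_ge0| |by rewrite exprn_ge0]; last first.
      apply/measurable_EFinP.
      by have [? ? _] := sqintB (gs k.+1) (gs k); exact: measurable_sqnorm.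
    apply: le_trans (lee_wpmul2l _ (gd k)) _; first by rewrite lee_fin exprn_ge0.
    rewrite -EFinM lee_fin (_ : 16 = 4 * 4 :> R) ?exprMn; last by ring.
    by rewrite invfM mulrA divff ?mul1r// expf_neq0.
  rewrite sumEFin lee_fin.
  suff : \sum_(0 <= k < n) (4 ^+ k)^-1 <= 2 - 2 * (4 ^+ n)^-1 :> R.
    move=> hs; apply: le_trans hs _; by rewrite gerBl mulr_ge0// invr_ge0 exprn_ge0.
  elim: n => [|n IH]; first by rewrite big_geq// expr0 invr1; lra.
  rewrite big_nat_recr//=; have : 0 < (4 ^+ n)^-1 :> R by rewrite invr_gt0 exprn_gt0.
  rewrite exprS invfM; move: IH; set S := \sum_(_ <= _ < _) _; lra.
(* the limit exists at the points where h is finite; elsewhere it is replaced by 0,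
   which keeps it measurable, and the bound by h is trivial *)
pose p x : bool := h x \is a fin_num.
have mp : measurable_fun setT p.
  apply: (measurable_fun_bool true) => //; rewrite preimage_true.
  exact: emeasurable_fin_num.
pose s x := Num.sqrt (fine (h x)).
have incr k x : p x -> sqnorm (g k.+1 x - g k x) <= (s x / 2 ^+ k) ^+ 2.
  move=> px; have := Dh k x; rewrite -(fineK px) lee_fin /D.
  rewrite expr_div_n /s sqr_sqrtr ?fine_ge0// -exprM mulnC exprM.
  rewrite (_ : 2 ^+ 2 = 4 :> R); last by ring.
  by rewrite ler_pdivlMr ?exprn_gt0// mulrC.
have s0 x : 0 <= s x by exact: sqrtr_ge0.
have comp (a b : R) : 0 <= b -> a ^+ 2 <= b ^+ 2 -> `|a| <= b.
  by move=> b0 ab; rewrite -(@ler_pXn2r _ 2) ?nnegrE// real_normK ?num_real.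
have lim (P : C -> R) : (forall x y, P (x - y) = P x - P y) ->
    (forall z, P z ^+ 2 <= Re z ^+ 2 + Im z ^+ 2) ->
    (forall k j, measurable_fun setT (fun x => P (g k x j 0))) ->
    exists F : torus R N -> 'I_M -> R,
      (forall j, measurable_fun setT (F ^~ j)) /\
      forall k x j, p x -> `|P (g k x j 0) - F x j| <= 2 * s x / 2 ^+ k.
  move=> PB Psq Pm.
  have /choice[F hF] (xj : torus R N * 'I_M) : exists L : R,
      (fun k => if p xj.1 then P (g k xj.1 xj.2 0) else 0) @ \oo --> L /\
      (p xj.1 -> forall k, `|P (g k xj.1 xj.2 0) - L| <= 2 * s xj.1 / 2 ^+ k).
    case: xj => x j /=; case: (boolP (p x)) => px; last first.
      by exists 0; split=> //; exact: cvg_cst.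
    have [|L [hL1 hL2]] := @geometric_limit (s x) (fun k => P (g k x j 0)).
      move=> k; apply: comp; first by rewrite divr_ge0// exprn_ge0.
      rewrite -PB; apply: le_trans (incr k x px); apply: le_trans (Psq _) _.
      have := sqnorm_comp (g k.+1 x - g k x) j.
      by rewrite [(g k.+1 x - g k x) j 0]mxE [(- g k x) j 0]mxE.
    by exists L.
  exists (fun x j => F (x, j)); split; last first.
    by move=> k x j px; have [_ /(_ px)] := hF (x, j); exact.
  move=> j; apply: (measurable_fun_cvg (h := fun k x => if p x then P (g k x j 0) else 0)).
    by move=> k; apply: measurable_fun_ifT.
  by move=> x _; have [] := hF (x, j).
have [|z|k j|FR [mFR hFR]] := lim (@Re R).
- by move=> x y; rewrite raddfB.
- by rewrite lerDl sqr_ge0.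
- by have [] := gs k.
have [|z|k j|FI [mFI hFI]] := lim (@Im R).
- by move=> x y; rewrite raddfB.
- by rewrite lerDr sqr_ge0.
- by have [] := gs k.
pose f x : 'cV[C]_M := \col_j Complex (FR x j) (FI x j).
have fR j : measurable_fun setT (fun x => Re (f x j 0)).
  by under eq_fun do rewrite mxE /=; exact: mFR.
have fI j : measurable_fun setT (fun x => Im (f x j 0)).
  by under eq_fun do rewrite mxE /=; exact: mFI.
pose c : R := 8 * M%:R + 1.
have c0 : 0 < c by rewrite ltr_wpDl// mulr_ge0.
have bound k x : ((sqnorm (g k x - f x))%:E <= (c / 4 ^+ k)%:E * h x)%E.
  case: (boolP (p x)) => px; last first.
    have -> : h x = +oo%E by apply/eqP; move: px; rewrite /p ge0_fin_numE// -leNgt leye_eq.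
    by rewrite gt0_muley ?leey// lte_fin divr_gt0 ?exprn_gt0.
  rewrite -(fineK px) -EFinM lee_fin.
  apply: (@le_trans _ _ (\sum_(j < M) 2 * (2 * s x / 2 ^+ k) ^+ 2)).
    apply: ler_sum => j _; rewrite mxE [(- f x) j 0]mxE !raddfB /= [f x j 0]mxE /=.
    have e0 : 0 <= 2 * s x / 2 ^+ k by rewrite divr_ge0 ?mulr_ge0 ?exprn_ge0.
    rewrite mulr_natl mulr2n; apply: lerD.
      by rewrite -real_normK ?num_real// ler_pXn2r ?nnegrE// hFR.
    by rewrite -real_normK ?num_real// ler_pXn2r ?nnegrE// hFI.
  rewrite sumr_const card_ord expr_div_n exprMn /s sqr_sqrtr ?fine_ge0// -exprM mulnC exprM.
  rewrite (_ : 2 ^+ 2 = 4 :> R); last by ring.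
  have -> : (2 * (4 * fine (h x) / 4 ^+ k)) *+ M = 8 * M%:R * (fine (h x) / 4 ^+ k).
    by rewrite -mulr_natr; ring.
  rewrite [leRHS]mulrAC -[leRHS]mulrA; apply: ler_wpM2r; last by rewrite /c lerDl.
  by rewrite divr_ge0 ?fine_ge0 ?exprn_ge0.
have K0 : (0 <= 2 * c) by rewrite mulr_ge0// ltW.
have gf k : (\int[mu]_x (sqnorm (g k x - f x))%:E <= (2 * c / 4 ^+ k)%:E)%E.
  apply: (@le_trans _ _ (\int[mu]_x ((c / 4 ^+ k)%:E * h x))%E).
    apply: ge0_le_integral => //.
    - by move=> x _; rewrite lee_fin sqnorm_ge0.
    - apply/measurable_EFinP; apply: measurable_sqnorm => j.
        by apply: measurable_Re_sub => //; have [] := gs k.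
      by apply: measurable_Im_sub => //; have [] := gs k.
    - by apply: emeasurable_funM; [exact: measurable_cst|exact: mh].
  have ck : 0 <= c / 4 ^+ k by rewrite divr_ge0 ?exprn_ge0// ltW.
  rewrite ge0_integralZl_EFin//.
  apply: le_trans (lee_wpmul2l _ ih) _; first by rewrite lee_fin.
  by rewrite -EFinM lee_fin mulrC mulrA.
have dP : sqint_prop (fun x => g 0%N x - f x).
  split=> [j|j|].
  - by apply: measurable_Re_sub => //; have [] := gs 0%N.
  - by apply: measurable_Im_sub => //; have [] := gs 0%N.
  - by apply: le_lt_trans (gf 0%N) _; rewrite ltry.
exists f, (2 * c) => //.
have := sqintB (gs 0%N) dP; congr sqint_prop.
by apply/funext => x; rewrite subKr.
Qed.

Lemma L2_complete (u : nat -> L2) :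
  (forall e, 0 < e -> exists n, forall m k, (n <= m)%N -> (n <= k)%N ->
     hnorm dot (u m - u k) <= e) ->
  exists v, forall e, 0 < e -> exists n, forall m, (n <= m)%N -> hnorm dot (u m - v) <= e.
Proof.
move=> uc; have q0 k : 0 < (4 ^+ k)^-1 :> R by rewrite invr_gt0 exprn_gt0.
have /choice[N0 hN0] k := uc _ (q0 k).
pose n k := (\sum_(i < k.+1) N0 i)%N.
have nN k : (N0 k <= n k)%N by rewrite /n big_ord_recr leq_addl.
have nS k : (N0 k <= n k.+1)%N.
  by apply: leq_trans (nN k) _; rewrite /n [X in (_ <= X)%N]big_ord_recr leq_addr.
pose g k := L2_fun (u (n k)).
have gs k : sqint_prop (g k) by exact: L2_sqint.
have gd k : (\int[mu]_x (sqnorm (g k.+1 x - g k x))%:E <= ((16 ^+ k)^-1)%:E)%E.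
  rewrite -L2_norm_class; last exact: sqintB.
  rewrite L2_classB// !L2_funK lee_fin (_ : 16 = 4 * 4 :> R); last by ring.
  rewrite exprMn invfM -expr2 ler_pXn2r//; last by rewrite nnegrE ltW.
    by apply: hN0; [exact: nS|exact: nN].
  by rewrite nnegrE hnorm_ge0.
have [f [K fs fK]] := fast_cauchy gs gd.
exists (cls f) => e e0.
have e2 : 0 < e / 2 by exact: divr_gt0.
have [k hk] : exists k, Num.max (4 ^+ k)^-1 (K / 4 ^+ k) <= Num.min (e / 2) ((e / 2) ^+ 2).
  have z (a b : R) : 0 < b -> exists k0, forall k, (k0 <= k)%N -> a / 4 ^+ k <= b.
    move=> b0; have : (fun k => a / 4 ^+ k) @ \oo --> (0 : R).
      rewrite (_ : (fun k => _) = geometric a (4^-1)).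
        by apply: cvg_geometric; rewrite ger0_norm ?invr_ge0// invf_lt1// ltr1n.
      by apply/funext => k /=; rewrite exprVn.
    move=> /cvgr0_norm_le/(_ _ b0)[k0 _ h]; exists k0 => k kk.
    exact: le_trans (ler_norm _) (h k kk).
  have b0 : 0 < Num.min (e / 2) ((e / 2) ^+ 2) by rewrite lt_min e2 exprn_gt0.
  have [k1 h1] := z 1 _ b0; have [k2 h2] := z K _ b0; exists (maxn k1 k2).
  by rewrite ge_max -[X in X <= _]mul1r h1 ?leq_maxl// h2 ?leq_maxr.
move: hk; rewrite ge_max !le_min => /andP[/andP[k1 _] /andP[_ k2]].
exists (n k) => m nm.
have -> : u m - cls f = (u m - u (n k)) + (u (n k) - cls f) by rewrite subrKA.
apply: le_trans (hnormD L2_prehilbert _ _) _; rewrite (splitr e); apply: lerD.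
  apply: le_trans k1; apply: hN0; last exact: nN.
  exact: leq_trans (nN k) nm.
rewrite -(@ler_pXn2r _ 2) ?nnegrE ?hnorm_ge0// ?(ltW e2)//; apply: le_trans k2.
have -> : u (n k) - cls f = cls (fun x => g k x - f x) by rewrite L2_classB// L2_funK.
by rewrite -lee_fin L2_norm_class; [exact: fK|exact: sqintB].
Qed.

Theorem L2_hilbert : hilbert dot.
Proof. by split; [exact: L2_prehilbert|exact: L2_complete]. Qed.
End L2_hilbert.
Arguments sqint0 {R N M}.

(** * The cells of mesh 1/m of the torus *)
Section cells.
Variable R : realType.

Definition ccell (m : nat) (z : circle R) : nat := Num.truncn (m%:R * val z).

Lemma ccell_itv m z : (ccell m z)%:R <= m%:R * val z < (ccell m z).+1%:R.
Proof. by apply: truncn_itv; rewrite mulr_ge0//; have /andP[] := valP z. Qed.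

Lemma ccell_def m z a : a%:R <= m%:R * val z < a.+1%:R -> ccell m z = a.
Proof. exact: truncn_def. Qed.

Lemma ccell_lt m z : (0 < m)%N -> (ccell m z < m)%N.
Proof.
move=> m0; rewrite -(ltr_nat R); have /andP[h _] := ccell_itv m z.
apply: le_lt_trans h _; have /andP[_ z1] := valP z.
by rewrite -[ltRHS]mulr1 ltr_pM2l// ltr0n.
Qed.

Lemma ccell_mul m r z : (0 < m)%N -> (0 < r)%N -> (ccell (m * r) z %/ r)%N = ccell m z.
Proof.
move=> m0 r0; symmetry; apply: ccell_def; have /andP[h1 h2] := ccell_itv (m * r) z.
set c := ccell _ z in h1 h2 *.
have rp : 0 < r%:R :> R by rewrite ltr0n.
have e : (m * r)%:R * val z = r%:R * (m%:R * val z) by rewrite natrM; ring.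
apply/andP; split.
  by rewrite -(ler_pM2l rp) -e; apply: le_trans h1; rewrite -natrM ler_nat mulnC leq_divM.
rewrite -(ltr_pM2l rp) -e; apply: lt_le_trans h2 _.
by rewrite -natrM ler_nat mulnC ltn_ceil.
Qed.

Lemma val_circle_shift (t : R) (z : circle R) : 0 <= val z + t < 1 -> val (circle_shift t z) = val z + t.
Proof.
move=> h; rewrite /circle_shift /=; have -> : Num.floor (val z + t) = 0.
  by apply/eqP; rewrite floor_eq add0r.
by rewrite subr0.
Qed.

Lemma ccell_shift m a b z : (0 < m)%N -> (b < m)%N -> ccell m z = a ->
  ccell m (circle_shift ((b%:R - a%:R) / m%:R) z) = b.
Proof.
move=> m0 bm za; have mp : 0 < m%:R :> R by rewrite ltr0n.
have := ccell_itv m z; rewrite za => /andP[h1 h2].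
have e : m%:R * (val z + (b%:R - a%:R) / m%:R) = m%:R * val z + b%:R - a%:R.
  by field; rewrite gt_eqF.
have b1 : b.+1%:R <= m%:R :> R by rewrite ler_nat.
have b0 : 0 <= b%:R :> R by [].
rewrite -!natr1 in h2 b1.
have v : val (circle_shift ((b%:R - a%:R) / m%:R) z) = val z + (b%:R - a%:R) / m%:R.
  apply: val_circle_shift; apply/andP; split.
    by rewrite -(pmulr_rge0 _ mp) e; lra.
  by rewrite -(ltr_pM2l mp) e mulr1; lra.
by apply: ccell_def; rewrite v e -natr1; apply/andP; split; lra.
Qed.

Lemma measurable_ccell m a : measurable [set z : circle R | ccell m z = a].
Proof.
rewrite (_ : [set z | _] = (fun z : circle R => m%:R * val z) @^-1` `[a%:R, a.+1%:R[).
  rewrite -[_ @^-1` _]setTI.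
  have mf : measurable_fun setT (fun z : circle R => m%:R * val z : measurableTypeR R).
    by apply: measurable_funM; [exact: measurable_cst|exact: measurable_val_circle].
  by apply: mf => //; exact: measurable_itv.
apply/seteqP; split => z /=; rewrite in_itv /=.
  by move=> <-; exact: ccell_itv.
exact: ccell_def.
Qed.

Variable N : nat.
Implicit Types (x y : torus R N) (c : {ffun 'I_N -> nat}).

(** The cell of mesh 1 / m that contains x, encoded by the numerators of its
   lower corner. *)
Definition cell (m : nat) x : {ffun 'I_N -> nat} := [ffun i => ccell m (tnth x i)].

Lemma cell_lt m x i : (0 < m)%N -> (cell m x i < m)%N.
Proof. by move=> m0; rewrite ffunE ccell_lt. Qed.

Lemma cell_mul m r x : (0 < m)%N -> (0 < r)%N ->
  [ffun i => cell (m * r) x i %/ r]%N = cell m x.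
Proof. by move=> m0 r0; apply/ffunP => i; rewrite !ffunE ccell_mul. Qed.

Lemma measurable_cell m c : measurable [set x | cell m x = c].
Proof.
rewrite (_ : [set x | _] = \bigcap_(i in [set: 'I_N])
    ((fun x : torus R N => tnth x i) @^-1` [set z | ccell m z = c i])).
  apply: fin_bigcap_measurable => // i _; rewrite -[_ @^-1` _]setTI.
  by apply: (measurable_tnth i) => //; exact: measurable_ccell.
apply/seteqP; split => x /=; first by move=> <- i _ /=; rewrite ffunE.
by move=> h; apply/ffunP => i; rewrite ffunE; exact: h.
Qed.

Definition disp (m : nat) (a b : {ffun 'I_N -> nat}) (i : 'I_N) : R :=
  ((b i)%:R - (a i)%:R) / m%:R.

Lemma cell_shift m a (b : {ffun 'I_N -> nat}) x : (0 < m)%N -> (forall i, b i < m)%N -> cell m x = a ->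
  cell m (vshift (disp m a b) x) = b.
Proof.
move=> m0 bm /ffunP xa; apply/ffunP => i; rewrite ffunE tnth_mktuple.
by apply: ccell_shift => //; have := xa i; rewrite ffunE.
Qed.

Definition cells (m : nat) : seq {ffun 'I_N -> nat} :=
  [seq [ffun j => f j : nat] | f : {ffun 'I_N -> 'I_m}].

Lemma size_cells m : size (cells m) = (m ^ N)%N.
Proof. by rewrite size_map -cardE card_ffun !card_ord. Qed.

Lemma uniq_cells m : uniq (cells m).
Proof.
rewrite map_inj_uniq ?enum_uniq// => f g /ffunP fg; apply/ffunP => i.
by have := fg i; rewrite !ffunE => /val_inj.
Qed.

Lemma mem_cells m c : (c \in cells m) = [forall i, c i < m]%N.
Proof.
apply/mapP/forallP => [[f _ ->] i|h]; first by rewrite ffunE.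
exists [ffun i => Ordinal (h i)]; first by rewrite mem_enum.
by apply/ffunP => i; rewrite !ffunE.
Qed.

Lemma cell_in m x : (0 < m)%N -> cell m x \in cells m.
Proof. by move=> m0; rewrite mem_cells; apply/forallP => i; exact: cell_lt. Qed.

Definition corner (m : nat) c : torus R N := [tuple to_circle ((c i)%:R / m%:R) | i < N].

Lemma cell_corner m c : c \in cells m -> cell m (corner m c) = c.
Proof.
rewrite mem_cells => /forallP cm; apply/ffunP => i; rewrite ffunE tnth_mktuple.
have mp : 0 < m%:R :> R by rewrite ltr0n; exact: leq_ltn_trans (cm i).
apply: ccell_def; rewrite /=; have -> : Num.floor ((c i)%:R / m%:R : R) = 0.
  apply/eqP; rewrite floor_eq add0r divr_ge0//= ltr_pdivrMr// mul1r ltr_nat.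
  exact: cm.
by rewrite subr0 mulrC divfK ?gt_eqF// lexx ltr_nat /=.
Qed.

(** ** Enumerations of cells that are compatible with refinement *)
Variable M : nat.
(** A cell together with a component of the vector values. *)
Definition idx := ({ffun 'I_N -> nat} * nat)%type.

Definition atoms (m : nat) : seq idx := [seq (c, i) | c <- cells m, i <- iota 0 M].

Lemma mem_atoms m (x : idx) : (x \in atoms m) = (x.1 \in cells m) && (x.2 < M)%N.
Proof.
apply/allpairsP/andP => [[[c i] /= [cm iM ->]]|[h1 h2]] /=.
  by move: iM; rewrite mem_iota.
by exists x; split=> //; [rewrite mem_iota|case: x {h1 h2}].
Qed.

Lemma uniq_atoms m : uniq (atoms m).
Proof.
apply: allpairs_uniq; [exact: uniq_cells|exact: iota_uniq|].
by move=> [? ?] [? ?] _ _ [-> ->].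
Qed.

Lemma size_atoms m : size (atoms m) = (m ^ N * M)%N.
Proof. by rewrite size_allpairs size_cells size_iota. Qed.

Definition nth_cell m k : {ffun 'I_N -> nat} := nth [ffun=> 0%N] (cells m) k.

Lemma nth_cell_in m k : (k < m ^ N)%N -> nth_cell m k \in cells m.
Proof. by move=> km; rewrite mem_nth ?size_cells. Qed.

Lemma nth_cell_inj m k l : (k < m ^ N)%N -> (l < m ^ N)%N ->
  nth_cell m k = nth_cell m l -> k = l.
Proof.
move=> km lm /eqP; rewrite /nth_cell nth_uniq ?size_cells ?uniq_cells//.
by move/eqP.
Qed.

Variable m : nat -> nat.
Hypothesis m_gt0 : forall l, (0 < m l)%N.
Hypothesis m_dvd : forall l, (m l %| m l.+1)%N.
Hypothesis M_gt0 : (0 < M)%N.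

Definition ratio l := (m l.+1 %/ m l)%N.

Lemma m_ratio l : m l.+1 = (m l * ratio l)%N.
Proof. by rewrite mulnC divnK. Qed.

Lemma ratio_gt0 l : (0 < ratio l)%N.
Proof. by rewrite divn_gt0// dvdn_leq. Qed.

Definition refine_cell r (c c' : {ffun 'I_N -> nat}) : {ffun 'I_N -> nat} :=
  [ffun j => c j * r + c' j]%N.

(** An enumeration of all pairs of a cell and a component at each level, such
   that the pairs that refine the pair number p of a level have the numbers
   p * r ^ N + k at the next, as matrix units of a chain require. *)
Fixpoint atom l (p : nat) : idx :=
  if l is l'.+1 then
    let x := atom l' (p %/ ratio l' ^ N) in
    (refine_cell (ratio l') x.1 (nth_cell (ratio l') (p %% ratio l' ^ N)), x.2)
  else (nth_cell (m 0) (p %/ M), (p %% M)%N).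

Definition natoms l := (m l ^ N * M)%N.

Lemma natomsS l : natoms l.+1 = (natoms l * ratio l ^ N)%N.
Proof. by rewrite /natoms m_ratio expnMn mulnAC. Qed.

Lemma natoms_gt0 l : (0 < natoms l)%N.
Proof. by rewrite muln_gt0 expn_gt0 m_gt0 M_gt0. Qed.

Lemma natoms_ratio l : (natoms l.+1 %/ natoms l = ratio l ^ N)%N.
Proof. by rewrite natomsS mulKn// natoms_gt0. Qed.

Lemma refine_cell_in a r c c' : c \in cells a -> c' \in cells r ->
  refine_cell r c c' \in cells (a * r).
Proof.
rewrite !mem_cells => /forallP ca /forallP cr; apply/forallP => j; rewrite ffunE.
apply: (@leq_trans ((c j).+1 * r)); first by rewrite mulSn addnC ltn_add2r.
by rewrite leq_mul2r (ca j) orbT.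
Qed.

Lemma refine_cell_inj r c1 c2 c1' c2' : c1' \in cells r -> c2' \in cells r ->
  refine_cell r c1 c1' = refine_cell r c2 c2' -> c1 = c2 /\ c1' = c2'.
Proof.
rewrite !mem_cells => /forallP h1 /forallP h2 /ffunP e.
have q j : (c1 j = c2 j /\ c1' j = c2' j)%N.
  have := e j; rewrite !ffunE => ej; have r0 : (0 < r)%N by exact: leq_ltn_trans (h1 j).
  have := congr1 (divn^~ r) ej; rewrite !divnMDl// !divn_small// !addn0 => cc.
  by move: ej; rewrite cc => /addnI.
by split; apply/ffunP => j; have [] := q j.
Qed.

Lemma atom_in l p : (p < natoms l)%N -> atom l p \in atoms (m l).
Proof.
rewrite mem_atoms; elim: l p => [|l IH] p pl /=.
  by rewrite ltn_pmod// andbT nth_cell_in// ltn_divLR.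
have r0 : (0 < ratio l ^ N)%N by rewrite expn_gt0 ratio_gt0.
have /andP[h1 h2] : ((atom l (p %/ ratio l ^ N)).1 \in cells (m l)) &&
    ((atom l (p %/ ratio l ^ N)).2 < M)%N.
  by apply: IH; rewrite ltn_divLR// -natomsS.
by rewrite h2 andbT m_ratio refine_cell_in// nth_cell_in// ltn_pmod.
Qed.

Lemma atom_inj l p q : (p < natoms l)%N -> (q < natoms l)%N ->
  atom l p = atom l q -> p = q.
Proof.
elim: l p q => [|l IH] p q pl ql /=.
  move=> [e1 e2]; rewrite (divn_eq p M) (divn_eq q M) e2; congr (_ * _ + _)%N.
  by apply: nth_cell_inj e1; rewrite ltn_divLR.
have r0 : (0 < ratio l ^ N)%N by rewrite expn_gt0 ratio_gt0.
move=> [e12 e2]; have nin s := nth_cell_in (ltn_pmod s r0).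
have [e1 e3] := refine_cell_inj (nin _) (nin _) e12.
rewrite (divn_eq p (ratio l ^ N)) (divn_eq q (ratio l ^ N)).
rewrite (nth_cell_inj _ _ e3) ?ltn_pmod//; congr (_ * _ + _)%N.
apply: IH; rewrite ?ltn_divLR -?natomsS//.
by rewrite [LHS]surjective_pairing e1 e2 -surjective_pairing.
Qed.

(** An injective enumeration of the right length exhausts the pairs. *)
Lemma perm_atom l : perm_eq [seq atom l p | p <- iota 0 (natoms l)] (atoms (m l)).
Proof.
have u : uniq [seq atom l p | p <- iota 0 (natoms l)].
  rewrite map_inj_in_uniq ?iota_uniq// => p q; rewrite !mem_iota /= => pl ql.
  exact: atom_inj.
have s : {subset [seq atom l p | p <- iota 0 (natoms l)] <= atoms (m l)}.
  by move=> _ /mapP[p + ->]; rewrite mem_iota /= => pl; exact: atom_in.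
have [|_ e] := uniq_min_size u s; first by rewrite size_map size_iota size_atoms.
by apply: uniq_perm => //; exact: uniq_atoms.
Qed.

Lemma sum_atoms (U : nmodType) (F : idx -> U) l :
  \sum_(p < natoms l) F (atom l p) = \sum_(c <- cells (m l)) \sum_(i < M) F (c, i : nat).
Proof.
transitivity (\sum_(x <- atoms (m l)) F x).
  rewrite -(perm_big _ (perm_atom l)) big_map -[natoms l in RHS]subn0.
  by rewrite -/(index_iota 0 (natoms l)) big_mkord.
rewrite big_allpairs; apply: eq_bigr => c _.
by rewrite -[M in LHS]subn0 -/(index_iota 0 M) big_mkord.
Qed.

Lemma atom_refine l p k : (k < ratio l ^ N)%N ->
  atom l.+1 (p * ratio l ^ N + k) =
  (refine_cell (ratio l) (atom l p).1 (nth_cell (ratio l) k), (atom l p).2).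
Proof.
move=> kr /=; have r0 : (0 < ratio l ^ N)%N by rewrite expn_gt0 ratio_gt0.
by rewrite divnMDl// divn_small// addn0 modnMDl modn_small.
Qed.

Lemma sum_nth_cell (U : nmodType) (F : {ffun 'I_N -> nat} -> U) r :
  \sum_(k < r ^ N) F (nth_cell r k) = \sum_(c <- cells r) F c.
Proof. by rewrite (big_nth [ffun=> 0%N]) big_mkord size_cells. Qed.
End cells.

(** * Matrix units on L2 *)
Section partial_shifts.
Variables (R : realType) (N M : nat).
Local Notation C := R[i].
Local Notation mu := (torus_measure R N).
Local Notation fT := (torus R N -> 'cV[C]_M).
Local Notation L2 := (L2 R N M).
Local Notation dot := (@L2_dot R N M).
Local Notation cls := (@L2_class R N M).
Implicit Types (f g : fT) (u v : L2) (h : 'I_N -> R).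

Lemma ge0_integral_vshift h (G : torus R N -> \bar R) : measurable_fun setT G ->
  (forall x, 0 <= G x)%E -> (\int[mu]_x G (vshift h x) = \int[mu]_x G x)%E.
Proof.
move=> mG G0.
have := @ge0_integral_pushforward _ _ _ _ R _ (@measurable_vshift R N h) mu setT G
  measurableT mG (fun x _ => G0 x).
rewrite preimage_setT => <-; apply: eq_measure_integral; first exact: measurable_vshift.
by move=> *; exact: torus_measure_vshift.
Qed.

Lemma Rintegral_vshift h (G : torus R N -> R) : measurable_fun setT G ->
  \int[mu]_x G (vshift h x) = \int[mu]_x G x.
Proof.
move=> mG; rewrite /Rintegral; congr fine.
rewrite integralE [RHS]integralE; congr (_ - _)%E.
  rewrite -[RHS](ge0_integral_vshift h)//; first by apply: eq_integral => x _; rewrite !funeposE.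
  by apply: measurable_funepos; exact/measurable_EFinP.
rewrite -[RHS](ge0_integral_vshift h)//; first by apply: eq_integral => x _; rewrite !funenegE.
by apply: measurable_funeneg; exact/measurable_EFinP.
Qed.

Lemma ae_vshift h (P : torus R N -> Prop) :
  {ae mu, forall x, P x} -> {ae mu, forall x, P (vshift h x)}.
Proof.
move=> [A [mA A0 PA]]; exists (vshift h @^-1` A); split.
- by rewrite -[_ @^-1` _]setTI; exact: (measurable_vshift _ measurableT mA).
- by rewrite torus_measure_vshift.
- by move=> x /= nP; apply: PA.
Qed.

Lemma sqint_vshift h f : sqint_prop f -> sqint_prop (f \o vshift h).
Proof.
move=> [fR fI fi]; split=> [j|j|].
- by apply: (measurableT_comp (fR j)); exact: measurable_vshift.
- by apply: (measurableT_comp (fI j)); exact: measurable_vshift.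
rewrite (ge0_integral_vshift h (G := fun x => (sqnorm (f x))%:E))//.
  by apply/measurable_EFinP; exact: measurable_sqnorm.
by move=> x; rewrite lee_fin sqnorm_ge0.
Qed.

Lemma sqint_if (p : torus R N -> bool) f : measurable_fun setT p -> sqint_prop f ->
  sqint_prop (fun t => if p t then f t else 0).
Proof.
move=> mp [fR fI fi]; split=> [j|j|].
- rewrite (_ : (fun t => _) = fun t => if p t then Re (f t j 0) else 0).
    by apply: measurable_fun_ifT.
  by apply/funext => t; case: ifP => // _; rewrite mxE.
- rewrite (_ : (fun t => _) = fun t => if p t then Im (f t j 0) else 0).
    by apply: measurable_fun_ifT.
  by apply/funext => t; case: ifP => // _; rewrite mxE.
apply: le_lt_trans fi; apply: ge0_le_integral => //.
- by move=> x _; rewrite lee_fin sqnorm_ge0.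
- apply/measurable_EFinP.
  rewrite (_ : (fun t => _) = fun t => if p t then sqnorm (f t) else 0).
    by apply: measurable_fun_ifT => //; exact: measurable_sqnorm.
  apply/funext => t; case: ifP => // _; rewrite /sqnorm big1// => j _.
  by rewrite !mxE expr0n addr0.
- by apply/measurable_EFinP; exact: measurable_sqnorm.
move=> x _; rewrite lee_fin; case: ifP => // _.
rewrite [leLHS](_ : _ = 0) ?sqnorm_ge0// /sqnorm big1// => j _.
by rewrite !mxE expr0n addr0.
Qed.

(** Indices in [nat] fit the enumerations of cells and components; a unit with an
   index out of range is zero. *)
Definition munit (i j : nat) : 'M[C]_M :=
  \matrix_(k, l) ((k == i :> nat) && (l == j :> nat))%:R.

Definition coord (j : nat) (v : 'cV[C]_M) : C := \sum_(l < M | l == j :> nat) v l 0.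

Lemma munit_mulE i j (v : 'cV[C]_M) k : (munit i j *m v) k 0 = if k == i :> nat then coord j v else 0.
Proof.
rewrite mxE /coord; case: ifP => ki.
  rewrite [RHS]big_mkcond; apply: eq_bigr => l _; rewrite mxE ki /=.
  by case: ifP; rewrite ?mul1r ?mul0r.
by rewrite big1// => l _; rewrite mxE ki mul0r.
Qed.

Lemma coordE (j : 'I_M) (v : 'cV[C]_M) : coord j v = v j 0.
Proof. by rewrite /coord (big_pred1 j). Qed.

Lemma coord_out j (v : 'cV[C]_M) : (M <= j)%N -> coord j v = 0.
Proof.
by move=> Mj; rewrite /coord big1// => l /eqP lj; move: (ltn_ord l); rewrite lj ltnNge Mj.
Qed.

Lemma munitM i j k l : (j < M)%N -> munit i j *m munit k l = (j == k)%:R *: munit i l.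
Proof.
move=> jM; apply/matrixP => s t; rewrite !mxE (bigD1 (Ordinal jM))//= big1 ?addr0.
  rewrite !mxE /= eqxx andbT; do 3 case: eqP => //=;
    by rewrite ?mulr1 ?mulr0 ?mul0r.
move=> r rj; rewrite !mxE (_ : (r == j :> nat) = false) ?andbF ?mul0r//.
by apply: contra_neqF rj => /eqP e; exact: val_inj.
Qed.

Lemma sqnorm_munit i j (v : 'cV[C]_M) : sqnorm (munit i j *m v) <= sqnorm v.
Proof.
have [jM|Mj] := ltnP j M; last first.
  rewrite [leLHS](_ : _ = 0) ?sqnorm_ge0// /sqnorm big1// => k _.
  by rewrite munit_mulE coord_out// if_same /= expr0n addr0.
have [iM|Mi] := ltnP i M; last first.
  rewrite [leLHS](_ : _ = 0) ?sqnorm_ge0// /sqnorm big1// => k _.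
  rewrite munit_mulE (_ : (k == i :> nat) = false) /= ?expr0n ?addr0//.
  by apply/eqP => ki; move: (ltn_ord k); rewrite ki ltnNge Mi.
rewrite {1}/sqnorm (bigD1 (Ordinal iM))//= big1 ?addr0.
  rewrite munit_mulE eqxx -[j]/(val (Ordinal jM)) coordE; exact: sqnorm_comp.
move=> k ki; rewrite munit_mulE (_ : (k == i :> nat) = false) /= ?expr0n ?addr0//.
by apply: contra_neqF ki => /eqP e; exact: val_inj.
Qed.

Lemma sqint_munit i j f : sqint_prop f -> sqint_prop (fun t => munit i j *m f t).
Proof.
move=> [fR fI fi].
have cR : measurable_fun setT (fun t => Re (coord j (f t))).
  rewrite (_ : (fun t => _) = fun t => \sum_(l < M) if l == j :> nat then Re (f t l 0) else 0).
    by apply: measurable_sum => l; case: (l == j :> nat) => //=; exact: measurable_cst.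
  by apply/funext => t; rewrite /coord raddf_sum big_mkcond.
have cI : measurable_fun setT (fun t => Im (coord j (f t))).
  rewrite (_ : (fun t => _) = fun t => \sum_(l < M) if l == j :> nat then Im (f t l 0) else 0).
    by apply: measurable_sum => l; case: (l == j :> nat) => //=; exact: measurable_cst.
  by apply/funext => t; rewrite /coord raddf_sum big_mkcond.
have mR k : measurable_fun setT (fun t => Re ((munit i j *m f t) k 0)).
  under eq_fun do rewrite munit_mulE.
  by case: (k == i :> nat) => //=; exact: measurable_cst.
have mI k : measurable_fun setT (fun t => Im ((munit i j *m f t) k 0)).
  under eq_fun do rewrite munit_mulE.
  by case: (k == i :> nat) => //=; exact: measurable_cst.
split=> //; apply: le_lt_trans fi; apply: ge0_le_integral => //.
- by move=> x _; rewrite lee_fin sqnorm_ge0.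
- by apply/measurable_EFinP; exact: measurable_sqnorm.
- by apply/measurable_EFinP; exact: measurable_sqnorm.
by move=> x _; rewrite lee_fin sqnorm_munit.
Qed.

Lemma measurable_cell_eq m c : measurable_fun setT (fun t : torus R N => cell m t == c).
Proof.
apply: (measurable_fun_bool true) => //; rewrite setTI preimage_true.
rewrite [X in measurable X](_ : _ = [set t | cell m t = c]); first exact: measurable_cell.
by apply/seteqP; split => t /= h; exact/eqP.
Qed.

Local Notation idx := (idx N).

(** The operator that moves the component y.2 on the cell y.1 to the component
   x.2 on the cell x.1. *)
Definition pshift_fun m (x y : idx) f : fT := fun t =>
  if cell m t == x.1 then munit x.2 y.2 *m f (vshift (disp R m x.1 y.1) t) else 0.

Definition pshift m x y u : L2 := cls (pshift_fun m x y (L2_fun u)).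

Lemma sqint_pshift m x y f : sqint_prop f -> sqint_prop (pshift_fun m x y f).
Proof.
move=> hf; apply: sqint_if; first exact: measurable_cell_eq.
apply: (@sqint_munit _ _ (f \o vshift (disp R m x.1 y.1))); exact: sqint_vshift.
Qed.

Lemma pshift_class m x y f : sqint_prop f -> pshift m x y (cls f) = cls (pshift_fun m x y f).
Proof.
move=> hf; apply: L2_class_eq; [apply: sqint_pshift; exact: L2_sqint|exact: sqint_pshift|].
have := ae_vshift (disp R m x.1 y.1) (L2_fun_class hf).
by apply: filterS => t; rewrite /pshift_fun => ->.
Qed.

Lemma pshift_lin m x y : linear (pshift m x y).
Proof.
move=> a u v; have hu := L2_sqint u; have hv := L2_sqint v.
rewrite -{1}[u]L2_funK -{1}[v]L2_funK -L2_class_lin//.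
rewrite pshift_class; last exact: sqint_lin.
rewrite /pshift -L2_class_lin; [|exact: sqint_pshift|exact: sqint_pshift].
congr cls; apply/funext => t; rewrite /pshift_fun; case: ifP => _.
  by rewrite mulmxDr -scalemxAr.
by rewrite scaler0 addr0.
Qed.

Lemma disp_add m (a b c : {ffun 'I_N -> nat}) t :
  vshift (disp R m b c) (vshift (disp R m a b) t) = vshift (disp R m a c) t.
Proof.
rewrite vshiftD; congr vshift; apply/funext => j; rewrite /disp -mulrDl; congr (_ / _).
ring.
Qed.

Lemma disp_id m (a : {ffun 'I_N -> nat}) t : vshift (disp R m a a) t = t.
Proof.
rewrite -[RHS](vshift_int (fun=> 0)); congr vshift.
by apply/funext => j; rewrite /disp subrr mul0r.
Qed.

(** A translation from cell to cell can be composed only at a common cell. *)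
Lemma pshift_mul m x y x' y' u : (0 < m)%N ->
  y \in atoms N M m -> x' \in atoms N M m ->
  pshift m x y (pshift m x' y' u) = (y == x')%:R *: pshift m x y' u.
Proof.
move=> m0; rewrite !mem_atoms => /andP[yc yM] /andP[xc xM].
have hu := L2_sqint u; rewrite {2}/pshift pshift_class; last exact: sqint_pshift.
have ycm : forall i, (y.1 i < m)%N by move: yc; rewrite mem_cells => /forallP.
have [<-|yx] := eqVneq y x'.
  rewrite scale1r; congr cls; apply/funext => t; rewrite /pshift_fun.
  case: eqP => // tx; rewrite (cell_shift _ ycm tx)// eqxx mulmxA munitM// eqxx scale1r.
  by rewrite disp_add.
rewrite scale0r -L2_class0; congr cls; apply/funext => t; rewrite /pshift_fun.
case: eqP => // tx; rewrite (cell_shift _ ycm tx)//; case: eqP => [y1|_]; last by rewrite mulmx0.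
rewrite mulmxA munitM// (_ : (y.2 == x'.2) = false) ?scale0r ?mul0mx//.
apply: contra_neqF yx => /eqP y2.
by rewrite [y]surjective_pairing y1 y2 -surjective_pairing.
Qed.

Lemma pdot_munit i j (a b : 'cV[C]_M) : pdot (munit i j *m a) b = pdot a (munit j i *m b).
Proof.
rewrite /pdot.
have [iM|Mi] := ltnP i M; last first.
  rewrite big1 => [|k _]; last first.
    rewrite munit_mulE (_ : (k == i :> nat) = false) ?mul0r//.
    by apply/eqP => ki; move: (ltn_ord k); rewrite ki ltnNge Mi.
  rewrite big1// => k _; rewrite munit_mulE coord_out// if_same rmorph0 mulr0//.
have [jM|Mj] := ltnP j M; last first.
  rewrite big1 => [|k _]; last by rewrite munit_mulE coord_out// if_same mul0r.
  rewrite big1// => k _; rewrite munit_mulE (_ : (k == j :> nat) = false) ?rmorph0 ?mulr0//.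
  by apply/eqP => kj; move: (ltn_ord k); rewrite kj ltnNge Mj.
rewrite (bigD1 (Ordinal iM))//= [X in _ + X]big1 ?addr0 => [|k ki]; last first.
  rewrite munit_mulE (_ : (k == i :> nat) = false) ?mul0r//.
  by apply: contra_neqF ki => /eqP e; exact: val_inj.
rewrite [RHS](bigD1 (Ordinal jM))//= [X in _ = _ + X]big1 ?addr0 => [|k kj]; last first.
  rewrite munit_mulE (_ : (k == j :> nat) = false) ?rmorph0 ?mulr0//.
  by apply: contra_neqF kj => /eqP e; exact: val_inj.
by rewrite !munit_mulE /= !eqxx (coordE (Ordinal jM) a) (coordE (Ordinal iM) b).
Qed.

(** Translations preserve the measure, and the adjoint of a matrix unit of C ^ M
   is its transpose. *)
Lemma pshift_adj m x y u v : (0 < m)%N -> x \in atoms N M m -> y \in atoms N M m ->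
  dot (pshift m x y u) v = dot u (pshift m y x v).
Proof.
move=> m0; rewrite !mem_atoms => /andP[xc xM] /andP[yc yM].
have xcm : forall i, (x.1 i < m)%N by move: xc; rewrite mem_cells => /forallP.
have ycm : forall i, (y.1 i < m)%N by move: yc; rewrite mem_cells => /forallP.
have hu := L2_sqint u; have hv := L2_sqint v.
rewrite -{1}[v]L2_funK -{2}[u]L2_funK /pshift.
rewrite !dot_class//; try exact: sqint_pshift.
set f := L2_fun u; set g := L2_fun v.
have e t : pdot (pshift_fun m x y f t) (g t) =
    pdot (f (vshift (disp R m x.1 y.1) t)) (pshift_fun m y x g (vshift (disp R m x.1 y.1) t)).
  rewrite /pshift_fun; case: eqP => tx.
    by rewrite (cell_shift _ ycm tx)// eqxx pdot_munit disp_add disp_id.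
  case: eqP => [ty|_].
    by case: tx; rewrite -(cell_shift m0 xcm ty) disp_add disp_id.
  rewrite /pdot !big1// => j _; first by rewrite mxE rmorph0 mulr0.
  by rewrite mxE mul0r.
rewrite /fdot; congr Complex.
  transitivity (\int[mu]_t (fun s => Re (pdot (f s) (pshift_fun m y x g s)))
      (vshift (disp R m x.1 y.1) t)); first by apply: eq_Rintegral => t _; rewrite e.
  apply: Rintegral_vshift; apply/measurable_EFinP.
  by apply: (measurable_int mu); apply: integrable_Re => //; exact: sqint_pshift.
transitivity (\int[mu]_t (fun s => Im (pdot (f s) (pshift_fun m y x g s)))
    (vshift (disp R m x.1 y.1) t)); first by apply: eq_Rintegral => t _; rewrite e.
apply: Rintegral_vshift; apply/measurable_EFinP.
by apply: (measurable_int mu); apply: integrable_Im => //; exact: sqint_pshift.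
Qed.
End partial_shifts.

Section atom_vectors.
Variables (R : realType) (N M : nat).
Local Notation C := R[i].
Local Notation mu := (torus_measure R N).
Local Notation fT := (torus R N -> 'cV[C]_M).
Local Notation L2 := (L2 R N M).
Local Notation dot := (@L2_dot R N M).
Local Notation cls := (@L2_class R N M).
Local Notation idx := (idx N).
Implicit Types (f g : fT) (u v : L2).

Lemma sqint_sum (I : Type) (r : seq I) (F : I -> fT) : (forall i, sqint_prop (F i)) ->
  sqint_prop (fun t => \sum_(i <- r) F i t).
Proof.
move=> hF; elim: r => [|i r IH].
  by under eq_fun do rewrite big_nil; exact: sqint0.
under eq_fun do rewrite big_cons -[F i _]scale1r.
exact: sqint_lin.
Qed.

Lemma L2_class_sum (I : Type) (r : seq I) (F : I -> fT) : (forall i, sqint_prop (F i)) ->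
  cls (fun t => \sum_(i <- r) F i t) = \sum_(i <- r) cls (F i).
Proof.
move=> hF; elim: r => [|i r IH].
  by under eq_fun do rewrite big_nil; rewrite big_nil; exact: L2_class0.
under eq_fun do rewrite big_cons -[F i _]scale1r.
by rewrite L2_class_lin ?scale1r ?big_cons ?IH//; exact: sqint_sum.
Qed.

Lemma sqint_cst (w : 'cV[C]_M) : sqint_prop ((fun=> w) : fT).
Proof.
split=> [j|j|]; [exact: measurable_cst|exact: measurable_cst|].
rewrite integral_cst//= (le_lt_trans _ (ltry (sqnorm w)))//.
by rewrite -[leRHS]mule1 lee_wpmul2l ?lee_fin ?sqnorm_ge0// probability_le1.
Qed.

Lemma L2_class_scale (a : C) f : sqint_prop f -> cls (fun t => a *: f t) = a *: cls f.
Proof.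
move=> hf; have := L2_class_lin a hf sqint0; rewrite L2_class0 addr0 => <-.
by congr cls; apply/funext => t; rewrite addr0.
Qed.

Lemma munit_sum : \sum_(i < M) munit R M i i = 1%:M.
Proof.
apply/matrixP => k l; rewrite summxE (bigD1 k)//= big1 ?addr0 => [|i ik].
  by rewrite !mxE eqxx /= eq_sym -val_eqE.
rewrite mxE (_ : (k == i :> nat) = false)//.
by rewrite eq_sym; apply/negbTE.
Qed.

Lemma sum_cell (U : nmodType) m (t : torus R N) (F : {ffun 'I_N -> nat} -> U) : (0 < m)%N ->
  \sum_(c <- cells N m) (if cell m t == c then F c else 0) = F (cell m t).
Proof.
move=> m0; rewrite -big_mkcond /= (big_rem (cell m t)) ?cell_in//= eqxx.
rewrite big_seq_cond big1 ?addr0// => c /andP[+ /eqP e].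
by rewrite -e mem_rem_uniqF ?uniq_cells.
Qed.

Lemma pshift_sum m u : (0 < m)%N ->
  \sum_(c <- cells N m) \sum_(i < M) pshift m (c, i : nat) (c, i : nat) u = u.
Proof.
move=> m0; have hu := L2_sqint u.
have e c : \sum_(i < M) pshift m (c, i : nat) (c, i : nat) u =
    cls (fun t => \sum_(i < M) pshift_fun m (c, i : nat) (c, i : nat) (L2_fun u) t).
  by rewrite L2_class_sum// => i; exact: sqint_pshift.
rewrite (eq_bigr _ (fun c _ => e c)) -L2_class_sum; last by move=> c; apply: sqint_sum => i; exact: sqint_pshift.
rewrite -[RHS]L2_funK; congr cls; apply/funext => t; rewrite /pshift_fun /=.
transitivity (\sum_(c <- cells N m) if cell m t == c then L2_fun u t else 0).
  apply: eq_bigr => c _; case: ifP => _; last by rewrite big1.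
  under eq_bigr => i _ do rewrite disp_id.
  by rewrite -mulmx_suml munit_sum mul1mx.
by rewrite (sum_cell t (fun=> L2_fun u t)).
Qed.

Lemma cell_refine m r (t : torus R N) c c' : (0 < m)%N -> (0 < r)%N -> c' \in cells N r ->
  (cell (m * r) t == refine_cell r c c') =
  (cell m t == c) && ([ffun i => cell (m * r) t i %% r]%N == c').
Proof.
move=> m0 r0; rewrite mem_cells => /forallP cr; rewrite -(cell_mul t m0 r0).
apply/eqP/andP => [->|[/eqP <- /eqP <-]].
  split; apply/eqP/ffunP => i; rewrite !ffunE.
    by rewrite divnMDl// divn_small ?addn0.
  by rewrite modnMDl modn_small.
by apply/ffunP => i; rewrite !ffunE -divn_eq.
Qed.

Lemma disp_refine m r (a b c : {ffun 'I_N -> nat}) : (0 < r)%N ->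
  disp R (m * r) (refine_cell r a c) (refine_cell r b c) = disp R m a b.
Proof.
move=> r0; apply/funext => j; rewrite /disp !ffunE !natrD !natrM.
have rp : r%:R != 0 :> R by rewrite pnatr_eq0 -lt0n.
rewrite opprD addrACA subrr addr0 -mulrBl.
have [->|m0] := eqVneq m 0%N; first by rewrite !mul0r invr0 !mulr0.
have mp : m%:R != 0 :> R by rewrite pnatr_eq0.
by field; rewrite mp rp.
Qed.

Lemma sum_refine (U : nmodType) m r (t : torus R N) c (w : U) : (0 < m)%N -> (0 < r)%N ->
  \sum_(c' <- cells N r) (if cell (m * r) t == refine_cell r c c' then w else 0) =
  if cell m t == c then w else 0.
Proof.
move=> m0 r0; set s := [ffun i => cell (m * r) t i %% r]%N.
have sr : s \in cells N r.
  by rewrite mem_cells; apply/forallP => i; rewrite ffunE ltn_pmod.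
rewrite (big_rem s)//= cell_refine// eqxx andbT.
rewrite big_seq big1 ?addr0// => c' c'r.
have [c'in c's] : c' \in cells N r /\ c' != s.
  split; first exact: mem_rem c'r.
  by apply: contraTneq c'r => ->; rewrite mem_rem_uniqF ?uniq_cells.
by rewrite cell_refine// eq_sym in c's *; rewrite -/s (negbTE c's) andbF.
Qed.

(** Translating a cell onto another translates the parts of a subdivision onto
   the corresponding parts. *)
Lemma pshift_refine m r (x y : idx) u : (0 < m)%N -> (0 < r)%N ->
  pshift m x y u = \sum_(c <- cells N r)
    pshift (m * r) (refine_cell r x.1 c, x.2) (refine_cell r y.1 c, y.2) u.
Proof.
move=> m0 r0; have hu := L2_sqint u.
rewrite -L2_class_sum; last by move=> c; exact: sqint_pshift.
congr cls; apply/funext => t; rewrite /pshift_fun /=.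
under eq_bigr => c _ do rewrite disp_refine//.
by rewrite sum_refine.
Qed.

(** The factor gives norm 1 to the sum of these vectors, hence to the constant
   function with this value, which is the sum of the atom vectors of any mesh. *)
Definition evec (i : nat) : 'cV[C]_M := \col_k (((Num.sqrt M%:R)^-1)%:C%C * (k == i :> nat)%:R).

Lemma munit_evec i j l : (j < M)%N -> munit R M i j *m evec l = (j == l)%:R *: evec i.
Proof.
move=> jM; apply/colP => k; rewrite munit_mulE (coordE (Ordinal jM)) !mxE /=.
by do 2 case: (_ == _); rewrite ?mulr1 ?mulr0 ?mul1r ?mul0r.
Qed.

Lemma evec_expand (w : 'cV[C]_M) :
  w = \sum_(i < M) ((Num.sqrt M%:R)%:C%C * w i 0) *: evec i.
Proof.
apply/colP => k; rewrite summxE (bigD1 k)//= big1 ?addr0 => [|i ik]; last first.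
  by rewrite !mxE (_ : (k == i :> nat) = false) ?mulr0// eq_sym; apply/negbTE.
have M0 : (0 < M)%N by exact: leq_ltn_trans (ltn_ord k).
rewrite !mxE eqxx mulr1 mulrAC -rmorphM divff ?mul1r//.
by rewrite sqrtr_eq0 -ltNge ltr0n.
Qed.

Lemma sqnorm_evec_sum : (0 < M)%N -> sqnorm (\sum_(i < M) evec i) = 1.
Proof.
move=> M0; rewrite /sqnorm.
rewrite (eq_bigr (fun=> M%:R^-1)) => [|k _].
  by rewrite sumr_const card_ord -[LHS]mulr_natr mulVf// pnatr_eq0 -lt0n.
rewrite summxE (bigD1 k)//= big1 ?addr0 => [|i ik]; last first.
  by rewrite !mxE (_ : (k == i :> nat) = false) ?mulr0// eq_sym; apply/negbTE.
by rewrite !mxE eqxx mulr1 /= expr0n addr0 exprVn sqr_sqrtr.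
Qed.

Definition atom_fun m (x : idx) : fT := fun t => if cell m t == x.1 then evec x.2 else 0.

Definition atom_vec m (x : idx) : L2 := cls (atom_fun m x).

Lemma sqint_atom m x : sqint_prop (atom_fun m x).
Proof. by apply: sqint_if; [exact: measurable_cell_eq|exact: sqint_cst]. Qed.

Lemma pshift_atom m x y z : (0 < m)%N -> y \in atoms N M m ->
  pshift m x y (atom_vec m z) = (y == z)%:R *: atom_vec m x.
Proof.
move=> m0; rewrite mem_atoms => /andP[yc yM].
have ycm : forall i, (y.1 i < m)%N by move: yc; rewrite mem_cells => /forallP.
rewrite pshift_class; last exact: sqint_atom.
rewrite -L2_class_scale; last exact: sqint_atom.
congr cls; apply/funext => t; rewrite /pshift_fun /atom_fun.
case: eqP => tx; last by rewrite scaler0.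
rewrite (cell_shift _ ycm tx)//.
have -> : (y == z) = (y.1 == z.1) && (y.2 == z.2) by case: (y) (z) => [? ?] [? ?].
by case: eqP => _ /=; rewrite ?munit_evec// ?mulmx0 ?scale0r.
Qed.

Lemma atom_vec_refine m r x : (0 < m)%N -> (0 < r)%N ->
  atom_vec m x = \sum_(c <- cells N r) atom_vec (m * r) (refine_cell r x.1 c, x.2).
Proof.
move=> m0 r0; rewrite -L2_class_sum; last by move=> c; exact: sqint_atom.
by congr cls; apply/funext => t; rewrite /atom_fun /= sum_refine.
Qed.

Lemma atom_vec_total m : (0 < m)%N ->
  \sum_(c <- cells N m) \sum_(i < M) atom_vec m (c, i : nat) = cls (fun=> \sum_(i < M) evec i).
Proof.
move=> m0; have e c : \sum_(i < M) atom_vec m (c, i : nat) =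
    cls (fun t => \sum_(i < M) atom_fun m (c, i : nat) t).
  by rewrite L2_class_sum// => i; exact: sqint_atom.
rewrite (eq_bigr _ (fun c _ => e c)) -L2_class_sum; last first.
  by move=> c; apply: sqint_sum => i; exact: sqint_atom.
congr cls; apply/funext => t; rewrite /atom_fun /=.
transitivity (\sum_(c <- cells N m) if cell m t == c then \sum_(i < M) evec i else 0).
  by apply: eq_bigr => c _; case: ifP => _ //; rewrite big1.
by rewrite (sum_cell t (fun=> \sum_(i < M) evec i)).
Qed.

(** Functions that are constant on the cells of one mesh are exactly the
   combinations of the vectors of this mesh. *)
Lemma L2_class_step m (F : {ffun 'I_N -> nat} -> 'cV[C]_M) : (0 < m)%N ->
  cls (fun t => F (cell m t)) = \sum_(c <- cells N m) \sum_(i < M)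
    ((Num.sqrt M%:R)%:C%C * F c i 0) *: atom_vec m (c, i : nat).
Proof.
move=> m0; have e c : \sum_(i < M) ((Num.sqrt M%:R)%:C%C * F c i 0) *: atom_vec m (c, i : nat) =
    cls (fun t => if cell m t == c then F c else 0).
  have h (i : 'I_M) : sqint_prop (fun t =>
      ((Num.sqrt M%:R)%:C%C * F c i 0) *: atom_fun m (c, i : nat) t).
    have := sqint_lin ((Num.sqrt M%:R)%:C%C * F c i 0) (sqint_atom m (c, i : nat)) sqint0.
    by under eq_fun do rewrite addr0.
  under eq_bigr => i _ do rewrite -(L2_class_scale _ (sqint_atom m (c, i : nat))).
  rewrite -L2_class_sum//; congr cls; apply/funext => t; rewrite /atom_fun /=.
  case: ifP => _; first by rewrite -evec_expand.
  by rewrite big1// => i _; rewrite scaler0.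
rewrite (eq_bigr _ (fun c _ => e c)) -L2_class_sum.
  by congr cls; apply/funext => t; rewrite sum_cell.
by move=> c; apply: sqint_if; [exact: measurable_cell_eq|exact: sqint_cst].
Qed.

(** ** Density of the step functions *)
Definition elementary (A : set (torus R N)) :=
  exists2 n, (0 < n)%N & forall s t, cell n s = cell n t -> A s -> A t.

Lemma elementary_common A B : elementary A -> elementary B -> exists2 n, (0 < n)%N &
  (forall s t, cell n s = cell n t -> A s -> A t) /\
  (forall s t, cell n s = cell n t -> B s -> B t).
Proof.
move=> [n n0 hA] [k k0 hB]; exists (n * k)%N; first by rewrite muln_gt0 n0.
split=> s t e; [apply: hA|apply: hB].
  by rewrite -(cell_mul s n0 k0) -(cell_mul t n0 k0) e.
by rewrite -(cell_mul s k0 n0) -(cell_mul t k0 n0) mulnC e.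
Qed.

Lemma elementaryC A : elementary A -> elementary (~` A).
Proof. by move=> [n n0 hA]; exists n => // s t e nA At; apply: nA; apply: hA At. Qed.

Lemma elementaryU A B : elementary A -> elementary B -> elementary (A `|` B).
Proof.
move=> /elementary_common/[apply] -[n n0 [hA hB]]; exists n => // s t e [As|Bs].
  by left; exact: hA As.
by right; exact: hB Bs.
Qed.

Lemma elementary_step A : elementary A -> exists2 n, (0 < n)%N &
  forall t, (t \in A) = (corner R n (cell n t) \in A).
Proof.
move=> [n n0 hA]; exists n => // t.
have e : cell n (corner R n (cell n t)) = cell n t by rewrite cell_corner// cell_in.
by apply/idP/idP; rewrite !inE; apply: hA.
Qed.

Lemma measurable_elementary A : elementary A -> measurable A.
Proof.
move=> [n n0 hA].
rewrite (_ : A = \bigcup_(c in [set` [seq c <- cells N n | corner R n c \in A]])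
  [set t | cell n t = c]).
  by apply: fin_bigcup_measurable => // c _; exact: measurable_cell.
apply/seteqP; split => [t At|t [c]] /=.
  exists (cell n t) => //=; rewrite mem_filter cell_in// andbT inE.
  by apply: hA At; rewrite cell_corner// cell_in.
rewrite mem_filter => /andP[+ cn] tc; rewrite inE; apply: hA.
by rewrite cell_corner.
Qed.

(** The sets that elementary sets approximate in measure form a sigma-algebra. *)
Definition approximable (A : set (torus R N)) := measurable A /\
  forall e : R, 0 < e -> exists S D, [/\ elementary S, measurable D, (mu D <= e%:E)%E &
    forall t, ~ D t -> (A t <-> S t)].

Lemma approximableC A : approximable A -> approximable (~` A).
Proof.
move=> [mA hA]; split; first exact: measurableC.
move=> e e0; have [S [D [eS mD De h]]] := hA e e0; exists (~` S), D.
by split=> //; [exact: elementaryC|move=> t /h /= ->].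
Qed.

Lemma approximable_elementary A : elementary A -> approximable A.
Proof.
move=> eA; split; first exact: measurable_elementary.
by move=> e e0; exists A, set0; rewrite measure0; split=> //; rewrite lee_fin ltW.
Qed.

Lemma elementary0 : elementary set0. Proof. by exists 1%N. Qed.

Lemma approximableU A B : approximable A -> approximable B -> approximable (A `|` B).
Proof.
move=> [mA hA] [mB hB]; split; first exact: measurableU.
move=> e e0; have e2 : 0 < e / 2 by exact: divr_gt0.
have [S [D [eS mD De h]]] := hA _ e2; have [S' [D' [eS' mD' De' h']]] := hB _ e2.
exists (S `|` S'), (D `|` D'); split.
- exact: elementaryU.
- exact: measurableU.
- apply: le_trans (measureU2 _ mD mD') _; rewrite (splitr e) EFinD.
  exact: leeD.
- by move=> t /= /not_orP[/h <- /h' <-].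
Qed.

(** By continuity of the finite measure from above, a finite union already
   exhausts the countable one up to a set of small measure. *)
Lemma approximable_bigcup (F : nat -> set (torus R N)) :
  (forall i, approximable (F i)) -> approximable (\bigcup_i F i).
Proof.
move=> hF; have mF : measurable (\bigcup_i F i).
  by apply: bigcupT_measurable => i; have [] := hF i.
split=> // e e0; have e2 : 0 < e / 2 by exact: divr_gt0.
pose G n := \big[setU/set0]_(i < n) F i.
have aG n : approximable (G n).
  rewrite /G; elim: n => [|n IH]; last by rewrite big_ord_recr; exact: approximableU.
  by rewrite big_ord0; apply/approximable_elementary/elementary0.
have GP n t : G n t <-> exists2 i, (i < n)%N & F i t.
  rewrite /G -bigcup_mkord; split; first by move=> [i /= ? ?]; exists i.
  by move=> [i ? ?]; exists i.
pose K n := (\bigcup_i F i) `\` G n.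
have mK n : measurable (K n) by apply: measurableD => //; have [] := aG n.
have K0 : mu \o K @ \oo --> (0 : \bar R).
  have -> : 0%E = mu (\bigcap_n K n).
    rewrite (_ : \bigcap_n K n = set0) ?measure0//; apply/seteqP; split => // t h.
    have [[i _ Fi] _] := h 0%N I; have [_] := h i.+1 I; apply.
    by apply/GP; exists i.
  apply: nonincreasing_cvg_mu => //.
  - by apply: le_lt_trans (probability_le1 _ (mK 0%N)) _; rewrite ltry.
  - exact: bigcapT_measurable.
  - move=> n k nk; apply/subsetPset => t [Ft nG]; split=> //; apply: contra_not nG.
    by move=> /GP[i ik Fi]; apply/GP; exists i => //; exact: leq_trans ik nk.
have [n hn] : exists n, (mu (K n) <= (e / 2)%:E)%E.
  apply: contrapT => h; have : ((e / 2)%:E <= (0 : \bar R))%E.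
    apply: (cvge_to_ge K0); apply: nearW => n; apply/ltW; rewrite ltNge; apply/negP => hn.
    by apply: h; exists n.
  by rewrite lee_fin leNgt e2.
have [_ /(_ _ e2)[S [D [eS mD De h]]]] := aG n.
exists S, (D `|` K n); split=> //.
- exact: measurableU.
- by apply: le_trans (measureU2 _ mD (mK n)) _; rewrite (splitr e) EFinD leeD.
- move=> t /= /not_orP[/h <- nK]; split=> [Ft|/GP[i _ Fi]]; last by exists i.
  by apply: contrapT => nG; apply: nK.
Qed.

Lemma elementary_coord (i : 'I_N) (k n : nat) : (0 < n)%N ->
  elementary [set t | (ccell n (tnth t i) < k)%N].
Proof.
by move=> n0; exists n => // s t /ffunP/(_ i); rewrite !ffunE /= => ->.
Qed.

(** The half-lines x <= y generate the Borel sets, and the set of the points t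
   with x <= t i is a countable intersection of unions of cells. *)
Lemma approximable_coord (i : 'I_N) (B : set (measurableTypeR R)) : measurable B ->
  approximable [set t | B (val (tnth t i))].
Proof.
move=> mB.
pose G : set (set (measurableTypeR R)) := [set A | approximable [set t | A (val (tnth t i))]].
have sG : sigma_algebra setT G.
  split.
  - by apply/approximable_elementary/elementary0.
  - by move=> A; rewrite setTD => /approximableC.
  - move=> F hF; rewrite /G /= (_ : [set t | _] = \bigcup_k [set t | F k (val (tnth t i))]).
      exact: approximable_bigcup.
    by apply/seteqP; split => t [k _ h]; exists k.
have : @measurable _ (measurableTypeR R) `<=` G.
  rewrite [X in X `<=` _]RGenCInfty.measurableE.
  apply: smallest_sub => // _ [x ->].
  rewrite /G /= (_ : [set t | _] = ~` (\bigcup_n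
      [set t | (ccell n.+1 (tnth t i) < Num.truncn (n.+1%:R * x))%N])).
    apply/approximableC/approximable_bigcup => n.
    by apply/approximable_elementary/elementary_coord.
  apply/seteqP; split => t /=; rewrite in_itv/= andbT.
    move=> xt [n _ /=]; rewrite ltnNge => /negP; apply; apply: le_truncn.
    by rewrite ler_pM2l// ltr0n.
  move=> h; rewrite leNgt; apply/negP => tx; apply: h.
  have d0 : 0 < x - val (tnth t i) by rewrite subr_gt0.
  have [n _ hn] := near_infty_natSinv_lt (PosNum d0).
  exists n => //=; rewrite truncn_gt_nat -natr1.
  have /andP[h1 _] := ccell_itv n.+1 (tnth t i); apply: le_trans (lerD h1 (lexx 1)) _.
  have := hn n (leqnn n) => /= /ltW hn'.
  have np : 0 < n.+1%:R :> R by [].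
  have : 1 <= n.+1%:R * (x - val (tnth t i)) by rewrite mulrC -ler_pdivrMr// div1r.
  by rewrite mulrBr; move: (_ * x) (_ * val _) => p q; lra.
by move=> /(_ _ mB).
Qed.

End atom_vectors.

Import HBNNSimple.
Section density.
Variables (R : realType) (N M : nat).
Local Notation C := R[i].
Local Notation mu := (torus_measure R N).
Local Notation fT := (torus R N -> 'cV[C]_M).
Local Notation L2 := (L2 R N M).
Local Notation dot := (@L2_dot R N M).
Local Notation cls := (@L2_class R N M).
Local Notation idx := (idx N).
Implicit Types (f g : fT) (u v : L2).

Lemma measurable_approximable (A : set (torus R N)) : measurable A -> approximable A.
Proof.
move: A; apply: smallest_sub.
  split; first by apply/approximable_elementary/elementary0.
  - by move=> A; rewrite setTD => /approximableC.
  - exact: approximable_bigcup.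
move=> A; rewrite -bigcup_seq/= => -[i _ [B [B' mB' <-] <-]].
by rewrite !setTI; exact: (approximable_coord i mB').
Qed.

Definition step_approx u := forall e, 0 < e -> exists n F, (0 < n)%N /\
  hnorm dot (u - cls (fun t => F (cell n t))) <= e.

Lemma sqint_step n (F : {ffun 'I_N -> nat} -> 'cV[C]_M) : (0 < n)%N ->
  sqint_prop (fun t => F (cell n t)).
Proof.
move=> n0; rewrite (_ : (fun t => _) =
    fun t => \sum_(c <- cells N n) (if cell n t == c then F c else 0)).
  by apply: sqint_sum => c; apply: sqint_if; [exact: measurable_cell_eq|exact: sqint_cst].
by apply/funext => t; rewrite sum_cell.
Qed.

Let H := @L2_prehilbert R N M.

Lemma step_approx_lin a u v : step_approx u -> step_approx v -> step_approx (a *: u + v).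
Proof.
move=> hu hv e e0; have c0 : 0 < cmod a + 1 by rewrite ltr_wpDl// cmod_ge0.
have d0 : 0 < e / (cmod a + 1) by exact: divr_gt0.
have [n [F [n0 hF]]] := hu _ d0; have [k [G [k0 hG]]] := hv _ d0.
pose F' c := F [ffun i => c i %/ k]%N; pose G' c := G [ffun i => c i %/ n]%N.
have FE t : F (cell n t) = F' (cell (n * k) t) by rewrite /F' cell_mul.
have GE t : G (cell k t) = G' (cell (n * k) t) by rewrite /G' mulnC cell_mul.
have nk : (0 < n * k)%N by rewrite muln_gt0 n0.
exists (n * k)%N, (fun c => a *: F' c + G' c); split=> //.
under eq_fun do rewrite -FE -GE.
rewrite L2_class_lin; [|exact: sqint_step|exact: sqint_step].
rewrite opprD addrACA -scalerBr; apply: le_trans (hnormD H _ _) _.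
have -> : e = cmod a * (e / (cmod a + 1)) + e / (cmod a + 1) by field; rewrite gt_eqF.
apply: lerD; last exact: hG.
by rewrite (hnormZ H); apply: ler_wpM2l; [exact: cmod_ge0|exact: hF].
Qed.

Lemma step_approx0 : step_approx 0.
Proof.
move=> e e0; exists 1%N, (fun=> 0); split=> //.
by rewrite L2_class0 subr0 (hnorm0 H) ltW.
Qed.

Lemma step_approx_sum (I : Type) (r : seq I) (F : I -> L2) :
  (forall i, step_approx (F i)) -> step_approx (\sum_(i <- r) F i).
Proof.
move=> hF; elim: r => [|i r IH]; first by rewrite big_nil; exact: step_approx0.
by rewrite big_cons -[F i]scale1r; exact: step_approx_lin.
Qed.

Lemma step_approx_limit u :
  (forall e, 0 < e -> exists2 v, step_approx v & hnorm dot (u - v) <= e) -> step_approx u.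
Proof.
move=> h e e0; have e2 : 0 < e / 2 by exact: divr_gt0.
have [v hv uv] := h _ e2; have [n [F [n0 hF]]] := hv _ e2; exists n, F; split=> //.
by apply: le_trans (hnorm_tri H v _ _) _; rewrite (splitr e); exact: lerD.
Qed.

Lemma sqint_indic (A : set (torus R N)) (w : 'cV[C]_M) : measurable A ->
  sqint_prop (fun t => if t \in A then w else 0).
Proof.
move=> mA; apply: sqint_if; last exact: sqint_cst.
apply: (measurable_fun_bool true) => //; rewrite setTI.
rewrite [X in measurable X](_ : _ = A)//.
by apply/seteqP; split => t /= tA; [exact: set_mem|exact: mem_set].
Qed.

(** A measurable set differs from a union of cells in a set of small measure. *)
Lemma step_approx_indic (A : set (torus R N)) (w : 'cV[C]_M) : measurable A ->
  step_approx (cls (fun t => if t \in A then w else 0)).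
Proof.
move=> mA; have iB B := @sqint_indic B w.
apply: step_approx_limit => e e0.
have k0 : 0 < sqnorm w + 1 by rewrite ltr_wpDl// sqnorm_ge0.
have d0 : 0 < e ^+ 2 / (sqnorm w + 1) by rewrite divr_gt0// exprn_gt0.
have [_ /(_ _ d0)[S [D [eS mD De h]]]] := measurable_approximable mA.
have mS := measurable_elementary eS.
exists (cls (fun t => if t \in S then w else 0)).
  have [n n0 hS] := elementary_step eS; move=> r r0.
  exists n, (fun c => if corner R n c \in S then w else 0); split=> //.
  under [X in _ - cls X]eq_fun do rewrite -hS.
  by rewrite subrr (hnorm0 H) ltW.
rewrite -(@ler_pXn2r _ 2) ?nnegrE ?hnorm_ge0 ?(ltW e0)// -lee_fin.
rewrite -L2_classB; [|exact: iB|exact: iB].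
rewrite L2_norm_class; last by apply: sqintB; exact: iB.
apply: (@le_trans _ _ (\int[mu]_t ((sqnorm w)%:E * (\1_D t)%:E))%E).
  apply: ge0_le_integral => //.
  - by move=> t _; rewrite lee_fin sqnorm_ge0.
  - apply/measurable_EFinP; have [? ? _] := sqintB (iB _ mA) (iB _ mS).
    exact: measurable_sqnorm.
  - by apply: emeasurable_funM; [exact: measurable_cst|apply/measurable_EFinP].
  move=> t _; rewrite -EFinM lee_fin indicE.
  have [tD|tD] := boolP (t \in D).
    rewrite mulr1; case: ifP => _; case: ifP => _; rewrite ?subrr ?subr0 ?sub0r//.
    - by rewrite /sqnorm big1 ?sqnorm_ge0// => j _; rewrite mxE /= expr0n addr0.
    - by rewrite -scaleN1r sqnormZ /= oppr0 sqrrN expr1n expr0n addr0 mul1r.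
    - by rewrite /sqnorm big1 ?sqnorm_ge0// => j _; rewrite mxE /= expr0n addr0.
  have AS : (t \in A) = (t \in S).
    have /h[h1 h2] : ~ D t by move=> Dt; move/negP: tD; apply; exact: mem_set.
    by apply/idP/idP => /set_mem ?; apply: mem_set; auto.
  rewrite mulr0 AS subrr /sqnorm big1// => j _; rewrite mxE /= expr0n addr0//.
rewrite ge0_integralZl_EFin; [|exact: measurableT|by move=> t _; rewrite lee_fin
  |by apply/measurable_EFinP|exact: sqnorm_ge0].
rewrite integral_indic// setIT; apply: le_trans (lee_wpmul2l _ De) _.
  by rewrite lee_fin sqnorm_ge0.
rewrite -EFinM lee_fin mulrCA; apply: ler_piMr; first exact: sqr_ge0.
by rewrite ler_pdivrMr// mul1r lerDl.
Qed.

Lemma sqint_scalar (k : torus R N -> R) (w : 'cV[C]_M) : measurable_fun setT k ->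
  (\int[mu]_t (k t ^+ 2)%:E < +oo)%E ->
  sqint_prop (fun t => (k t)%:C%C *: w) /\
  (forall r : R, (\int[mu]_t (k t ^+ 2)%:E <= r%:E)%E ->
    (\int[mu]_t (sqnorm ((k t)%:C%C *: w))%:E <= (r * sqnorm w)%:E)%E).
Proof.
move=> mk ki.
have sE t : sqnorm ((k t)%:C%C *: w) = sqnorm w * k t ^+ 2.
  by rewrite sqnormZ /= expr0n addr0 mulrC.
have iE : (\int[mu]_t (sqnorm ((k t)%:C%C *: w))%:E =
    (sqnorm w)%:E * \int[mu]_t (k t ^+ 2)%:E)%E.
  under eq_integral => t _ do rewrite sE EFinM.
  rewrite ge0_integralZl_EFin; [by []|exact: measurableT|by move=> t _; rewrite lee_fin sqr_ge0
    |by apply/measurable_EFinP; exact: measurable_funX|exact: sqnorm_ge0].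
split; last first.
  move=> r kr; rewrite iE mulrC EFinM; apply: lee_wpmul2l => //.
  by rewrite lee_fin sqnorm_ge0.
split=> [j|j|].
- rewrite (_ : (fun t => _) = fun t => k t * Re (w j 0)).
    by apply: measurable_funM => //; exact: measurable_cst.
  by apply/funext => t; rewrite mxE; case: (w j 0) => ? ? /=; rewrite mul0r subr0.
- rewrite (_ : (fun t => _) = fun t => k t * Im (w j 0)).
    by apply: measurable_funM => //; exact: measurable_cst.
  by apply/funext => t; rewrite mxE; case: (w j 0) => ? ? /=; rewrite mul0r addr0.
rewrite iE; apply: lte_mul_pinfty => //; first by rewrite lee_fin sqnorm_ge0.
Qed.

(** A nonnegative function is the limit of increasing simple functions, and the
   squares of the differences are dominated by its square. *)
Lemma step_approx_scalar (g : torus R N -> R) (w : 'cV[C]_M) :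
  measurable_fun setT g -> (forall t, 0 <= g t) -> (\int[mu]_t (g t ^+ 2)%:E < +oo)%E ->
  step_approx (cls (fun t => (g t)%:C%C *: w)).
Proof.
move=> mg g0 gi.
have mG : measurable_fun setT (EFin \o g) by exact/measurable_EFinP.
have G0 t : setT t -> (0 <= (EFin \o g) t)%E by rewrite lee_fin.
pose a n := nnsfun_approx measurableT mG n.
have aE n t : (a n t)%:E = (approx setT (EFin \o g) n t)%:E by rewrite /a nnsfun_approxE.
have a_le n t : a n t <= g t by rewrite -lee_fin aE; exact: le_approx.
have a_ge n t : 0 <= a n t by [].
have a_cvg t : (fun n => a n t) @ \oo --> g t.
  by have := @cvg_nnsfun_approx _ _ R setT measurableT _ mG G0 t I; move/fine_cvgP => [_].
pose D n t : \bar R := ((g t - a n t) ^+ 2)%:E.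
have mD n : measurable_fun setT (D n).
  apply/measurable_EFinP; apply: measurable_funX; apply: measurable_funB => //.
have ig : mu.-integrable setT (fun t => (g t ^+ 2)%:E).
  apply/integrableP; split; first by apply/measurable_EFinP; exact: measurable_funX.
  by under eq_integral => t _ do rewrite gee0_abs ?lee_fin ?sqr_ge0//.
have [] := @dominated_convergence _ _ _ mu setT measurableT D (cst 0) _ mD _ _ ig _.
- exact: measurable_cst.
- apply: aeW => t _; apply/fine_cvgP; split; first exact: nearW.
  have d0 : (fun n => g t - a n t) @ \oo --> (0 : R).
    by rewrite -(subrr (g t)); apply: cvgB; [exact: cvg_cst|exact: a_cvg].
  have d2 := cvgM d0 d0; rewrite mulr0 in d2.
  rewrite [X in X @ _](_ : _ = (fun n => (g t - a n t) * (g t - a n t)))//.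
  exact: d2.
- apply: aeW => t n _; rewrite gee0_abs ?lee_fin ?sqr_ge0//.
  have := a_le n t; have := a_ge n t; have := g0 t => ? ? ?.
  by rewrite ler_pXn2r ?nnegrE ?subr_ge0// gerBl.
move=> _ _; rewrite integral0 => Dto0.
have sq k := @sqint_scalar k w.
have [sg _] := sq g mg gi.
have ma n : measurable_fun setT (fun t => a n t) by [].
have sa n : sqint_prop (fun t => (a n t)%:C%C *: w).
  apply: (sq _ (ma n) _).1; apply: le_lt_trans gi; apply: ge0_le_integral => //.
  - by move=> t _; rewrite lee_fin sqr_ge0.
  - by apply/measurable_EFinP; apply: measurable_funX.
  - by apply/measurable_EFinP; apply: measurable_funX.
  - by move=> t _; rewrite lee_fin ler_pXn2r ?nnegrE.
apply: step_approx_limit => e e0.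
have k0 : 0 < sqnorm w + 1 by rewrite ltr_wpDl// sqnorm_ge0.
have d0 : 0 < e ^+ 2 / (sqnorm w + 1) by rewrite divr_gt0// exprn_gt0.
have [n hn] : exists n, (\int[mu]_t D n t <= (e ^+ 2 / (sqnorm w + 1))%:E)%E.
  apply: contrapT => h; have : ((e ^+ 2 / (sqnorm w + 1))%:E <= (0 : \bar R))%E.
    apply: (cvge_to_ge Dto0); apply: nearW => n; apply/ltW; rewrite ltNge; apply/negP => hn.
    by apply: h; exists n.
  by rewrite lee_fin leNgt d0.
exists (cls (fun t => (a n t)%:C%C *: w)).
  pose s : seq R := finmap.enum_fset (fset_set (a n @` setT)).
  rewrite (_ : (fun t => _) = fun t => \sum_(i < size s)
      (if t \in a n @^-1` [set s`_i] then (s`_i)%:C%C *: w else 0)).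
    have mi (i : 'I_(size s)) : measurable (a n @^-1` [set s`_i]).
      by rewrite -[_ @^-1` _]setTI; exact: (ma n).
    rewrite L2_class_sum; last by move=> i; exact: sqint_indic.
    by apply: step_approx_sum => i; exact: step_approx_indic.
  apply/funext => t; rewrite (fimfunEord (a n) t) rmorph_sum scaler_suml.
  apply: eq_bigr => i _; rewrite indicE.
  by case: (t \in _); rewrite ?mulr1 ?mulr0 ?scale0r.
rewrite -(@ler_pXn2r _ 2) ?nnegrE ?hnorm_ge0 ?(ltW e0)// -lee_fin.
rewrite -(L2_classB sg (sa n)) L2_norm_class; last exact: (sqintB sg (sa n)).
under eq_integral => t _ do rewrite -scalerBl -rmorphB.
have mga : measurable_fun setT (fun t => g t - a n t) by apply: measurable_funB.
have gai : (\int[mu]_t ((g t - a n t) ^+ 2)%:E < +oo)%E by apply: le_lt_trans hn _; rewrite ltry.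
apply: le_trans ((sq _ mga gai).2 _ hn) _; rewrite lee_fin mulrAC -mulrA.
by apply: ler_piMr; [exact: sqr_ge0|rewrite ler_pdivrMr// mul1r lerDl].
Qed.

(** Split a vector-valued function into the positive and negative parts of the
   real and imaginary parts of its components. *)
Theorem step_dense u : step_approx u.
Proof.
have hu := L2_sqint u; have [uR uI ui] := hu; set f := L2_fun u in hu uR uI ui.
have part (g : torus R N -> R) (w : 'cV[C]_M) : measurable_fun setT g ->
    (\int[mu]_t (g t ^+ 2)%:E < +oo)%E -> step_approx (cls (fun t => (g t)%:C%C *: w)).
  move=> mg gi.
  have half (k : torus R N -> R) : measurable_fun setT k -> (forall t, k t ^+ 2 = g t ^+ 2) ->
      sqint_prop (fun t => (Num.max (k t) 0)%:C%C *: w) /\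
      step_approx (cls (fun t => (Num.max (k t) 0)%:C%C *: w)).
    move=> mk kg.
    have mp : measurable_fun setT (fun t => Num.max (k t) 0).
      by apply: measurable_maxr => //; exact: measurable_cst.
    have pi : (\int[mu]_t (Num.max (k t) 0 ^+ 2)%:E < +oo)%E.
      apply: le_lt_trans gi; apply: ge0_le_integral => //.
      - by move=> t _; rewrite lee_fin sqr_ge0.
      - by apply/measurable_EFinP; exact: measurable_funX.
      - by apply/measurable_EFinP; exact: measurable_funX.
      - move=> t _; rewrite lee_fin -kg /Num.max; case: ifP => // _.
        by rewrite expr0n sqr_ge0.
    split; first exact: (sqint_scalar w mp pi).1.
    by apply: step_approx_scalar => // t; rewrite le_max lexx orbT.
  have [s1 a1] := half g mg (fun t => erefl).
  have [||s2 a2] := half (fun t => - g t); first by apply: measurable_funN.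
    by move=> t; rewrite sqrrN.
  have -> : cls (fun t => (g t)%:C%C *: w) = (-1) *: cls (fun t => (Num.max (- g t) 0)%:C%C *: w)
      + cls (fun t => (Num.max (g t) 0)%:C%C *: w).
    rewrite -(L2_class_lin (-1) s2 s1); congr cls; apply/funext => t.
    rewrite scaleN1r addrC -scalerBl -rmorphB; congr (_%:C%C *: _).
    case/orP: (le_total 0 (g t)) => h.
      have e1 : Num.max (g t) 0 = g t by apply: max_l.
      have e2 : Num.max (- g t) 0 = 0 by apply: max_r; rewrite oppr_le0.
      by rewrite e1 e2 subr0.
    have e1 : Num.max (g t) 0 = 0 by apply: max_r.
    have e2 : Num.max (- g t) 0 = - g t by apply: max_l; rewrite oppr_ge0.
    by rewrite e1 e2 sub0r opprK.
  exact: step_approx_lin.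
have fE : f = fun t => \sum_j ((Re (f t j 0))%:C%C *: delta_mx j 0 +
    (Im (f t j 0))%:C%C *: ('i%C *: delta_mx j 0)).
  apply/funext => t; rewrite {1}(matrix_sum_delta (f t)); apply: eq_bigr => j _.
  rewrite big_ord_recl big_ord0 addr0 scalerA -scalerDl; congr (_ *: delta_mx _ _).
  have -> : f t j ord0 = f t j 0 by congr (f t j _); exact: val_inj.
  by case: (f t j _) => x y; apply/eqP; rewrite eq_complex /=; apply/andP; split;
    apply/eqP; ring.
have fin (P : C -> R) j : (forall z, P z ^+ 2 <= Re z ^+ 2 + Im z ^+ 2) ->
    measurable_fun setT (fun t => P (f t j 0)) ->
    (\int[mu]_t (P (f t j 0) ^+ 2)%:E < +oo)%E.
  move=> Pz mP; apply: le_lt_trans ui; apply: ge0_le_integral => //.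
  - by move=> t _; rewrite lee_fin sqr_ge0.
  - by apply/measurable_EFinP; exact: measurable_funX.
  - by apply/measurable_EFinP; exact: measurable_sqnorm.
  - by move=> t _; rewrite lee_fin (le_trans (Pz _))// sqnorm_comp.
have fR j : (\int[mu]_t (Re (f t j 0) ^+ 2)%:E < +oo)%E.
  by apply: (fin (@Re R)) => // z; rewrite lerDl sqr_ge0.
have fI j : (\int[mu]_t (Im (f t j 0) ^+ 2)%:E < +oo)%E.
  by apply: (fin (@Im R)) => // z; rewrite lerDr sqr_ge0.
have sR j := (sqint_scalar (delta_mx j 0) (uR j) (fR j)).1.
have sI j := (sqint_scalar ('i%C *: delta_mx j 0) (uI j) (fI j)).1.
rewrite -[u]L2_funK -/f fE L2_class_sum => [|j]; last exact: (sqintD (sR j) (sI j)).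
apply: step_approx_sum => j; rewrite (L2_classD (sR j) (sI j)) -[cls _]scale1r.
by apply: step_approx_lin; exact: part.
Qed.
End density.

(** * The chain of matrix units of the algebra of finite derivatives *)
Section L2_system.
Variables (R : realType) (N M : nat) (m : nat -> nat).
Local Notation C := R[i].
Hypothesis m_gt0 : forall l, (0 < m l)%N.
Hypothesis m_dvd : forall l, (m l %| m l.+1)%N.
Hypothesis m_cofinal : forall n, (0 < n)%N -> exists l, (n %| m l)%N.
Hypothesis M_gt0 : (0 < M)%N.
Local Notation dot := (@L2_dot R N M).
Local Notation d := (natoms N M m).
Local Notation at_ := (atom N M m).

Definition L2_unit l p q : L2 R N M -> L2 R N M := pshift (m l) (at_ l p) (at_ l q).
Definition L2_vec l p : L2 R N M := atom_vec R M (m l) (at_ l p).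

Let at_in l p : (p < d l)%N -> at_ l p \in atoms N M (m l).
Proof. exact: atom_in. Qed.

Let at_eq l p q : (p < d l)%N -> (q < d l)%N -> (at_ l p == at_ l q) = (p == q).
Proof.
move=> pl ql; apply/eqP/eqP => [|->//].
exact: (atom_inj m_gt0 m_dvd M_gt0).
Qed.

(** The density of the vectors comes from [step_dense]: since every
   positive integer divides some m l, a step function on any mesh is one on a mesh of the chain. *)
Theorem L2_munits : munits dot d L2_unit L2_vec.
Proof.
split.
- exact: L2_hilbert.
- exact: natoms_gt0.
- by move=> l; rewrite natomsS// dvdn_mulr.
- by move=> l p q; exact: pshift_lin.
- by move=> l p q p' q' u ql pl; rewrite /L2_unit pshift_mul ?at_in// at_eq.
- move=> l u; rewrite /L2_unit.
  rewrite (sum_atoms m_gt0 m_dvd M_gt0 (fun x => pshift (m l) x x u)).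
  exact: pshift_sum.
- by move=> l p q u v pl ql; exact: (pshift_adj _ _ (m_gt0 l) (at_in pl) (at_in ql)).
- move=> l p q u pl ql; rewrite natoms_ratio// /L2_unit.
  rewrite (pshift_refine _ _ u (m_gt0 l) (ratio_gt0 m_gt0 m_dvd l)) -sum_nth_cell.
  apply: eq_bigr => k _; rewrite (atom_refine M m_gt0 m_dvd p (ltn_ord k)).
  by rewrite (atom_refine M m_gt0 m_dvd q (ltn_ord k)) -(m_ratio m_dvd l).
- by move=> l p q s ql sl; rewrite /L2_unit pshift_atom ?at_in// at_eq.
- move=> l p pl; rewrite natoms_ratio// /L2_vec.
  rewrite (atom_vec_refine _ _ _ (m_gt0 l) (ratio_gt0 m_gt0 m_dvd l)) -sum_nth_cell.
  apply: eq_bigr => k _; rewrite (atom_refine M m_gt0 m_dvd p (ltn_ord k)).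
  by rewrite -(m_ratio m_dvd l).
- rewrite /L2_vec (sum_atoms m_gt0 m_dvd M_gt0 (fun x => atom_vec R M (m 0) x)).
  rewrite atom_vec_total// dot_class; [|exact: sqint_cst|exact: sqint_cst].
  rewrite fdot_sq sqnorm_evec_sum// Rintegral_cst// mul1r.
  transitivity ((fine (1%E : \bar R))%:C%C : C) => //.
  by congr ((fine _)%:C%C); exact: (@probability_setT _ _ _ (torus_measure R N)).
- move=> u e e0; have [n [F [n0 hF]]] := step_dense u e0.
  have [l nl] := m_cofinal n0; pose r := (m l %/ n)%N.
  have ml : m l = (n * r)%N by rewrite mulnC divnK.
  have r0 : (0 < r)%N by rewrite divn_gt0//; apply: dvdn_leq.
  pose F' c := F [ffun i => c i %/ r]%N.
  pose cf (x : idx N) : C := (Num.sqrt M%:R)%:C%C * coord x.2 (F' x.1).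
  exists l, (fun p => cf (at_ l p)).
  rewrite /L2_vec (sum_atoms m_gt0 m_dvd M_gt0 (fun x => cf x *: atom_vec R M (m l) x)).
  suff -> : \sum_(c <- cells N (m l)) \sum_(i < M)
      cf (c, i : nat) *: atom_vec R M (m l) (c, i : nat) = L2_class (fun t => F (cell n t)) by [].
  transitivity (L2_class (fun t : torus R N => F' (cell (m l) t))).
    rewrite (L2_class_step F' (m_gt0 l)).
    by apply: eq_bigr => c _; apply: eq_bigr => i _; rewrite /cf coordE.
  by congr L2_class; apply/funext => t; rewrite ml /F' cell_mul.
Qed.

Lemma pshift_ops l x y : x \in atoms N M (m l) -> y \in atoms N M (m l) ->
  ops d L2_unit (pshift (m l) x y).
Proof.
move=> xa ya.
have E z : z \in atoms N M (m l) -> exists2 p, (p < d l)%N & z = at_ l p.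
  rewrite -(perm_mem (perm_atom N m_gt0 m_dvd M_gt0 l)) => /mapP[p].
  by rewrite mem_iota => pl ->; exists p.
have [p pl ->] := E _ xa; have [q ql ->] := E _ ya.
by exists l, (mxunit R d l p q); rewrite rho_unit.
Qed.

Lemma ops_sum (I : eqType) (r : seq I) (F : I -> L2 R N M -> L2 R N M) :
  (forall i, i \in r -> ops d L2_unit (F i)) -> ops d L2_unit (\sum_(i <- r) F i).
Proof.
have [z0 zl _] := ops_subalg L2_munits.
elim: r => [|i r IH] hF; first by rewrite big_nil.
rewrite big_cons -[F i]scale1r; apply: zl; first by apply: hF; rewrite mem_head.
by apply: IH => j jr; apply: hF; rewrite in_cons jr orbT.
Qed.

Lemma ops_scale (a : C) A : ops d L2_unit A -> ops d L2_unit (a *: A).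
Proof.
have [z0 zl _] := ops_subalg L2_munits.
by move=> oA; have := zl a _ _ oA z0; rewrite addr0.
Qed.
End L2_system.

(** * The algebra generated by finite derivatives and multiplications *)
Section translations.
Variables (R : realType) (N M : nat).
Local Notation C := R[i].
Local Notation mu := (torus_measure R N).
Local Notation fT := (torus R N -> 'cV[C]_M).
Local Notation L2 := (L2 R N M).
Local Notation dot := (@L2_dot R N M).
Local Notation cls := (@L2_class R N M).
Implicit Types (f g : fT) (u v : L2) (h : 'I_N -> R).
Let H := @L2_prehilbert R N M.

Definition translate h u : L2 := cls (L2_fun u \o vshift h).

Lemma translate_class h f : sqint_prop f -> translate h (cls f) = cls (f \o vshift h).
Proof.
move=> hf; apply: L2_class_eq; [apply: sqint_vshift; exact: L2_sqint|exact: sqint_vshift|].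
have := ae_vshift h (L2_fun_class hf).
by apply: filterS => t /= ->.
Qed.

Lemma translateD h k : translate h \o translate k = translate (fun j => h j + k j).
Proof.
apply/funext => u /=; rewrite {2}/translate translate_class; last exact/sqint_vshift/L2_sqint.
by congr cls; apply/funext => t /=; rewrite vshiftD.
Qed.

Lemma translate0 : translate (fun=> 0) = id.
Proof.
apply/funext => u; rewrite -[RHS]L2_funK; congr cls; apply/funext => t /=.
by congr (L2_fun u _); apply: (vshift_int (fun=> 0)).
Qed.

Definition along (i : 'I_N) (a : R) : 'I_N -> R := fun j => if j == i then a else 0.

Lemma finite_derivativeE i (q : rat) :
  finite_derivative i q = ((ratr q)^-1 : C) *: (translate (along i (ratr q)) - id).
Proof.
apply/funext => u; have hu := L2_sqint u.
have hs := sqint_vshift (along i (ratr q)) hu.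
transitivity (((ratr q)^-1 : C) *: (translate (along i (ratr q)) u - u)); last by [].
rewrite -{3}[u]L2_funK -(L2_classB hs hu) -(L2_class_scale _ (sqintB hs hu)).
by congr cls; apply/funext => t; rewrite torus_shiftE.
Qed.

Lemma multiplication_class S f : sqint_prop (fun t => S t *m L2_fun (cls f) t) ->
  sqint_prop (fun t => S t *m f t) -> sqint_prop f ->
  multiplication_op S (cls f) = cls (fun t => S t *m f t).
Proof.
move=> h1 h2 hf; apply: L2_class_eq => //.
by have := L2_fun_class hf; apply: filterS => t ->.
Qed.

(** ** Functions that are constant on the cells of some mesh *)
Definition cellwise (T : Type) (S : torus R N -> T) :=
  exists2 n, (0 < n)%N & forall s t, cell n s = cell n t -> S s = S t.

Lemma cellwise_at (T : Type) n (S : torus R N -> T) : (0 < n)%N ->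
  (forall s t, cell n s = cell n t -> S s = S t) ->
  forall t, S t = S (corner R n (cell n t)).
Proof. by move=> n0 h t; apply: h; rewrite cell_corner// cell_in. Qed.

Lemma cellwise_dvd (T : Type) n k (S : torus R N -> T) : (0 < n)%N -> (0 < k)%N ->
  (n %| k)%N -> (forall s t, cell n s = cell n t -> S s = S t) ->
  forall s t, cell k s = cell k t -> S s = S t.
Proof.
move=> n0 k0 /dvdnP[r kr] h s t e; apply: h; rewrite kr mulnC in e k0.
have r0 : (0 < r)%N by move: k0; rewrite muln_gt0 => /andP[].
by rewrite -(cell_mul s n0 r0) -(cell_mul t n0 r0) e.
Qed.

(** An arc whose end points are multiples of 1 / n is a union of cells of mesh
   1 / n: after translation by the integer part k of t, the cell of z lies between
   two consecutive multiples of 1 / n on the real line. *)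
Lemma arc_cell (a b : rat) n (A B : int) (z z' : circle R) : (0 < n)%N ->
  n%:R * ratr a = A%:~R :> R -> n%:R * ratr b = B%:~R :> R ->
  ccell n z = ccell n z' -> Defs.arc a b z -> Defs.arc a b z'.
Proof.
move=> n0 nA nB e [t + tz]; rewrite /= in_itv /= => /andP[ta tb].
have np : 0 < n%:R :> R by rewrite ltr0n.
set k := Num.floor t.
have vz : val z = t - k%:~R by rewrite -tz.
exists (val z' + k%:~R); last by rewrite -[RHS]to_circleK; apply/to_circleP; exists k.
have /andP[h1 h2] := ccell_itv n z; have /andP[h1' h2'] := ccell_itv n z'.
rewrite e vz in h1 h2.
set c := ccell n z' in h1 h2 h1' h2'.
have E x : n%:R * (x + k%:~R) = n%:R * x + (n%:Z * k)%:~R :> R.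
  by rewrite mulrDr intrM.
have Et : n%:R * t = n%:R * (t - k%:~R) + (n%:Z * k)%:~R :> R.
  by rewrite -E subrK.
have lA : A%:~R < (c.+1%:Z + n%:Z * k)%:~R :> R.
  rewrite -nA intrD; apply: (@le_lt_trans _ _ (n%:R * t)); first by rewrite ler_pM2l.
  by rewrite Et ltrD2r.
have lB : (c%:Z + n%:Z * k)%:~R < B%:~R :> R.
  rewrite -nB intrD; apply: (@le_lt_trans _ _ (n%:R * t)); last by rewrite ltr_pM2l.
  by rewrite Et lerD2r.
rewrite ltr_int in lA; rewrite ltr_int in lB.
rewrite /= in_itv /=; apply/andP; split.
  rewrite -(ler_pM2l np) E nA; apply: (@le_trans _ _ ((c%:Z + n%:Z * k)%:~R)).
    by rewrite ler_int; move: lA; lia.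
  by rewrite intrD lerD2r.
rewrite -(ltr_pM2l np) E nB; apply: (@lt_le_trans _ _ ((c.+1%:Z + n%:Z * k)%:~R)).
  by rewrite intrD ltrD2r.
by rewrite ler_int; move: lB; lia.
Qed.

Lemma ratr_numden (q : rat) : ratr q = (numq q)%:~R / (denq q)%:~R :> R.
Proof. by []. Qed.

Lemma denq_nat (q : rat) : denq q = (`|denq q|%N)%:Z.
Proof. by rewrite gez0_abs// ltW. Qed.

Lemma mul_denq (q : rat) n : (`|denq q| %| n)%N -> exists A : int, n%:R * ratr q = A%:~R :> R.
Proof.
move=> /dvdnP[k ->]; exists (k%:Z * numq q); rewrite ratr_numden natrM intrM.
have -> : (`|denq q|%N)%:R = (denq q)%:~R :> R by rewrite {2}denq_nat.
have d0 : (denq q)%:~R != 0 :> R by rewrite intr_eq0.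
by field.
Qed.

Lemma elementary_arc (i : 'I_N) (a b : rat) :
  elementary [set t : torus R N | Defs.arc a b (tnth t i)].
Proof.
exists (`|denq a| * `|denq b|)%N; first by rewrite muln_gt0 !absz_gt0 !denq_neq0.
move=> s t /ffunP/(_ i); rewrite !ffunE => e /=.
have [A hA] := @mul_denq a (`|denq a| * `|denq b|)%N (dvdn_mulr _ (dvdnn _)).
have [B hB] := @mul_denq b (`|denq a| * `|denq b|)%N (dvdn_mull _ (dvdnn _)).
by apply: arc_cell hA hB e; rewrite muln_gt0 !absz_gt0 !denq_neq0.
Qed.

Lemma elementary_box (a b : 'I_N -> rat) : elementary (box a b : set (torus R N)).
Proof.
rewrite (_ : box a b = ~` \big[setU/set0]_(i < N) ~` [set t | Defs.arc (a i) (b i) (tnth t i)]).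
  apply: elementaryC; apply: (big_ind (@elementary R N)); first exact: elementary0.
    exact: elementaryU.
  by move=> i _; apply: elementaryC; exact: elementary_arc.
rewrite -bigcup_seq; apply/seteqP; split => [t bt [i _ /=]|t nt i]; first by apply; exact: bt.
by apply: contrapT => ni; apply: nt; exists i => //=; rewrite mem_index_enum.
Qed.

Lemma cellwise_add (U : nmodType) (S S' : torus R N -> U) :
  cellwise S -> cellwise S' -> cellwise (fun t => S t + S' t).
Proof.
move=> [n n0 hS] [k k0 hS']; have nk : (0 < n * k)%N by rewrite muln_gt0 n0.
exists (n * k)%N => // s t e; congr (_ + _).
  exact: (cellwise_dvd n0 nk (dvdn_mulr _ (dvdnn _)) hS e).
exact: (cellwise_dvd k0 nk (dvdn_mull _ (dvdnn _)) hS' e).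
Qed.

Lemma cellwise_step (S : torus R N -> 'M[C]_M) : step_fun S -> cellwise S.
Proof.
move=> [P [p [q [s [_ hS]]]]]; have -> : S = fun x => \sum_(k < P) \1_(box (p k) (q k)) x *: s k.
  exact/funext.
elim: (index_enum _) => [|k r [n n0 IH]].
  by exists 1%N => // ? ? _; rewrite !big_nil.
rewrite (_ : (fun x => _) = fun x => \1_(box (p k) (q k)) x *: s k +
    \sum_(k <- r) \1_(box (p k) (q k)) x *: s k); last first.
  by apply/funext => x; rewrite big_cons.
apply: cellwise_add; last by exists n.
have [l l0 h] := @elementary_box (p k) (q k); exists l => // x y e; congr (_ *: _).
rewrite !indicE; congr ((nat_of_bool _)%:R).
by apply/idP/idP => /set_mem bx; apply: mem_set; apply: h bx.
Qed.

(** On each cell a cellwise constant multiplication is a constant matrix, which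
   expands in the partial shifts that fix the cell. *)
Lemma cell_mulmx (n : nat) (F : {ffun 'I_N -> nat} -> 'M[C]_M) f t : (0 < n)%N ->
  F (cell n t) *m f t = \sum_(c <- cells N n) \sum_(i < M) \sum_(j < M)
    F c i j *: pshift_fun n (c, i : nat) (c, j : nat) f t.
Proof.
move=> n0; transitivity (\sum_(c <- cells N n) if cell n t == c then F c *m f t else 0).
  by rewrite (sum_cell t (fun c => F c *m f t)).
apply: eq_bigr => c _; rewrite /pshift_fun /=; case: ifP => tc; last first.
  by rewrite big1// => i _; rewrite big1// => j _; rewrite scaler0.
rewrite disp_id {1}(matrix_sum_delta (F c)) mulmx_suml; apply: eq_bigr => i _.
rewrite mulmx_suml; apply: eq_bigr => j _; rewrite -scalemxAl; congr (_ *: (_ *m _)).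
by apply/matrixP => k l; rewrite !mxE.
Qed.

Lemma sqint_cell (n : nat) (F : {ffun 'I_N -> nat} -> 'M[C]_M) f : (0 < n)%N ->
  sqint_prop f -> sqint_prop (fun t => F (cell n t) *m f t).
Proof.
move=> n0 hf; rewrite (_ : (fun t => _) = fun t => \sum_(c <- cells N n)
    \sum_(i < M) \sum_(j < M) F c i j *: pshift_fun n (c, i : nat) (c, j : nat) f t).
  apply: sqint_sum => c; apply: sqint_sum => i; apply: sqint_sum => j.
  exact/sqint_scale/sqint_pshift.
by apply/funext => t; exact: cell_mulmx.
Qed.

Lemma sqint_cellwise (S : torus R N -> 'M[C]_M) f : cellwise S -> sqint_prop f ->
  sqint_prop (fun t => S t *m f t).
Proof.
move=> [n n0 h] hf; have := sqint_cell (fun c => S (corner R n c)) n0 hf.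
by congr sqint_prop; apply/funext => t; rewrite -(cellwise_at n0 h).
Qed.

Lemma sqnorm_mul_le (A : 'M[C]_M) e (v : 'cV[C]_M) : 0 <= e -> mxnorm_le A e ->
  sqnorm (A *m v) <= e ^+ 2 * sqnorm v.
Proof. by move=> e0 /(mxnorm_le_sq _ e0). Qed.

(** S f is the pointwise limit of step multiples of f, hence measurable, and its
   norm exceeds that of one of them by at most the norm of f. *)
Lemma sqint_regulated (S : torus R N -> 'M[C]_M) f : regulated S -> sqint_prop f ->
  sqint_prop (fun t => S t *m f t).
Proof.
move=> hS hf; have [fR fI fi] := hf.
have /choice[T hT] k : exists S', cellwise S' /\ forall x, mxnorm_le (S x - S' x) k.+1%:R^-1.
  have k0 : 0 < k.+1%:R^-1 :> R by rewrite invr_gt0.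
  by have [S' /cellwise_step cS' h] := hS _ k0; exists S'.
have sT k : sqint_prop (fun t => T k t *m f t) by apply: sqint_cellwise => //; exact: (hT k).1.
have comp (P : C -> R) : (forall x y, P (x - y) = P x - P y) ->
    (forall z, P z ^+ 2 <= Re z ^+ 2 + Im z ^+ 2) ->
    (forall k j, measurable_fun setT (fun t => P ((T k t *m f t) j 0))) ->
    forall j, measurable_fun setT (fun t => P ((S t *m f t) j 0)).
  move=> PB Psq mP j; apply: (measurable_fun_cvg (h := fun k t => P ((T k t *m f t) j 0))) => //.
  move=> t _; apply/cvgrPdist_le => e e0.
  have k0 : 0 < vnorm (f t) + 1 by rewrite ltr_wpDl// vnorm_ge0.
  have [n _ hn] := near_infty_natSinv_lt (PosNum (divr_gt0 e0 k0)).
  exists n => // k /= nk; rewrite -PB.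
  have -> : (S t *m f t) j 0 - (T k t *m f t) j 0 = ((S t - T k t) *m f t) j 0.
    rewrite mulmxBl; move: (S t *m f t) (T k t *m f t) => x y.
    by rewrite [RHS]mxE [X in _ = _ + X]mxE.
  have h1 := (hT k).2 t (f t); have h2 : k.+1%:R^-1 < e / (vnorm (f t) + 1) by exact: hn.
  have hP z : `|P z| <= Num.sqrt (Re z ^+ 2 + Im z ^+ 2).
    by rewrite -sqrtr_sqr ler_wsqrtr.
  apply: le_trans (hP _) _; apply: le_trans (_ : _ <= vnorm ((S t - T k t) *m f t)) _.
    by rewrite ler_wsqrtr// sqnorm_comp.
  apply: le_trans h1 _; apply: le_trans (ler_wpM2r (vnorm_ge0 _) (ltW h2)) _.
  by rewrite mulrAC ler_pdivrMr// ler_pM2l// lerDl.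
have mR j : measurable_fun setT (fun t => Re ((S t *m f t) j 0)).
  apply: (comp (@Re R)) => [x y|z|k i]; [exact: raddfB|by rewrite lerDl sqr_ge0|].
  by have [] := sT k.
have mI j : measurable_fun setT (fun t => Im ((S t *m f t) j 0)).
  apply: (comp (@Im R)) => [x y|z|k i]; [exact: raddfB|by rewrite lerDr sqr_ge0|].
  by have [] := sT k.
split=> //; have [sR sI si] := sT 0%N.
apply: (@le_lt_trans _ _ (\int[mu]_t (2%:E * (sqnorm (T 0%N t *m f t))%:E +
    2%:E * (sqnorm (f t))%:E))%E).
  apply: ge0_le_integral => //.
  - by move=> t _; rewrite lee_fin sqnorm_ge0.
  - by apply/measurable_EFinP; exact: measurable_sqnorm.
  - apply: emeasurable_funD; apply: emeasurable_funM; try exact: measurable_cst.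
      by apply/measurable_EFinP; exact: measurable_sqnorm.
    by apply/measurable_EFinP; exact: measurable_sqnorm.
  move=> t _; rewrite -!EFinM -EFinD lee_fin.
  have -> : S t *m f t = T 0%N t *m f t + (S t - T 0%N t) *m f t.
    by rewrite mulmxBl addrC subrK.
  apply: le_trans (sqnormD _ _) _; rewrite lerD2l ler_pM2l//.
  have := sqnorm_mul_le (f t) ler01 _; rewrite expr1n mul1r; apply.
  by have := (hT 0%N).2 t; rewrite invr1.
have fin2 (k : fT) : sqint_prop k -> mu.-integrable setT (fun t => 2%:E * (sqnorm (k t : 'cV[C]_M))%:E)%E.
  by move=> hk; apply: integrableZl => //; exact: integrable_sqnorm.
have i2 := integrableD measurableT (fin2 _ (sT 0%N)) (fin2 _ hf).
have [_] := integrableP _ _ _ i2.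
by under eq_integral => t _ do rewrite gee0_abs ?adde_ge0 ?mule_ge0 ?lee_fin ?sqnorm_ge0//.
Qed.
End translations.

(** ** Generators and matrix units *)
Section generators.
Variables (R : realType) (N M : nat).
Local Notation C := R[i].
Local Notation mu := (torus_measure R N).
Local Notation fT := (torus R N -> 'cV[C]_M).
Local Notation L2 := (L2 R N M).
Local Notation dot := (@L2_dot R N M).
Local Notation cls := (@L2_class R N M).
Implicit Types (f g : fT) (u v : L2) (S : torus R N -> 'M[C]_M).
Local Notation bnd := (opnorm_le (hnorm dot) (hnorm dot)).
Let H := @L2_prehilbert R N M.

Lemma regulated_step S : step_fun S -> regulated S.
Proof.
move=> hS e e0; exists S => // x; rewrite subrr.
by apply: mxnorm_le0; exact: ltW.
Qed.

Lemma multiplication_lin S : regulated S -> linear (@multiplication_op R N M S).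
Proof.
move=> hS a u v; have hu := L2_sqint u; have hv := L2_sqint v.
have hau := sqint_lin a hu hv.
rewrite -{1}[u]L2_funK -{1}[v]L2_funK -(L2_class_lin a hu hv).
rewrite multiplication_class//; try exact: sqint_regulated; last first.
  exact/sqint_regulated/L2_sqint.
rewrite /multiplication_op -L2_class_lin; try exact: sqint_regulated.
by congr cls; apply/funext => t; rewrite mulmxDr -scalemxAr.
Qed.

(** The operator norm of a multiplication is at most the supremum of the norms of
   its values. *)
Lemma multiplication_sub_bnd S S' e : regulated S -> regulated S' -> 0 <= e ->
  (forall x, mxnorm_le (S x - S' x) e) ->
  bnd (multiplication_op S - multiplication_op S') e.
Proof.
move=> hS hS' e0 h u; have hu := L2_sqint u; have [fR fI fi] := hu.
have sS := sqint_regulated hS hu; have sS' := sqint_regulated hS' hu.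
rewrite -(@ler_pXn2r _ 2) ?nnegrE ?mulr_ge0 ?hnorm_ge0// exprMn.
pose g x := S x *m L2_fun u x - S' x *m L2_fun u x.
have hg : sqint_prop g := sqintB sS sS'.
have -> : (multiplication_op S - multiplication_op S') u = cls g.
  by rewrite opB -(L2_classB sS sS').
suff : ((hnorm dot (cls g) ^+ 2)%:E <= (e ^+ 2)%:E * (hnorm dot u ^+ 2)%:E)%E.
  by rewrite -EFinM lee_fin.
rewrite (L2_norm_class hg) -[u in leRHS]L2_funK (L2_norm_class hu).
have mf : measurable_fun setT (fun x => (sqnorm (L2_fun u x))%:E).
  by apply/measurable_EFinP; exact: measurable_sqnorm.
have [dR dI _] := hg.
rewrite -ge0_integralZl//=; first last.
- by rewrite lee_fin sqr_ge0.
- by move=> x _; rewrite lee_fin sqnorm_ge0.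
apply: ge0_le_integral => //.
- by move=> x _; rewrite lee_fin sqnorm_ge0.
- by apply/measurable_EFinP; exact: measurable_sqnorm.
- by apply: emeasurable_funM => //; exact: measurable_cst.
move=> x _; rewrite -EFinM lee_fin /g -mulmxBl; exact: sqnorm_mul_le.
Qed.

Lemma translate_int h (k : 'I_N -> int) :
  translate (fun j => h j + (k j)%:~R) = translate h :> (L2 -> L2).
Proof.
apply/funext => u; congr cls; apply/funext => t /=; congr (L2_fun u _).
by rewrite -[RHS](vshift_int k) vshiftD.
Qed.

Lemma arc_ccell m a (z : circle R) : (a < m)%N ->
  Defs.arc (a%:R / m%:R) (a.+1%:R / m%:R) z <-> ccell m z = a.
Proof.
move=> am; have m0 : (0 < m)%N by exact: leq_ltn_trans am.
have mp : 0 < m%:R :> R by rewrite ltr0n.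
have E k : ratr (k%:R / m%:R) = k%:R / m%:R :> R by rewrite fmorph_div !rmorph_nat.
rewrite /Defs.arc /= !E; split=> [[t]|<-].
  rewrite in_itv/= ler_pdivrMr// ltr_pdivlMr// mulrC => /andP[h1 h2] <-.
  apply: ccell_def => /=; have -> : Num.floor t = 0.
    apply/eqP; rewrite floor_eq add0r; apply/andP; split.
      by rewrite -(pmulr_rge0 _ mp); apply: le_trans h1.
    rewrite -(ltr_pM2l mp) mulr1; apply: lt_le_trans h2 _.
    by rewrite ler_nat.
  by rewrite subr0 h1.
exists (val z); last exact: to_circleK.
by rewrite in_itv/= ler_pdivrMr// ltr_pdivlMr// mulrC; exact: ccell_itv.
Qed.

Lemma cell_step m (c : {ffun 'I_N -> nat}) (s : 'M[C]_M) : c \in cells N m ->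
  step_fun (fun t => if cell m t == c then s else 0).
Proof.
rewrite mem_cells => /forallP cm.
exists 1%N, (fun _ j => (c j)%:R / m%:R), (fun _ j => (c j).+1%:R / m%:R), (fun=> s).
split=> // t; rewrite big_ord1 indicE.
case: eqP => tc; last first.
  rewrite memNset ?scale0r// => bt; apply: tc; apply/ffunP => j.
  by rewrite ffunE; apply/(arc_ccell _ (cm j)); exact: bt.
rewrite mem_set ?scale1r// => j; apply/(arc_ccell _ (cm j)).
by rewrite -tc ffunE.
Qed.

Section generated.
Variable Y : set (L2 -> L2).
Hypothesis Y_subalg : op_subalgebra Y.
Hypothesis Y_gen : @H_generators R N M `<=` Y.

Lemma generated_id : Y id.
Proof.
have -> : id = multiplication_op (fun=> 1%:M) :> (L2 -> L2).
  apply/funext => u; rewrite -[LHS]L2_funK; congr cls; apply/funext => t.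
  by rewrite mul1mx.
apply: Y_gen; right; exists (fun=> 1%:M) => //; apply: regulated_step.
have c0 : [ffun=> 0%N] \in cells N 1.
  by rewrite mem_cells; apply/forallP => i; rewrite ffunE.
have := cell_step 1%:M c0; congr step_fun; apply/funext => t; rewrite (_ : _ == _)//.
by apply/eqP/ffunP => j; rewrite !ffunE; apply/eqP; rewrite -leqn0 -ltnS ccell_lt.
Qed.

(** The translation by h along an axis is 1 + h D. *)
Lemma generated_along i q : Y (translate (along i (ratr q))).
Proof.
have [_ Yl _] := Y_subalg; have [->|q0] := eqVneq q 0.
  rewrite (_ : along i _ = fun=> 0) ?translate0; first exact: generated_id.
  by apply/funext => j; rewrite /along rmorph0 if_same.
have := Yl (ratr q) _ id (Y_gen (or_introl (ex_intro _ i (ex_intro _ q (conj q0 erefl))))) generated_id.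
rewrite finite_derivativeE scalerA divff ?scale1r ?subrK//.
by rewrite fmorph_eq0.
Qed.

(** A rational translation is the composite of translations along the axes. *)
Lemma generated_translate (q : 'I_N -> rat) : Y (translate (fun j => ratr (q j))).
Proof.
have [_ _ Yc] := Y_subalg.
have -> : (fun j => ratr (q j)) = fun j => \sum_i along i (ratr (q i)) j :> R.
  apply/funext => j; rewrite (bigD1 j)//= {1}/along eqxx big1 ?addr0// => i ij.
  by rewrite /along eq_sym (negbTE ij).
elim: (index_enum _) => [|i r IH].
  rewrite (_ : (fun j => _) = fun=> 0) ?translate0; first exact: generated_id.
  by apply/funext => j; rewrite big_nil.
rewrite (_ : (fun j => _) = fun j => along i (ratr (q i)) j +
  \sum_(k <- r) along k (ratr (q k)) j); last by apply/funext => j; rewrite big_cons.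
by rewrite -translateD; apply: Yc => //; exact: generated_along.
Qed.

(** A partial shift is a translation by a rational vector followed by the
   multiplication by a matrix that is supported on one cell. *)
Lemma generated_pshift m x y : x \in atoms N M m -> Y (pshift m x y).
Proof.
rewrite mem_atoms => /andP[xm _]; have [_ _ Yc] := Y_subalg.
pose S (t : torus R N) := if cell m t == x.1 then munit R M x.2 y.2 else 0.
have sS : step_fun S by exact: cell_step.
have -> : pshift m x y = multiplication_op S \o translate (disp R m x.1 y.1).
  apply/funext => u; have hu := sqint_vshift (disp R m x.1 y.1) (L2_sqint u).
  have cS := cellwise_step sS.
  rewrite /= /translate multiplication_class; try exact: sqint_cellwise.
  - congr cls; apply/funext => t; rewrite /pshift_fun /S /=.
    by case: ifP => // _; rewrite mul0mx.
  - by apply: sqint_cellwise => //; exact: L2_sqint.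
  - by [].
apply: Yc; first by apply: Y_gen; right; exists S => //; exact: regulated_step.
have -> : disp R m x.1 y.1 = fun j => ratr (((y.1 j)%:R - (x.1 j)%:R) / m%:R).
  by apply/funext => j; rewrite fmorph_div rmorphB !rmorph_nat.
exact: generated_translate.
Qed.
End generated.

Variable m : nat -> nat.
Hypothesis m_gt0 : forall l, (0 < m l)%N.
Hypothesis m_dvd : forall l, (m l %| m l.+1)%N.
Hypothesis m_cofinal : forall n, (0 < n)%N -> exists l, (n %| m l)%N.
Hypothesis M_gt0 : (0 < M)%N.
Local Notation X := (ops (natoms N M m) (@L2_unit R N M m)).
Let mun := L2_munits R N m_gt0 m_dvd m_cofinal M_gt0.

Lemma multiplication_ops S : cellwise S -> X (multiplication_op S).
Proof.
move=> [n n0 hS]; have [l nl] := m_cofinal n0.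
have hS' := cellwise_dvd n0 (m_gt0 l) nl hS.
pose F c := S (corner R (m l) c).
have -> : multiplication_op S = \sum_(c <- cells N (m l)) \sum_(i < M) \sum_(j < M)
    F c i j *: pshift (m l) (c, i : nat) (c, j : nat).
  apply/funext => u; have hu := L2_sqint u.
  have hp c i j : sqint_prop (fun t =>
      F c i j *: pshift_fun (m l) (c, i : nat) (c, j : nat) (L2_fun u) t).
    exact/sqint_scale/sqint_pshift.
  transitivity (cls (fun t => \sum_(c <- cells N (m l)) \sum_(i < M) \sum_(j < M)
      F c i j *: pshift_fun (m l) (c, i : nat) (c, j : nat) (L2_fun u) t)).
    congr cls; apply/funext => t; rewrite (cellwise_at (m_gt0 l) hS').
    exact: cell_mulmx.
  rewrite L2_class_sum; last by move=> c; apply: sqint_sum => i; exact: sqint_sum.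
  rewrite fct_sumE; apply: eq_bigr => c _.
  rewrite L2_class_sum; last by move=> i; exact: sqint_sum.
  rewrite fct_sumE; apply: eq_bigr => i _.
  rewrite L2_class_sum// fct_sumE; apply: eq_bigr => j _.
  by rewrite L2_class_scale//; exact: sqint_pshift.
apply: ops_sum => // c cl; apply: ops_sum => // i _; apply: ops_sum => // j _.
by apply: ops_scale => //; apply: pshift_ops => //; rewrite mem_atoms /= cl ltn_ord.
Qed.

(** A translation by multiples of the mesh permutes the cells cyclically in each
   direction; the displacement from a cell to its image is the translation vector
   up to integers. *)
Lemma translate_ops l (s : {ffun 'I_N -> nat}) :
  X (translate (fun j => (s j)%:R / (m l)%:R)).
Proof.
pose c' (c : {ffun 'I_N -> nat}) : {ffun 'I_N -> nat} := [ffun j => (c j + s j) %% m l]%N.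
have -> : translate (fun j => (s j)%:R / (m l)%:R) = \sum_(c <- cells N (m l)) \sum_(i < M)
    pshift (m l) (c, i : nat) (c' c, i : nat) :> (L2 -> L2).
  apply/funext => u; have hu := L2_sqint u.
  transitivity (cls (fun t => \sum_(c <- cells N (m l)) \sum_(i < M)
      pshift_fun (m l) (c, i : nat) (c' c, i : nat) (L2_fun u) t)); last first.
    rewrite L2_class_sum; last by move=> c; apply: sqint_sum => i; exact: sqint_pshift.
    rewrite fct_sumE; apply: eq_bigr => c _.
    by rewrite L2_class_sum ?fct_sumE// => i; exact: sqint_pshift.
  congr cls; apply/funext => t /=.
  set w := L2_fun u (vshift _ t).
  transitivity (\sum_(c <- cells N (m l)) if cell (m l) t == c then w else 0).
    by rewrite (sum_cell t (fun=> w)).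
  apply: eq_bigr => c _; rewrite /pshift_fun /=; case: ifP => _; last by rewrite big1.
  rewrite -mulmx_suml munit_sum mul1mx /w; congr (L2_fun u _).
  have mp : (m l)%:R != 0 :> R by rewrite pnatr_eq0 -lt0n.
  rewrite -[LHS](vshift_int (fun j => - ((c j + s j) %/ m l)%:Z)) vshiftD.
  congr vshift; apply/funext => j; rewrite /disp /c' ffunE.
  have := congr1 (fun k : nat => k%:R : R) (divn_eq (c j + s j) (m l)).
  rewrite natrD natrD natrM => e.
  rewrite (_ : ((c j + s j) %% m l)%:R = (c j)%:R + (s j)%:R -
    ((c j + s j) %/ m l)%:R * (m l)%:R :> R); last by rewrite e addrC addKr.
  by rewrite mulrNz; field.
apply: ops_sum => // c cl; apply: ops_sum => // i _.
apply: pshift_ops => //; rewrite mem_atoms /= ?cl ltn_ord//= andbT mem_cells.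
by apply/forallP => j; rewrite ffunE ltn_pmod.
Qed.

Lemma ops_id : X id.
Proof. by exists 0%N, 1%:M; rewrite (rho1 mun). Qed.

(** The step is a multiple of the mesh 1 / m l as soon as its denominator divides
   m l, and modulo integers it is a nonnegative one. *)
Lemma finite_derivative_ops i q : X (@finite_derivative R N M i q).
Proof.
have dq : (0 < `|denq q|)%N by rewrite absz_gt0 denq_neq0.
have [l /(mul_denq R)[A hA]] := m_cofinal dq.
have mp : (m l)%:R != 0 :> R by rewrite pnatr_eq0 -lt0n.
have mz : (m l)%:Z != 0 by rewrite eqz_nat -lt0n.
have [_ Xl _] := ops_subalg mun.
rewrite finite_derivativeE; apply: ops_scale => //.
rewrite -[translate _]scale1r addrC -scaleN1r.
apply: Xl; first exact: ops_id.
rewrite scale1r.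
pose s : {ffun 'I_N -> nat} := [ffun j => if j == i then `|(A %% m l)%Z|%N else 0%N].
have -> : along i (ratr q) = fun j => (s j)%:R / (m l)%:R +
    (if j == i then (A %/ m l)%Z else 0)%:~R :> R; last first.
  by rewrite translate_int; exact: translate_ops.
apply/funext => j; rewrite /along ffunE; case: ifP => _; last by rewrite mul0r addr0.
apply: (mulfI mp); rewrite hA {1}(divz_eq A (m l)) intrD intrM.
have -> : (`|(A %% m l)%Z|%N)%:R = ((A %% m l)%Z)%:~R :> R.
  by rewrite -[in RHS](gez0_abs (modz_ge0 A mz)).
by field.
Qed.

Let op_norm_closureE (Z : set (L2 -> L2)) : op_norm_closure Z = op_closure dot Z.
Proof.
by rewrite /op_norm_closure /bounded_ops (_ : @L2_norm R N M = hnorm dot)//;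
  apply/funext => u; exact: L2_normE.
Qed.

(** The generators lie in the closure of the partial shifts, and the partial
   shifts in every algebra that contains the generators. *)
Theorem H_algebraE : H_algebra R N M = op_closure dot X.
Proof.
rewrite /H_algebra op_norm_closureE; apply/seteqP; split; last first.
  apply: op_closure_mono => A [l [a ->]] Y [Ys Yg]; have [_ Yl _] := Ys.
  have Y0 : Y 0 by have [] := Ys.
  have Ysum (I : Type) (r : seq I) (F : I -> L2 -> L2) :
      (forall i, Y (F i)) -> Y (\sum_(i <- r) F i).
    move=> hF; elim: r => [|i r IH]; first by rewrite big_nil.
    by rewrite big_cons -[F i]scale1r; exact: Yl.
  rewrite (_ : rho _ a = \sum_p \sum_q a p q *: @L2_unit R N M m l p q).
    apply: (Ysum) => p; apply: Ysum => q; rewrite -[_ *: _]addr0; apply: Yl => //.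
    by apply: generated_pshift => //; exact: atom_in.
  by apply/funext => u; rewrite /rho fct_sumE; apply: eq_bigr => p _; rewrite fct_sumE.
suff sub : smallest (@op_subalgebra R N M) (@H_generators R N M) `<=` op_closure dot X.
  by move=> A /(op_closure_mono sub); exact: op_closure_idem.
apply: smallest_sub; first exact: (op_closure_subalg H (ops_bounded mun) (ops_subalg mun)).
move=> A [[i [q [_ ->]]]|[S hS ->]].
  exact: (sub_op_closure H (ops_bounded mun) (finite_derivative_ops i q)).
have cl S' : step_fun S' -> X (multiplication_op S').
  by move=> /cellwise_step; exact: multiplication_ops.
split; last first.
  move=> e e0; have [S' sS' h] := hS e e0.
  exists (multiplication_op S'); first exact: cl.
  exact: (multiplication_sub_bnd hS (regulated_step sS') (ltW e0) h).
split; first exact: multiplication_lin.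
have [S' sS' h] := hS 1 ltr01.
have [_ [k hk]] := ops_bounded mun (cl _ sS').
exists (1 + k); rewrite -[multiplication_op S](subrK (multiplication_op S')).
have b1 := multiplication_sub_bnd hS (regulated_step sS') ler01 h.
have := bnd_lin H 1 b1 hk; rewrite scale1r.
by rewrite /cmod /= expr0n addr0 expr1n sqrtr1 mul1r.
Qed.
End generators.

(** * The isomorphism and the unitary equivalence *)
Lemma factorial_cofinal n : (0 < n)%N -> exists l, (n %| (l.+1)`!)%N.
Proof. by case: n => // n _; exists n; rewrite factS dvdn_mulr. Qed.

Lemma factorial_dvd l : ((l.+1)`! %| (l.+2)`!)%N.
Proof. by rewrite [(l.+2)`!]factS dvdn_mull. Qed.

(** Conjugation by a unitary operator commutes with taking adjoints. *)
Lemma star_isomorphic_unitary (R : realType) (N M N' M' : nat)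
    (W : L2 R N' M' -> L2 R N M) (W' : L2 R N M -> L2 R N' M')
    (X' : set (L2 R N' M' -> L2 R N' M')) (X : set (L2 R N M -> L2 R N M))
    (A : starAlgType R[i]) :
  linear W -> (forall u v, L2_dot (W u) (W v) = L2_dot u v) -> cancel W W' ->
  cancel W' W -> X' = [set W' \o B \o W | B in X] ->
  star_isomorphic X' A -> star_isomorphic X A.
Proof.
move=> Wl Wd WK W'K XE [f [fl fM fs [fX finj fsurj]]].
exists (fun a => W \o f a \o W'); split.
- by move=> c a b; apply/funext => u; rewrite /= fl [LHS]Wl.
- by move=> a b; apply/funext => u; rewrite /= fM /= WK.
- by move=> a u v; rewrite /= -{1}[v]W'K Wd (fs a) -Wd W'K.
split.
- move=> a _; have := fX a I; rewrite XE => -[B XB <-].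
  by rewrite (_ : _ \o _ = B)//; apply/funext => u /=; rewrite !W'K.
- move=> a b _ _ ab; apply: finj; rewrite ?in_setT//; apply/funext => u.
  by apply: (can_inj WK); have := congr1 (fun g => g (W u)) ab; rewrite /= WK.
move=> B XB; have : X' (W' \o B \o W) by rewrite XE; exists B.
move=> /fsurj[a _ fa]; exists a => //.
by rewrite fa; apply/funext => u /=; rewrite !W'K.
Qed.

Theorem theorem1p1 (R : realType) (N M : nat) (hN : (0 < N)%N) (hM : (0 < M)%N) :
  (forall phi : uhf_system R, star_isomorphic (H_algebra R N M) (uhf phi)) /\
  exists (W : L2 R 1 1 -> L2 R N M) (V : L2 R N M -> L2 R 1 1),
    [/\ unitary_op W, cancel W V, cancel V W &
        H_algebra R 1 1 = [set V \o A \o W | A in H_algebra R N M]].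
Proof.
(* the mesh 1 / m' l on the circle gives as many matrix units as the mesh 1 / m l
   in dimension N with M components *)
pose m l := (l.+1)`!; pose m' l := (m l ^ N * M)%N.
have m0 l : (0 < m l)%N by exact: fact_gt0.
have m'0 l : (0 < m' l)%N by rewrite muln_gt0 expn_gt0 m0.
have m'd l : (m' l %| m' l.+1)%N by rewrite dvdn_mul// dvdn_exp2r// factorial_dvd.
have m'c n : (0 < n)%N -> exists l, (n %| m' l)%N.
  move=> /factorial_cofinal[l nl]; exists l; rewrite dvdn_mulr//.
  by apply: (dvdn_trans nl); rewrite dvdn_exp.
have S := L2_munits R N m0 factorial_dvd factorial_cofinal hM.
have S' := L2_munits R 1 m'0 m'd m'c (ltn0Sn 0).
have d'E : natoms 1 1 m' = natoms N M m by apply/funext => l; rewrite /natoms expn1 muln1.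
have HE := H_algebraE R N m0 factorial_dvd factorial_cofinal hM.
have H'E := H_algebraE R 1 m'0 m'd m'c (ltn0Sn 0).
rewrite d'E in S' H'E.
have [W [V [Wl Wd WK VK HV]]] := unitary_equivalence S' S.
rewrite -HE -H'E in HV.
split; last by exists W, V; split=> //; split=> //; exists V.
move=> phi; apply: (star_isomorphic_unitary Wl Wd WK VK HV).
have S1 := L2_munits R 1 m0 factorial_dvd factorial_cofinal (ltn0Sn 0).
have H1E := H_algebraE R 1 m0 factorial_dvd factorial_cofinal (ltn0Sn 0).
have d1E : natoms 1 1 m = fun l => (l.+1)`!.
  by apply/funext => l; rewrite /natoms expn1 muln1.
rewrite d1E in S1 H1E.
by rewrite H1E; have [f hf] := uhf_isomorphism S1 phi; exists f.
Qed.
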